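(* If $\theta\in(0,\pi/2)$ and $\mu$ is a $\Gamma$-invariant $(b,\theta)$-density, $b=(b_1,b_2)\in\mathbb R^2$, which gives positive measure to the radial limit set $L_\Gamma^{rad}$, then $$\delta_\theta(\Gamma)=b_1\cos\theta+b_2\sin\theta .$$
   Context: Setting. A Hadamard space is a complete geodesic CAT(0) metric space. $(X_1,d_1)$, $(X_2,d_2)$ are locally compact Hadamard spaces, and $X=X_1\times X_2$ carries the metric $d=\sqrt{d_1^2+d_2^2}$. $\partial X$, $\partial X_i$ are the geometric boundaries (classes of asymptotic geodesic rays, cone topology). An isometry $h$ of a Hadamard space is axial if there are $l>0$ and a geodesic line $\sigma$ with $h(\sigma(t))=\sigma(t+l)$ for all $t\in\mathbb R$; such $\sigma$ is an axis. It is rank one if it has an axis which does not bound a flat half-plane. Two rank one isometries are independent if their fixed point sets in the geometric boundary are disjoint. $\Gamma\subset \mathrm{Is}(X_1)\times \mathrm{Is}(X_2)$ is a discrete group containing elements $g=(g_1,g_2)$ and $h=(h_1,h_2)$ such that for $i=1,2$, $g_i$ and $h_i$ are independent rank one isometries of $X_i$. $o=(o_1,o_2)\in X$ is a fixed base point. Limit set and slope. $L_\Gamma=\overline{\Gamma\cdot x}\cap\partial X$ (independent of $x\in X$). Every geodesic ray in $X$ has the form $\sigma(t)=(\sigma_1(t\cos\theta),\sigma_2(t\sin\theta))$ with geodesic rays $\sigma_i$ in $X_i$ and $\theta\in[0,\pi/2]$ its slope (a factor being constant if its speed is $0$), which depends only on the boundary point. $\partial X_\theta$ is the set of points of $\partial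 X$ of slope $\theta$; for $\theta\in(0,\pi/2)$ it is identified with $\partial X_1\times\partial X_2$ and its points are written $(\eta_1,\eta_2,\theta)$; $\partial X_0\cong\partial X_1$ and $\partial X_{\pi/2}\cong\partial X_2$. Radial limit set. A point $\tilde\xi\in\partial X$ is a radial limit point if there is a sequence $\gamma_n=(\gamma_{n,1},\gamma_{n,2})\in\Gamma$ such that $\gamma_no\to\tilde\xi$ and: if $\tilde\xi=(\xi_1,\xi_2,\theta)$ with $\theta\in(0,\pi/2)$, then for both $i\in\{1,2\}$ the sequence $\gamma_{n,i}o_i$ stays at bounded distance of one (hence any) geodesic ray in the class of $\xi_i$; if $\tilde\xi=\xi_i\in\partial X_i$ ($i=1$ for slope $0$, $i=2$ for slope $\pi/2$), then $\gamma_{n,i}o_i$ stays at bounded distance of one (hence any) geodesic ray in the class of $\xi_i$. $L_\Gamma^{rad}$ is the set of radial limit points. Exponent of growth. $\delta_\theta(\Gamma)=\liminf_{\varepsilon\to0}\limsup_{n\to\infty}\frac1n\log N_\theta^\varepsilon(n)$, where $N_\theta^\varepsilon(n)=\#\{\gamma=(\gamma_1,\gamma_2)\in\Gamma: n-1<d(o,\gamma o)\le n,\ |\arctan\frac{d_2(o_2,\gamma_2o_2)}{d_1(o_1,\gamma_1o_1)}-\theta|<\varepsilon\}$ (with $\arctan(a/0)=\pi/2$ for $a>0$). $(b,\theta)$-density. For $\eta_i\in\partial X_i$, $\mathcal B_{\eta_i}(x_i,y_i)=\lim_{t\to\infty}(d_i(x_i,\sigma(t))-d_i(y_i,\sigma(t)))$,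 $\sigma$ any ray in the class of $\eta_i$. $\mathcal M^+(\partial X)$ is the cone of positive finite Borel measures on $\partial X$ (weak topology). For $\theta\in(0,\pi/2)$ and $b=(b_1,b_2)\in\mathbb R^2$, a $\Gamma$-invariant $(b,\theta)$-density is a continuous map $\mu:X\to\mathcal M^+(\partial X)$, $x\mapsto\mu_x$, such that for all $x=(x_1,x_2)\in X$: (i) $\emptyset\ne\mathrm{supp}(\mu_x)\subseteq L_\Gamma\cap\partial X_\theta$; (ii) $\gamma_*\mu_x=\mu_{\gamma x}$ for all $\gamma\in\Gamma$, where $\gamma_*\mu_x(E)=\mu_x(\gamma^{-1}E)$; (iii) $\frac{d\mu_x}{d\mu_o}(\tilde\eta)=e^{b_1\mathcal B_{\eta_1}(o_1,x_1)+b_2\mathcal B_{\eta_2}(o_2,x_2)}$ for all $\tilde\eta=(\eta_1,\eta_2,\theta)\in\mathrm{supp}(\mu_o)$. The density gives positive measure to a set $E$ if $\mu_o(E)>0$ (equivalently $\mu_x(E)>0$ for all $x$). *)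

(* Defs.v *)
From HB Require Import structures.
From mathcomp Require Import all_boot all_order all_algebra generic_quotient.
From mathcomp Require Import all_classical all_reals all_analysis.
From mathcomp Require Import ring.

Set Implicit Arguments.
Unset Strict Implicit.
Unset Printing Implicit Defensive.

Import Order.TTheory GRing.Theory Num.Theory.
Import numFieldNormedType.Exports.

Local Open Scope classical_set_scope.
Local Open Scope quotient_scope.
Local Open Scope ring_scope.

Definition l2prod (R : realType) (X1 X2 : metricType R) : Type :=
  (X1 * X2)%type.

Section L2Product.
Context (R : realType) (X1 X2 : metricType R).
Local Notation X := (l2prod X1 X2).

HB.instance Definition _ := Choice.copy X (X1 * X2)%type.

Definition l2dist (x y : X) : R :=
  Num.sqrt (mdist x.1 y.1 ^+ 2 + mdist x.2 y.2 ^+ 2).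

Let l2distxx x : l2dist x x = 0.
Proof. by rewrite /l2dist !mdistxx expr0n addr0 sqrtr0. Qed.

Let l2dist_positivity x y : l2dist x y = 0 -> x = y.
Proof.
case: x y => [x1 x2] [y1 y2] /eqP; rewrite /l2dist sqrtr_eq0 /= => le0.
have := conj (sqr_ge0 (mdist x1 y1)) (sqr_ge0 (mdist x2 y2)) => -[p1 p2].
have : mdist x1 y1 ^+ 2 + mdist x2 y2 ^+ 2 == 0.
  by rewrite eq_le le0 addr_ge0.
rewrite paddr_eq0// !expf_eq0/= => /andP[/eqP e1 /eqP e2].
by rewrite (mdist_positivity _ _ e1) (mdist_positivity _ _ e2).
Qed.

Let l2dist_sym x y : l2dist x y = l2dist y x.
Proof. by rewrite /l2dist metric_sym (metric_sym x.2). Qed.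

Let minkowski2 (a b c d : R) : 0 <= a -> 0 <= b -> 0 <= c -> 0 <= d ->
  Num.sqrt ((a + b) ^+ 2 + (c + d) ^+ 2) <=
  Num.sqrt (a ^+ 2 + c ^+ 2) + Num.sqrt (b ^+ 2 + d ^+ 2).
Proof.
move=> a0 b0 c0 d0.
have p0 : 0 <= a ^+ 2 + c ^+ 2 by rewrite addr_ge0 ?sqr_ge0.
have q0 : 0 <= b ^+ 2 + d ^+ 2 by rewrite addr_ge0 ?sqr_ge0.
rewrite -[leRHS]ger0_norm ?addr_ge0 ?sqrtr_ge0// -sqrtr_sqr.
apply: ler_wsqrtr; rewrite [leRHS]sqrrD !sqr_sqrtr// -sqrtrM//.
suff : a * b + c * d <= Num.sqrt ((a ^+ 2 + c ^+ 2) * (b ^+ 2 + d ^+ 2)).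
  set s := Num.sqrt _; rewrite !sqrrD => h.
  have : (a * b + c * d) *+ 2 <= s *+ 2 by rewrite lerMn2r h orbT.
  rewrite mulrnDl => h2.
  have -> : a ^+ 2 + a * b *+ 2 + b ^+ 2 + (c ^+ 2 + c * d *+ 2 + d ^+ 2) =
    a ^+ 2 + c ^+ 2 + (a * b *+ 2 + c * d *+ 2) + (b ^+ 2 + d ^+ 2).
    by rewrite [LHS](AC (3*3) (1*4*(2*5)*(3*6))).
  by rewrite lerD2r lerD2l.
rewrite -[leLHS]ger0_norm ?addr_ge0 ?mulr_ge0// -sqrtr_sqr.
apply: ler_wsqrtr; rewrite -subr_ge0.
rewrite (_ : _ - _ = (a * d - b * c) ^+ 2) ?sqr_ge0//.
by rewrite !expr2 !(mulrDl, mulrDr, mulrBl, mulrBr, opprD, mulNr, mulrN);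
  ring.
Qed.

Let l2dist_triangle y x z : l2dist x z <= l2dist x y + l2dist y z.
Proof.
apply: le_trans (minkowski2 _ _ _ _); rewrite ?mdist_ge0//.
by apply: ler_wsqrtr; apply: lerD; rewrite ler_pXn2r ?nnegrE ?addr_ge0
  ?mdist_ge0//; exact: metric_triangle.
Qed.

HB.instance Definition _ := @isMetric.Build R X l2dist
  l2distxx l2dist_positivity l2dist_sym l2dist_triangle.

End L2Product.

Section Isometries.
Context (R : realType).

Record isometryType (X : metricType R) : Type := Isometry {
  isom_fun :> X -> X ;
  isomP : forall x y, mdist (isom_fun x) (isom_fun y) = mdist x y ;
  isom_surj : set_surj setT setT isom_fun }.

Context (X : metricType R).

Lemma isometry_ext (f g : isometryType X) : (f : X -> X) =1 g -> f = g.
Proof.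
case: f g => [f pf sf] [g pg sg] /= /funext fg; subst g.
by rewrite (Prop_irrelevance pf pg) (Prop_irrelevance sf sg).
Qed.

HB.instance Definition _ := gen_eqMixin (isometryType X).
HB.instance Definition _ := gen_choiceMixin (isometryType X).

Definition isom_one : isometryType X.
Proof. by exists id => // x _; exists x. Defined.

Definition isom_mul (f g : isometryType X) : isometryType X.
Proof.
exists (f \o g) => [x y|z _] /=; first by rewrite !isomP.
have [y _ <-] := @isom_surj _ f z I; have [x _ <-] := @isom_surj _ g y I.
by exists x.
Defined.

Lemma isom_ex_inv (f : isometryType X) y : exists x, f x = y.
Proof. by have [x _ <-] := @isom_surj _ f y I; exists x. Qed.

Definition isom_inv_fun (f : isometryType X) (y : X) : X :=
  sval (cid (isom_ex_inv f y)).

Lemma isom_inv_funK (f : isometryType X) y : f (isom_inv_fun f y) = y.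
Proof. by rewrite /isom_inv_fun; case: cid. Qed.

Definition isom_inv (f : isometryType X) : isometryType X.
Proof.
exists (isom_inv_fun f) => [x y|x _].
  by rewrite -(isomP f) !isom_inv_funK.
exists (f x) => //; apply: mdist_positivity.
by rewrite -(isomP f) isom_inv_funK mdistxx.
Defined.

Let isom_mulA : associative isom_mul.
Proof. by move=> f g h; exact: isometry_ext. Qed.

Let isom_mul1 : left_id isom_one isom_mul.
Proof. by move=> f; exact: isometry_ext. Qed.

Let isom_mulr1 : right_id isom_one isom_mul.
Proof. by move=> f; exact: isometry_ext. Qed.

Let isom_mulrV : right_inverse isom_one isom_inv isom_mul.
Proof. by move=> f; apply: isometry_ext => x; exact: isom_inv_funK. Qed.

Let isom_mulVr : left_inverse isom_one isom_inv isom_mul.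
Proof.
move=> f; apply: isometry_ext => x; apply: mdist_positivity.
by rewrite /= -(isomP f) isom_inv_funK mdistxx.
Qed.

HB.instance Definition _ := isGroup.Build (isometryType X)
  isom_mulA isom_mul1 isom_mulr1 isom_mulVr isom_mulrV.

(* Used for discreteness: on isometries, the compact-open topology is also the
   topology of pointwise convergence. *)
HB.instance Definition _ := Topological.copy (isometryType X)
  (initial_topology (fun f : isometryType X => (f : {compact-open, X -> X}))).

End Isometries.

(* Unlike Is(X1 x X2), Is(X1) x Is(X2) is a plain product of groups. *)
Definition prod_isom (R : realType) (X1 X2 : metricType R)
  (g : isometryType X1 * isometryType X2) : isometryType (l2prod X1 X2).
Proof.
exists (fun x : l2prod X1 X2 => (g.1 x.1, g.2 x.2)).
  by move=> x y; rewrite /mdist/= /l2dist/= !isomP.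
move=> [y1 y2] _; have [x1 e1] := isom_ex_inv g.1 y1.
by have [x2 e2] := isom_ex_inv g.2 y2; exists (x1, x2) => //=; rewrite e1 e2.
Defined.

Definition discrete_subset (T : topologicalType) (A : set T) : Prop :=
  A `<=` isolated A.

Section Hadamard.
Context (R : realType) (X : metricType R).
Implicit Types (c : R -> X) (p q : X).

Definition geodesic_segment c p q : Prop :=
  [/\ c 0 = p, c (mdist p q) = q &
      {in `[0, mdist p q] &, forall s t, mdist (c s) (c t) = `|s - t|}].

Definition geodesic_line c : Prop := forall s t, mdist (c s) (c t) = `|s - t|.

(* Only the restriction to [0, +oo[ is meaningful. *)
Definition geodesic_ray c : Prop :=
  {in `[0, +oo[ &, forall s t, mdist (c s) (c t) = `|s - t|}.

Definition euclidean_plane := l2prod R^o R^o.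

(* A triangle p, q, r with comparison triangle p', q', r', a point x = c s of
   the side [p, q], a point y = c' t of the side [p, r], and their comparison
   points x', y'; every pair of sides is obtained by naming p their common
   vertex. *)
Definition cat0 : Prop :=
  forall (p q r : X) (c c' : R -> X)
      (p' q' r' x' y' : euclidean_plane) (s t : R),
    geodesic_segment c p q -> geodesic_segment c' p r ->
    mdist p' q' = mdist p q -> mdist p' r' = mdist p r ->
    mdist q' r' = mdist q r ->
    s \in `[0, mdist p q] -> t \in `[0, mdist p r] ->
    mdist p' x' = s -> mdist x' q' = mdist p q - s ->
    mdist p' y' = t -> mdist y' r' = mdist p r - t ->
    mdist (c s) (c' t) <= mdist x' y'.

Record hadamard : Prop := {
  hadamard_complete : forall F : set_system X,
    ProperFilter F -> cauchy F -> exists x : X, F --> x ;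
  hadamard_geodesic : forall p q, exists c, geodesic_segment c p q ;
  hadamard_cat0 : cat0 }.

Definition axis (h : isometryType X) c : Prop :=
  geodesic_line c /\ exists2 l : R, 0 < l & forall t, h (c t) = c (t + l).

Definition bounds_flat_half_plane c : Prop :=
  exists F : R -> R -> X,
    (forall s, F s 0 = c s) /\
    forall s s' t t', 0 <= t -> 0 <= t' ->
      mdist (F s t) (F s' t') = Num.sqrt ((s - s') ^+ 2 + (t - t') ^+ 2).

Definition rank_one (h : isometryType X) : Prop :=
  exists2 c, axis h c & ~ bounds_flat_half_plane c.

End Hadamard.

Section Boundary.
Context (R : realType).

Record ray (X : metricType R) : Type := Ray {
  ray_fun :> R -> X ; rayP : geodesic_ray ray_fun }.

Context (X : metricType R).

HB.instance Definition _ := gen_eqMixin (ray X).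
HB.instance Definition _ := gen_choiceMixin (ray X).

Definition asymptotic (c c' : ray X) : bool :=
  `[< exists C : R, forall t, 0 <= t -> mdist (c t) (c' t) <= C >].

Let asymptotic_refl : reflexive asymptotic.
Proof. by move=> c; apply/asboolP; exists 0 => t _; rewrite mdistxx. Qed.

Let asymptotic_sym : symmetric asymptotic.
Proof.
by move=> c c'; apply/idP/idP => /asboolP[C h]; apply/asboolP; exists C => t t0;
  rewrite metric_sym; exact: h.
Qed.

Let asymptotic_trans : transitive asymptotic.
Proof.
move=> c c1 c2 /asboolP[C h] /asboolP[C' h']; apply/asboolP.
exists (C + C') => t t0; apply: le_trans (metric_triangle _ (c t) _) _.
by apply: lerD; [exact: h|exact: h'].
Qed.

Canonical asymptotic_equiv :=
  EquivRel asymptotic asymptotic_refl asymptotic_sym asymptotic_trans.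

Definition boundary : Type := {eq_quot asymptotic}.

HB.instance Definition _ := Choice.on boundary.

Definition bclass (c : ray X) : boundary := \pi_({eq_quot asymptotic}) c.

Definition brepr (xi : boundary) : ray X := repr (xi : {eq_quot asymptotic}).

Definition ray_comp (f : isometryType X) (c : ray X) : ray X.
Proof. by exists (f \o c) => s t s0 t0; rewrite /= isomP (rayP c). Defined.

Definition bact (f : isometryType X) (xi : boundary) : boundary :=
  bclass (ray_comp f (brepr xi)).

Definition fixed_points (f : isometryType X) : set boundary :=
  [set xi | bact f xi = xi].

Definition independent_rank_one (f g : isometryType X) : Prop :=
  [/\ rank_one f, rank_one g &
      fixed_points f `&` fixed_points g = set0].

(* Independent of the chosen ray when X is a Hadamard space. *)
Definition busemann (eta : boundary) (x y : X) : R :=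
  lim ((mdist x (brepr eta t) - mdist y (brepr eta t)) @[t --> +oo%R]).

Definition near_ray (u : nat -> X) (eta : boundary) : Prop :=
  exists2 c : ray X, bclass c = eta &
    exists C : R, forall n, exists2 t, 0 <= t & mdist (u n) (c t) <= C.

Definition bordification (o : X) : Type := (X + boundary)%type.

HB.instance Definition _ (o : X) := Choice.on (bordification o).

End Boundary.

Section ConeTopology.
Context (R : realType) (X : metricType R) (o : X).
Local Notation Xbar := (bordification o).

(* The geodesic from o to z, on [0, +oo[: eventually constant if z lies in X. *)
Definition geodesic_from (z : Xbar) (c : R -> X) : Prop :=
  match z with
  | inl x => geodesic_segment c o x /\ forall t, mdist o x <= t -> c t = x
  | inr xi => exists2 r : ray X, bclass r = xi & r 0 = o /\ c = r
  end.

Definition cone_nbhd (z : Xbar) (r e : R) : set Xbar :=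
  [set w | exists c c', [/\ geodesic_from z c, geodesic_from w c' &
    forall t, 0 <= t <= r -> mdist (c t) (c' t) < e]].

(* Uniform convergence on compact sets of the geodesics issuing from o. *)
Definition cone_open (A : set Xbar) : Prop :=
  forall z, A z -> exists2 r : R, 0 < r & exists2 e : R, 0 < e &
    cone_nbhd z r e `<=` A.

Let cone_openT : cone_open setT.
Proof. by move=> z _; exists 1 => //; exists 1. Qed.

Let cone_openI : setI_closed cone_open.
Proof.
move=> A B oA oB z [/oA[r r0 [e e0 zA]] /oB[r' r'0 [e' e'0 zB]]].
exists (Num.max r r'); first by rewrite lt_max r0.
exists (Num.min e e'); first by rewrite lt_min e0.
move=> w [c [c' [zc wc' cc']]]; split; [apply: zA|apply: zB];
  exists c, c'; split=> // t /andP[t0 tr];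
  (have := cc' t; rewrite t0 le_max tr ?orbT lt_min => /(_ isT)/andP[//]).
Qed.

Let cone_open_bigU (I : Type) (f : I -> set Xbar) :
  (forall i, cone_open (f i)) -> cone_open (\bigcup_i f i).
Proof.
move=> of_ z [i _ /of_[r r0 [e e0 h]]]; exists r => //; exists e => // w /h.
by exists i.
Qed.

HB.instance Definition _ :=
  isOpenTopological.Build Xbar cone_openT cone_openI cone_open_bigU.

End ConeTopology.

(* Measurable types are pointed, hence the parameter xi0; neither the topology
   nor the Borel sigma-algebra depends on it. *)
Definition tboundary (R : realType) (X : metricType R) (o : X)
  (xi0 : boundary X) : Type := boundary X.

Section BoundaryTopology.
Context (R : realType) (X : metricType R) (o : X) (xi0 : boundary X).
Local Notation bX := (tboundary o xi0).

HB.instance Definition _ := Choice.on bX.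
HB.instance Definition _ := isPointed.Build bX xi0.
HB.instance Definition _ := Topological.copy bX
  (initial_topology (inr : boundary X -> bordification o)).

HB.instance Definition _ := @isMeasurable.Build (sigma_display (@open bX))
  bX <<s @open bX >> (@sigma_algebra0 _ setT _) (@sigma_algebraC bX _)
  (@sigma_algebra_bigcup _ setT _).

Definition msupport (mu : set bX -> \bar R) : set bX :=
  [set xi | forall U : set bX, open U -> U xi -> (0 < mu U)%E].

End BoundaryTopology.

Section Product.
Context (R : realType) (X1 X2 : metricType R).
Local Notation X := (l2prod X1 X2).
Local Notation G := (isometryType X1 * isometryType X2)%type.
Implicit Types (Gamma : set G) (xi : boundary X).

(* xi = (eta1, eta2, theta), for 0 < theta < pi / 2. *)
Definition bpoint (eta1 : boundary X1) (eta2 : boundary X2) (theta : R) xi :=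
  exists (c1 : ray X1) (c2 : ray X2) (c : ray X),
    [/\ bclass c1 = eta1, bclass c2 = eta2, bclass c = xi &
        forall t, 0 <= t -> c t = (c1 (t * cos theta), c2 (t * sin theta))].

(* xi has slope 0, resp. pi / 2, and corresponds to eta1, resp. eta2. *)
Definition bpoint1 (eta1 : boundary X1) xi :=
  exists (c1 : ray X1) (x2 : X2) (c : ray X),
    [/\ bclass c1 = eta1, bclass c = xi & forall t, 0 <= t -> c t = (c1 t, x2)].

Definition bpoint2 (eta2 : boundary X2) xi :=
  exists (x1 : X1) (c2 : ray X2) (c : ray X),
    [/\ bclass c2 = eta2, bclass c = xi & forall t, 0 <= t -> c t = (x1, c2 t)].

Definition boundary_slope (theta : R) : set (boundary X) :=
  [set xi | exists eta1 eta2, bpoint eta1 eta2 theta xi].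

Context (o : X).

Definition limit_set Gamma : set (boundary X) :=
  [set xi | closure [set (inl (prod_isom g o) : bordification o) | g in Gamma]
              (inr xi)].

Definition radial_limit_set Gamma : set (boundary X) :=
  [set xi | exists gamma : nat -> G,
    [/\ forall n, Gamma (gamma n),
        (inl (prod_isom (gamma n) o) : bordification o) @[n --> \oo]
          --> (inr xi : bordification o) &
        [\/ exists eta1 eta2 theta,
              [/\ 0 < theta < pi / 2, bpoint eta1 eta2 theta xi,
                  near_ray (fun n => (gamma n).1 o.1) eta1 &
                  near_ray (fun n => (gamma n).2 o.2) eta2],
            exists2 eta1, bpoint1 eta1 xi &
              near_ray (fun n => (gamma n).1 o.1) eta1 |
            exists2 eta2, bpoint2 eta2 xi &
              near_ray (fun n => (gamma n).2 o.2) eta2]]].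

(* The value at (0, 0) is immaterial: it only affects orbit_count at n = 0. *)
Definition slope_angle (x y : X) : R :=
  if mdist x.1 y.1 == 0 then pi / 2 else atan (mdist x.2 y.2 / mdist x.1 y.1).

Definition orbit_count Gamma (theta eps : R) (n : nat) : \bar R :=
  counting [set g | [/\ Gamma g,
    n%:R - 1 < mdist o (prod_isom g o) <= n%:R &
    `|slope_angle o (prod_isom g o) - theta| < eps]].

(* lne 0 = -oo; eps tends to 0 from the right. *)
Definition growth_exponent Gamma (theta : R) : \bar R :=
  limf_einf (fun eps : R => limn_esup (fun n =>
    (n%:R^-1)%:E * lne (orbit_count Gamma theta eps n))%E) 0^'+.

Context (xi0 : boundary X).
Local Notation bX := (tboundary o xi0).

(* Weak continuity is tested on all continuous functions, the boundary of a
   locally compact Hadamard space being compact. The Radon-Nikodym derivative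
   is defined up to null sets only, whence the almost everywhere quantifier
   over the support of mu o; it takes a default value without domination. *)
Record invariant_density Gamma (b1 b2 theta : R)
    (mu : X -> {finite_measure set bX -> \bar R}) : Prop := {
  density_weak_continuous : forall f : bX -> R, continuous f ->
    continuous (fun x : X => \int[mu x]_xi f xi) ;
  density_support_neq0 : forall x, msupport (mu x) !=set0 ;
  density_support : forall x,
    msupport (mu x) `<=` limit_set Gamma `&` boundary_slope theta ;
  density_invariant : forall g x (E : set bX), Gamma g -> measurable E ->
    pushforward (mu x) (bact (prod_isom g) : bX -> bX) E
      = mu (prod_isom g x) E ;
  density_dominated : forall x, mu x `<< mu o ;
  density_derivative : forall x, {ae mu o, forall xi : bX,
    msupport (mu o) xi -> forall eta1 eta2, bpoint eta1 eta2 theta xi ->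
      Radon_Nikodym (charge_of_finite_measure (mu x)) (mu o) xi
      = (expR (b1 * busemann eta1 o.1 x.1 + b2 * busemann eta2 o.2 x.2))%:E} }.

End Product.

(* Main.v *)
(* An axis of a rank one isometry bounds no flat half-plane. By properness, the
   distance from x to the point c s of the axis c then grows with slope almost 1
   as soon as s is well past the projection of x, and therefore every geodesic
   whose end points project far on both sides of c m passes uniformly close to
   c m. With two independent rank one elements in each factor, a finite subset
   of Gamma suffices to move any given point of X to the repelling side of both
   axes. Hence some open neighbourhood W of a point of the support of mu o
   satisfies: for every y in X there is k in a finite subset of Gamma such that
   the part of W of slope theta lies in the shadow, seen from k y, of a ball of
   fixed radius around k o. By invariance, the shadow of the ball around o seen
   from y has mu o-measure bounded below uniformly in y, and by conformality the
   measure of the shadow of a ball around k o seen from o is, up to bounded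
   factors, exp (- b1 d1(o1, k o1) - b2 d2(o2, k o2)).

   As Gamma is discrete, the shadows of the orbit points with n - 1 < d <= n
   overlap at most polynomially often in n, and comparing with the total mass
   gives the upper bound on the growth exponent. Conversely the radial limit
   points of slope theta lie in infinitely many of these shadows, with slopes
   tending to theta; if the exponent were smaller, the measures of the shadows
   would be summable and the radial limit set null by Borel-Cantelli. *)

(* Two obstacles shape the proof. The first is uniformity: comparing lengths shows that a geodesic
   between points at height at most H above a rank one axis passes near it, but with constants that
   grow with H, while the end points met later are arbitrarily far from the axis. The dependence on
   H is removed by continuity: one end point moves in steps of length at most 1, the geodesic
   follows, and after each step the slightly degraded distance to the axis is improved back to its
   old value, because a geodesic known to pass at a fixed distance can be cut at points of bounded
   height. The second is that one element of Gamma has to act well on both factors at once, and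
   Gamma need not contain the components of its elements separately; the finite subset keeps more
   candidates than there can be bad ones. The equality is exact because every loss is
   subexponential: bounded factors from Busemann functions, a quadratic overlap of the shadows, and
   an error n eta in the weights b1 d1 + b2 d2 of orbit points with slope within eps of theta, where
   eta is arbitrary once eps is small. *)
Require Import Defs.
From mathcomp Require Import all_boot all_order all_algebra generic_quotient.
From mathcomp Require Import all_classical all_reals all_analysis.
From mathcomp Require Import measurable_realfun.
From mathcomp Require Import ring lra zify.

Set Implicit Arguments.
Unset Strict Implicit.
Unset Printing Implicit Defensive.

Import Order.TTheory GRing.Theory Num.Theory.
Import numFieldNormedType.Exports.

Local Open Scope classical_set_scope.
Local Open Scope ring_scope.

(** * CN inequality *)

(* Complete CAT(0) spaces with compact balls, in the form in which they are used:
   geo p q u is the point at distance u d(p, q) from p on the geodesic from p to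
   q, and geo_cn is the inequality of Bruhat and Tits. Properness is stated with
   ultrafilters, along which arbitrary bounded families of points converge. *)
Record cnspace (R : realType) (X : metricType R) : Type := CNSpace {
  geo : X -> X -> R -> X ;
  geo_distl : forall p q (u : R), 0 <= u <= 1 -> mdist p (geo p q u) = u * mdist p q ;
  geo_distr : forall p q (u : R), 0 <= u <= 1 ->
    mdist (geo p q u) q = (1 - u) * mdist p q ;
  geo_cn : forall x p q (u : R), 0 <= u <= 1 -> mdist x (geo p q u) ^+ 2 <=
    (1 - u) * mdist x p ^+ 2 + u * mdist x q ^+ 2
    - u * (1 - u) * mdist p q ^+ 2 ;
  cn_proper : forall (I : Type) (F : set_system I) (f : I -> X) p C,
    UltraFilter F -> F [set i | mdist p (f i) <= C] ->
    exists x : X, f @ F --> (x : X) }.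

Section CN.
Context (R : realType) (X : metricType R) (M : cnspace X).
Implicit Types (p q x y z w : X) (u v s t : R).
Local Notation d := mdist.
Local Notation geo := (geo M).

Lemma sqr_le_le (a b : R) : 0 <= b -> a ^+ 2 <= b ^+ 2 -> a <= b.
Proof. by move=> b0 h; rewrite leNgt; apply/negP => ba; nra. Qed.

(** The point [z] is tested against the CN inequality itself: under the two bounds the right side is
    nonpositive. Upper bounds suffice, which is how points are identified below. *)
Lemma geo_uniq p q u z : 0 <= u <= 1 ->
  d p z <= u * d p q -> d z q <= (1 - u) * d p q -> z = geo p q u.
Proof.
move=> u01 h1 h2; apply: mdist_positivity.
have := geo_cn M z p q u01.
have := mdist_ge0 p q; have := mdist_ge0 p z; have := mdist_ge0 z q.
have := mdist_ge0 z (geo p q u).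
rewrite (metric_sym z p) => p1 p2 p3 p4 h.
have a1 : d p z ^+ 2 <= (u * d p q) ^+ 2 by rewrite ler_pXn2r ?nnegrE//; nra.
have a2 : d z q ^+ 2 <= ((1 - u) * d p q) ^+ 2
  by rewrite ler_pXn2r ?nnegrE//; nra.
have : d z (geo p q u) ^+ 2 <= 0.
  have [u0 u1] := andP u01.
  have a3 := ler_wpM2l u0 a2.
  have u1' : 0 <= 1 - u by lra.
  have a4 := ler_wpM2l u1' a1.
  nra.
by move=> h0; apply/eqP; rewrite -sqrf_eq0 eq_le h0 sqr_ge0.
Qed.

Lemma geo0 p q : geo p q 0 = p.
Proof.
by apply/esym/geo_uniq; rewrite ?lexx ?ler01// ?mdistxx ?mul0r// subr0 mul1r.
Qed.

Lemma geo1 p q : geo p q 1 = q.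
Proof.
by apply/esym/geo_uniq; rewrite ?lexx ?ler01// ?mdistxx ?mul1r// subrr mul0r.
Qed.

Lemma geo_sym p q u : 0 <= u <= 1 -> geo p q u = geo q p (1 - u).
Proof.
move=> u01; apply: geo_uniq; first by lra.
  by rewrite metric_sym geo_distr// (metric_sym q).
by rewrite metric_sym geo_distl// (metric_sym q) subKr.
Qed.

Lemma geoxx p u : 0 <= u <= 1 -> geo p p u = p.
Proof. by move=> u01; apply/esym/geo_uniq; rewrite ?mdistxx ?mulr0. Qed.

(** The CN inequality on the side from [x] to [z], then on the side from [x] to [y]. By the law of
    cosines, the right side is the squared distance of the corresponding points in the Euclidean
    comparison triangle. *)
Lemma geo_geo x y z (a b : R) : 0 <= a <= 1 -> 0 <= b <= 1 ->
  d (geo x y a) (geo x z b) ^+ 2 <= a ^+ 2 * d x y ^+ 2 + b ^+ 2 * d x z ^+ 2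
    + a * b * (d y z ^+ 2 - d x y ^+ 2 - d x z ^+ 2).
Proof.
move=> a01 b01.
have h1 := geo_cn M (geo x y a) x z b01.
have h2 := geo_cn M z x y a01.
have h3 := geo_distl M x y a01.
rewrite (metric_sym _ x) h3 in h1.
rewrite (metric_sym z x) (metric_sym z y) (metric_sym z) in h2.
have [b0 b1] := andP b01.
have := ler_wpM2l b0 h2.
nra.
Qed.

Lemma geo_convexl x y z u : 0 <= u <= 1 ->
  d (geo x y u) (geo x z u) <= u * d y z.
Proof.
move=> u01; have [u0 u1] := andP u01.
apply: sqr_le_le; first by rewrite mulr_ge0// mdist_ge0.
apply: (le_trans (geo_geo x y z u01 u01)).
by rewrite exprMn; lra.
Qed.

Lemma geo_convexr x y z u : 0 <= u <= 1 ->
  d (geo y x u) (geo z x u) <= (1 - u) * d y z.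
Proof.
by move=> u01; rewrite !(geo_sym _ x)//; apply: geo_convexl; lra.
Qed.

Lemma geo_convex p q p' q' u : 0 <= u <= 1 ->
  d (geo p q u) (geo p' q' u) <= (1 - u) * d p p' + u * d q q'.
Proof.
move=> u01; apply: (le_trans (metric_triangle _ (geo p q' u) _)).
by rewrite addrC lerD ?geo_convexr ?geo_convexl.
Qed.

Lemma geo_dist_convex x p q u : 0 <= u <= 1 ->
  d x (geo p q u) <= (1 - u) * d x p + u * d x q.
Proof. by move=> u01; rewrite -{1}(geoxx x u01); exact: geo_convex. Qed.

(** Weighted form of the quadrilateral inequality of CAT(0) spaces, whose last term is twice the
    product of the sides [p q] and [x y]. The auxiliary point divides the diagonal from [x] to [q]
    so that its squared length gets total coefficient 1 when the CN inequalities from [p] and from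
    [y] are combined. *)
Lemma quadrilateral x p q y (t : R) : 0 < t ->
  d x q ^+ 2 + d p y ^+ 2 <=
  d x p ^+ 2 + d y q ^+ 2 + t * d p q ^+ 2 + t^-1 * d x y ^+ 2.
Proof.
move=> t0; pose u := t / (1 + t).
have t1 : 0 < 1 + t by lra.
have u01 : 0 <= u <= 1.
  by apply/andP; split; [apply: divr_ge0; lra|rewrite ler_pdivrMr//; lra].
have h1 := geo_cn M p x q u01; have h2 := geo_cn M y x q u01.
have e1 : 1 - u = (1 + t)^-1 by rewrite /u; field; lra.
have ue : u = t * (1 + t)^-1 by [].
have tr := metric_triangle p (geo x q u) y.
rewrite (metric_sym (geo x q u) y) in tr.
have := mdist_ge0 p (geo x q u); have := mdist_ge0 y (geo x q u).
have := mdist_ge0 p y.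
move: tr h1 h2; rewrite (metric_sym p x) (metric_sym y x).
set m1 := d p (geo _ _ _); set m2 := d y (geo _ _ _).
set P := d x p; set Y := d x y; set D := d x q; set E := d p q.
set F := d y q; set G := d p y; rewrite e1 => tr h1 h2 g0 m20 m10.
pose k := 1 + t.
have k0 : 0 < k by [].
have hG : G ^+ 2 <= k * m1 ^+ 2 + k / t * m2 ^+ 2.
  apply: (@le_trans _ _ ((m1 + m2) ^+ 2)).
    by rewrite ler_pXn2r ?nnegrE ?addr_ge0.
  rewrite -subr_ge0.
  rewrite (_ : _ - _ = t^-1 * (t * m1 - m2) ^+ 2); last by rewrite /k; field; lra.
  by rewrite mulr_ge0 ?sqr_ge0// invr_ge0 ltW.
have k1 := ler_wpM2l (ltW k0) h1.
have kt0 : 0 <= k / t by rewrite divr_ge0// ltW.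
have k2 := ler_wpM2l kt0 h2.
have q1 : k * (k^-1 * P ^+ 2 + u * E ^+ 2 - u * k^-1 * D ^+ 2) =
  P ^+ 2 + t * E ^+ 2 - t / k * D ^+ 2 by rewrite ue /k; field; lra.
have q2 : k / t * (k^-1 * Y ^+ 2 + u * F ^+ 2 - u * k^-1 * D ^+ 2) =
  t^-1 * Y ^+ 2 + F ^+ 2 - k^-1 * D ^+ 2.
  by rewrite ue /k; field; rewrite !gt_eqF.
have q3 : t / k * D ^+ 2 + k^-1 * D ^+ 2 = D ^+ 2.
  by rewrite /k; field; lra.
rewrite q1 in k1; rewrite q2 in k2.
by clear h1 h2 q1 q2; lra.
Qed.

Definition btw x y z := d x z + d z y = d x y.

Lemma geo_btw x y u : 0 <= u <= 1 -> btw x y (geo x y u).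
Proof. by move=> u01; rewrite /btw geo_distl// geo_distr//; ring. Qed.

Lemma btw_geo x y z : btw x y z ->
  exists2 u, 0 <= u <= 1 & z = geo x y u /\ d x z = u * d x y.
Proof.
rewrite /btw => h; have := mdist_ge0 x z; have := mdist_ge0 z y => zy xz.
have [xy0|xy0] := eqVneq (d x y) 0.
  exists 0; first by rewrite lexx ler01.
  rewrite geo0 mul0r; suff xz0 : d x z = 0.
    by split=> //; apply: mdist_positivity; rewrite metric_sym.
  by lra.
have xyp : 0 < d x y by rewrite lt_neqAle eq_sym xy0 mdist_ge0.
have e : d x z = d x z / d x y * d x y by rewrite divfK.
have u01 : 0 <= d x z / d x y <= 1.
  by apply/andP; split; [by rewrite divr_ge0 ?mdist_ge0|rewrite ler_pdivrMr//; lra].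
exists (d x z / d x y) => //; split=> //.
apply: geo_uniq => //; first by rewrite -e.
by rewrite mulrBl mul1r -e -h; lra.
Qed.

Lemma btw_sym x y z : btw x y z -> btw y x z.
Proof. by rewrite /btw (metric_sym y z) (metric_sym z x) (metric_sym y x) addrC. Qed.

Lemma btwl x y : btw x y x. Proof. by rewrite /btw mdistxx add0r. Qed.
Lemma btwr x y : btw x y y. Proof. by rewrite /btw mdistxx addr0. Qed.

Lemma btw_trans x y z w : btw x y z -> btw x z w -> btw x y w /\ btw w y z.
Proof.
rewrite /btw => h1 h2; have := metric_triangle x w y.
have := metric_triangle w z y => t1 t2; lra.
Qed.

Lemma btw_transr x y z w : btw x y z -> btw z y w -> btw x y w /\ btw x w z.
Proof.
move=> /btw_sym h1 /btw_sym h2.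
by have [/btw_sym a /btw_sym b] := btw_trans h1 h2.
Qed.

Lemma btw_transport x y y' z : btw x y z -> exists2 z', btw x y' z' &
  d z z' <= d y y'.
Proof.
move=> /btw_geo[u u01 [-> _]]; exists (geo x y' u); first exact: geo_btw.
have [u0 u1] := andP u01.
by apply: (le_trans (geo_convexl x y y' u01)); rewrite ler_piMl ?mdist_ge0.
Qed.

Lemma mdist_lip x y z : `|d x y - d x z| <= d y z.
Proof.
have := metric_triangle x y z; have := metric_triangle x z y.
by rewrite (metric_sym z y) ler_norml; lra.
Qed.

End CN.

(** * Properness of locally compact Hadamard spaces *)

Section Ultra.

Lemma fmap_ultra (I T : Type) (f : I -> T) (F : set_system I) :
  UltraFilter F -> UltraFilter (f @ F).
Proof.
move=> FU; split=> [|G GF sFG]; first exact: fmap_proper_filter.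
apply/seteqP; split=> A; last exact: sFG.
move=> GA; have [//|FnA] := in_ultra_setVsetC (f @^-1` A) FU.
have : G (~` A) by apply: sFG.
by move=> /(filterI GA) /filter_ex[? []].
Qed.

Lemma fmapS (I T : Type) (f : I -> T) (F : set_system I) {FF : Filter F}
  (P : set I) (Q : set T) : (forall i, P i -> Q (f i)) -> F P -> (f @ F) Q.
Proof. by move=> PQ; exact: (@filterS _ F FF P (f @^-1` Q)). Qed.

Lemma filterI_ex (I : Type) (F : set_system I) {FF : ProperFilter F}
  (A B : set I) : F A -> F B -> exists2 i, A i & B i.
Proof. by move=> FA FB; have [i [Ai Bi]] := filter_ex (filterI FA FB); exists i. Qed.

Lemma filterI3_ex (I : Type) (F : set_system I) {FF : ProperFilter F}
  (A B C : set I) : F A -> F B -> F C -> exists i, [/\ A i, B i & C i].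
Proof.
move=> FA FB FC; have [i [Ai Bi] Ci] := filterI_ex (filterI FA FB) FC.
by exists i.
Qed.

Lemma ultra_oo : exists U : set_system nat, UltraFilter U /\ \oo `<=` U.
Proof. exact: ultraFilterLemma. Qed.

End Ultra.

Section Proper.
Import metricType_numDomainType.
Context (R : realType) (X : metricType R).
Hypothesis Xcomplete : forall F : set_system X,
  ProperFilter F -> cauchy F -> exists x : X, F --> x.
Hypothesis Xlc : locally_compact [set: X].
Variable geod : X -> X -> R -> X.
Hypothesis geod_l : forall p q (u : R), 0 <= u <= 1 ->
  mdist p (geod p q u) = u * mdist p q.
Hypothesis geod_r : forall p q (u : R), 0 <= u <= 1 ->
  mdist (geod p q u) q = (1 - u) * mdist p q.
Variable p : X.

(** Compactness of the closed ball of radius [r] about [p], expressed by ultrafilters. *)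
Let P (r : R) := forall G : set_system X, UltraFilter G ->
  G [set x | mdist p x <= r] -> exists x : X, G --> x.

Lemma ball_limits_le r s : r <= s -> P s -> P r.
Proof.
by move=> rs Ps G UG Gr; apply: Ps; apply: filterS Gr => x /= /le_trans; apply.
Qed.

Lemma ball_retraction (r e : R) : 0 <= r -> 0 <= e -> exists phi : X -> X, forall x,
  mdist p x <= r + e -> mdist p (phi x) <= r /\ mdist x (phi x) <= e.
Proof.
move=> r0 e0.
exists (fun x => if mdist p x <= r then x else geod p x (r / mdist p x)).
move=> x px; case: ifPn => [//|]; first by rewrite mdistxx.
rewrite -ltNge => rx; have x0 : 0 < mdist p x by lra.
have u01 : 0 <= r / mdist p x <= 1.
  by apply/andP; split; [apply: divr_ge0; lra|rewrite ler_pdivrMr//; lra].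
rewrite geod_l// (metric_sym x) geod_r// mulrBl mul1r divfK ?gt_eqF//.
by split=> //; lra.
Qed.

(** Retracting the ultrafilter to a smaller ball moves points by at most [e / 2], and the image
    converges, so the ultrafilter is Cauchy. *)
Lemma ball_limits_closed r : 0 <= r -> (forall s, 0 <= s < r -> P s) -> P r.
Proof.
move=> r0 h G UG Gr; apply: Xcomplete; apply: cauchy_exP => e e0.
have [re|re] := ltP r (e / 2).
  exists p; apply: filterS Gr => x /= xr; rewrite ballEmdist/=; lra.
have s0 : 0 <= r - e / 2 by lra.
have e20 : 0 <= e / 2 by lra.
have [phi hphi] := ball_retraction s0 e20.
have rs : 0 <= r - e / 2 < r by rewrite s0; lra.
have [||y yG] := h _ rs (phi @ G).
- exact: fmap_ultra.
- apply: (fmapS _ Gr) => x /= xr.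
  by have [] := hphi x; first by rewrite subrK.
exists y.
have : G [set x | mdist y (phi x) < e / 2].
  by move/cvgrPdist_lt : yG; apply; lra.
move=> Gy; apply: filterS (filterI Gr Gy) => x [/= xr xy].
have [|_ h2] := hphi x; first by rewrite subrK.
rewrite ballEmdist/=; have := metric_triangle y (phi x) x.
by rewrite (metric_sym (phi x)); lra.
Qed.

(** A Lebesgue number: if radii tending to 0 failed at points [x n], the compact neighbourhood of an
    ultralimit of these points would contain one of the excluded balls. *)
Lemma uniform_compact r : 0 <= r -> P r -> exists2 e : R, 0 < e &
  forall x, mdist p x <= r -> exists2 K : set X, compact K & ball x e `<=` K.
Proof.
move=> r0 Pr; apply: contrapT => h.
have hn (n : nat) : exists x, mdist p x <= r /\
    forall K : set X, compact K -> ~ (ball x (n.+1%:R^-1) `<=` K).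
  apply: contrapT => hn; apply: h; exists (n.+1%:R^-1); first by rewrite invr_gt0.
  move=> x xr; apply: contrapT => hK; apply: hn; exists x; split=> // K cK bK.
  by apply: hK; exists K.
pose x n := sval (cid (hn n)).
have [xr xK] : (forall n, mdist p (x n) <= r) /\ (forall n,
    forall K : set X, compact K -> ~ (ball (x n) (n.+1%:R^-1) `<=` K)).
  by split=> n; have [] := svalP (cid (hn n)).
have [U [UU ooU]] := ultra_oo.
have [||y yU] := Pr (x @ U).
- exact: fmap_ultra.
- by apply: (fmapS _ filterT) => n _; exact: xr.
have [B Bn [cB _]] := Xlc (I : [set: X] y).
have : nbhs y B by move: Bn; rewrite /within/=; apply: filterS => z; exact.
rewrite -filter_from_mdist_nbhs => -[e /= e0 eB].
have Ue : U [set n | mdist y (x n) < e / 2].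
  by move/cvgrPdist_lt : yU; apply; lra.
have : U [set n | n.+1%:R^-1 < e / 2].
  have e20 : 0 < e / 2 by lra.
  exact: ooU (near_infty_natSinv_lt (PosNum e20)).
move=> /(filterI_ex Ue)[n /= h1 h2].
apply: (xK n _ cB) => z; rewrite ballEmdist/= => h3; apply: eB => /=.
have h4 := lt_trans h3 h2; clear h2 h3.
by have := metric_triangle y (x n) z; lra.
Qed.

(** The retraction to the old ball converges along the ultrafilter, so most points lie within [e] of
    one point of that ball, hence in one compact set. *)
Lemma ball_limits_step r : 0 <= r -> P r -> exists2 e : R, 0 < e & P (r + e).
Proof.
move=> r0 Pr; have [e e0 he] := uniform_compact r0 Pr.
exists (e / 2); first by lra.
move=> G UG Gr.
have e20 : 0 <= e / 2 by lra.
have [phi hphi] := ball_retraction r0 e20.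
have [||y yG] := Pr (phi @ G).
- exact: fmap_ultra.
- by apply: (fmapS _ Gr) => x /= /hphi[].
have : G [set x | mdist y (phi x) < e / 4].
  by move/cvgrPdist_lt : yG; apply; lra.
move=> Gy; have [x0 /= x01 x02] := filterI_ex Gr Gy.
have [K cK bK] := he (phi x0) (hphi _ x01).1.
have GK : G K.
  apply: filterS (filterI Gr Gy) => x [/= xr xy]; apply: bK.
  have [_ h2] := hphi _ xr; rewrite ballEmdist/=.
  have := metric_triangle (phi x0) y x; have := metric_triangle y (phi x) x.
  by rewrite (metric_sym (phi x0) y) (metric_sym (phi x) x); lra.
by move: cK; rewrite compact_ultra => /(_ G UG GK)[z []]; exists z.
Qed.

(** Hopf-Rinow: if the radii of compact balls were bounded, they would contain their supremum and
    extend past it. *)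
Lemma proper_ball r : P r.
Proof.
apply: contrapT => nP.
pose S := [set s : R | 0 <= s /\ P s].
have P0 : P 0.
  move=> G UG G0; exists p; apply/fcvgrPdist_lt => e e0; apply: filterS G0 => x /=.
  by move=> /le_lt_trans; apply.
have S0 : S 0 by split.
have Sr : ubound S r.
  move=> s [s0 Ps]; rewrite leNgt; apply/negP => rs.
  by apply: nP; apply: ball_limits_le Ps; exact: ltW.
have hS : has_sup S by split; [exists 0|exists r].
have s0 : 0 <= sup S by apply: ub_le_sup => //; exists r.
have Ps : P (sup S).
  apply: ball_limits_closed => // t /andP[t0 ts].
  have ts' : 0 < sup S - t by lra.
  have [s [_ Ps] st] := sup_adherent ts' hS.
  by apply: ball_limits_le Ps; move: st; rewrite subKr => /ltW.
have [e e0 Pe] := ball_limits_step s0 Ps.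
have : sup S + e <= sup S.
  by apply: ub_le_sup; [exists r|split=> //; lra].
lra.
Qed.

End Proper.

Section MetricLimits.
Import metricType_numDomainType.
Context (R : realType) (X : metricType R).

Lemma cvg_mdistP (T : Type) (F : set_system T) {FF : Filter F} (f : T -> X)
    (y : X) :
  f @ F --> y <-> forall e, 0 < e -> F [set t | mdist y (f t) < e].
Proof. exact: cvgrPdist_lt. Qed.

Lemma nbhs_mdist (y : X) (A : set X) :
  nbhs y A <-> exists2 e, 0 < e & forall z, mdist y z < e -> A z.
Proof. by rewrite -filter_from_mdist_nbhs; split=> -[e e0 h]; exists e. Qed.

End MetricLimits.

(** * From comparison triangles to the CN inequality *)

Section Hadamard.
Context (R : realType) (X : metricType R).
Local Notation d := mdist.

Lemma euclidean_planeE (a b c e : R) :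
  mdist ((a, b) : euclidean_plane R) (c, e) =
  Num.sqrt ((c - a) ^+ 2 + (e - b) ^+ 2).
Proof. by rewrite {1}/mdist/= /l2dist/= /mdist/= !real_normK ?num_real. Qed.

(** The CAT(0) inequality with the second point at the vertex [x] itself. The comparison triangle
    has [p] at the origin and [q] at [(l, 0)]; [a] is given by the law of cosines, and the triangle
    inequalities leave room for the height [b]. *)
Lemma cat0_cn (x p q : X) (c c' : R -> X) (u : R) : cat0 X ->
  geodesic_segment c p q -> geodesic_segment c' p x -> 0 <= u <= 1 ->
  d x (c (u * d p q)) ^+ 2 <= (1 - u) * d x p ^+ 2 + u * d x q ^+ 2
    - u * (1 - u) * d p q ^+ 2.
Proof.
move=> cat sc sc' u01; have [u0 u1] := andP u01.
have [c'0 c'1 _] := sc'; have [c0 c1 _] := sc.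
have [l0|l0] := eqVneq (d p q) 0.
  rewrite l0 mulr0 c0 -(mdist_positivity _ _ l0) expr0n mulr0 subr0.
  by rewrite -mulrDl subrK mul1r.
set l := d p q in l0 *.
have lp : 0 < l by rewrite lt_neqAle eq_sym l0 mdist_ge0.
set r := d x p; set m := d x q.
have r0 : 0 <= r by exact: mdist_ge0.
have m0 : 0 <= m by exact: mdist_ge0.
have t1 : m <= r + l by exact: metric_triangle.
have t2 : r <= m + l by rewrite /l (metric_sym p); exact: metric_triangle.
have t3 : l <= r + m by rewrite /r (metric_sym x); exact: metric_triangle.
pose a := (r ^+ 2 + l ^+ 2 - m ^+ 2) / (2 * l).
have ae : 2 * l * a = r ^+ 2 + l ^+ 2 - m ^+ 2.
  by rewrite /a mulrC divfK// mulf_neq0// pnatr_eq0.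
have ar : a ^+ 2 <= r ^+ 2.
  have e1 : 2 * l * (r - a) = (m - r + l) * (m + r - l).
    by rewrite mulrBr ae; ring.
  have e2 : 2 * l * (r + a) = (r + l - m) * (r + l + m).
    by rewrite mulrDr ae; ring.
  have : 0 <= 2 * l * (r - a) by rewrite e1; apply: mulr_ge0; lra.
  have : 0 <= 2 * l * (r + a) by rewrite e2; apply: mulr_ge0; lra.
  rewrite !pmulr_rge0; try lra.
  move=> h1 h2; rewrite -subr_ge0 subr_sqr; apply: mulr_ge0; lra.
pose b := Num.sqrt (r ^+ 2 - a ^+ 2).
have be : b ^+ 2 = r ^+ 2 - a ^+ 2 by rewrite sqr_sqrtr// subr_ge0.
have ul : 0 <= u * l by rewrite mulr_ge0// ltW.
have lu : 0 <= l - u * l by rewrite -{1}(mul1r l) -mulrBl mulr_ge0//; lra.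
have e5 : Num.sqrt ((l - 0) ^+ 2 + (0 - 0) ^+ 2) = l.
  by rewrite !subr0 expr0n addr0 sqrtr_sqr ger0_norm// ltW.
have e6 : Num.sqrt ((a - 0) ^+ 2 + (b - 0) ^+ 2) = d p x.
  by rewrite !subr0 be addrC subrK sqrtr_sqr metric_sym ger0_norm.
have e7 : Num.sqrt ((a - l) ^+ 2 + (b - 0) ^+ 2) = d q x.
  rewrite subr0 be (_ : _ + _ = m ^+ 2).
    by rewrite sqrtr_sqr metric_sym ger0_norm.
  have -> : m ^+ 2 = r ^+ 2 + l ^+ 2 - 2 * l * a by rewrite ae; ring.
  by ring.
have := cat p q x c c' (0, 0) (l, 0) (a, b) (u * l, 0) (a, b) (u * l) (d p x)
  sc sc'.
rewrite !euclidean_planeE e5 e6 e7 !in_itv/= ul lexx mdist_ge0/=.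
have -> : u * l <= l by lra.
rewrite !subrr !subr0 expr0n !addr0 sqrtr0 !sqrtr_sqr !ger0_norm//.
move=> /(_ erefl erefl erefl isT isT erefl erefl erefl erefl).
rewrite c'1 metric_sym => h.
have : d x (c (u * l)) ^+ 2 <= (Num.sqrt ((a - u * l) ^+ 2 + b ^+ 2)) ^+ 2.
  by rewrite ler_pXn2r ?nnegrE ?mdist_ge0 ?sqrtr_ge0.
rewrite sqr_sqrtr ?addr_ge0 ?sqr_ge0// be => /le_trans; apply.
rewrite le_eqVlt; apply/orP; left; apply/eqP.
rewrite (_ : _ + _ = r ^+ 2 + u ^+ 2 * l ^+ 2 - u * (2 * l * a)); last by ring.
by rewrite ae; ring.
Qed.

Lemma hadamard_cnspace : hadamard X -> locally_compact [set: X] -> cnspace X.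
Proof.
move=> [hc hg hcat] hl.
pose c p q := sval (cid (hg p q)).
have cP p q : geodesic_segment (c p q) p q := svalP (cid (hg p q)).
pose g p q (u : R) := c p q (u * d p q).
have ul (p q : X) (u : R) : 0 <= u <= 1 -> 0 <= u * d p q <= d p q.
  have := mdist_ge0 p q => h /andP[u0 u1].
  by apply/andP; split; [exact: mulr_ge0|rewrite ler_piMl].
have gl p q (u : R) : 0 <= u <= 1 -> d p (g p q u) = u * d p q.
  move=> /(ul p q)/andP[h1 h2]; have [c0 c1 ci] := cP p q.
  rewrite -{1}c0 ci ?in_itv/= ?lexx ?mdist_ge0 ?h1//.
  by rewrite sub0r normrN ger0_norm.
have gr p q (u : R) : 0 <= u <= 1 -> d (g p q u) q = (1 - u) * d p q.
  move=> /(ul p q)/andP[h1 h2]; have [c0 c1 ci] := cP p q.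
  rewrite -{2}c1 ci ?in_itv/= ?lexx ?mdist_ge0 ?h1//.
  by rewrite distrC ger0_norm; lra.
apply: (@CNSpace R X g) => //.
  by move=> x p q u u01; exact: (cat0_cn hcat (cP p q) (cP p x)).
move=> I F f p C UF FC.
have [||x xF] := @proper_ball R X hc hl g gl gr p C (f @ F).
- exact: fmap_ultra.
- exact: FC.
by exists x.
Qed.

End Hadamard.

(** * Products of two spaces *)

Section Product.
Import metricType_numDomainType.
Context (R : realType) (X1 X2 : metricType R).
Local Notation X := (l2prod X1 X2).

Lemma mdist_l2prod (x y : X) :
  mdist x y = Num.sqrt (mdist x.1 y.1 ^+ 2 + mdist x.2 y.2 ^+ 2).
Proof. by []. Qed.

Lemma sqr_mdist_l2prod (x y : X) :
  mdist x y ^+ 2 = mdist x.1 y.1 ^+ 2 + mdist x.2 y.2 ^+ 2.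
Proof. by rewrite mdist_l2prod sqr_sqrtr// addr_ge0 ?sqr_ge0. Qed.

Lemma mdist_l2prod1 (x y : X) : mdist x.1 y.1 <= mdist x y.
Proof.
apply: sqr_le_le; first exact: mdist_ge0.
by rewrite sqr_mdist_l2prod lerDl sqr_ge0.
Qed.

Lemma mdist_l2prod2 (x y : X) : mdist x.2 y.2 <= mdist x y.
Proof.
apply: sqr_le_le; first exact: mdist_ge0.
by rewrite sqr_mdist_l2prod lerDr sqr_ge0.
Qed.

Lemma mdist_l2prod_le (x y : X) :
  mdist x y <= mdist x.1 y.1 + mdist x.2 y.2.
Proof.
apply: sqr_le_le; first by rewrite addr_ge0 ?mdist_ge0.
rewrite sqr_mdist_l2prod sqrrD -subr_ge0.
rewrite (_ : _ - _ = (mdist x.1 y.1 * mdist x.2 y.2) *+ 2).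
  by rewrite mulrn_wge0// mulr_ge0// mdist_ge0.
by ring.
Qed.

(** Squared distances add, so componentwise geodesics with a common parameter satisfy the CN
    inequality. The definition is transparent because geodesics of the product are later split into
    components by computation. *)
Definition prod_cnspace (M1 : cnspace X1) (M2 : cnspace X2) : cnspace X.
Proof.
apply: (@CNSpace R X (fun p q u => (geo M1 p.1 q.1 u, geo M2 p.2 q.2 u))).
- move=> p q u u01; have [u0 u1] := andP u01.
  rewrite !mdist_l2prod/= !geo_distl// !exprMn -mulrDr sqrtrM ?sqr_ge0//.
  by rewrite sqrtr_sqr ger0_norm.
- move=> p q u u01; have [u0 u1] := andP u01.
  rewrite !mdist_l2prod/= !geo_distr// !exprMn -mulrDr sqrtrM ?sqr_ge0//.
  by rewrite sqrtr_sqr ger0_norm//; lra.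
- move=> x p q u u01; rewrite !sqr_mdist_l2prod/=.
  by have := geo_cn M1 x.1 p.1 q.1 u01; have := geo_cn M2 x.2 p.2 q.2 u01; lra.
- move=> I F f p C UF FC.
  have [|x1 /cvgrPdist_lt h1] := @cn_proper _ _ M1 I F (fun i => (f i).1) p.1 C UF.
    by apply: filterS FC => i /=; apply: le_trans; exact: mdist_l2prod1.
  have [|x2 /cvgrPdist_lt h2] := @cn_proper _ _ M2 I F (fun i => (f i).2) p.2 C UF.
    by apply: filterS FC => i /=; apply: le_trans; exact: mdist_l2prod2.
  exists (x1, x2); apply/cvgrPdist_lt => e e0.
  have e2 : 0 < e / 2 by lra.
  apply: filterS (filterI (h1 _ e2) (h2 _ e2)) => i [/= a1 a2].
  by have := mdist_l2prod_le ((x1, x2) : X) (f i); rewrite /=; lra.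
Defined.

End Product.

(** * Projection to a geodesic line *)

Section Line.
Context (R : realType) (X : metricType R) (M : cnspace X).
Local Notation d := mdist.
Local Notation geo := (geo M).

Lemma lip_continuous (f : R -> R) (L : R) :
  (forall s t, `|f s - f t| <= L * `|s - t|) -> continuous f.
Proof.
move=> h s; apply/cvgrPdist_lt => /= e e0.
have L0 : 0 <= L.
  by have := h 1 0; rewrite subr0 normr1 mulr1; apply: le_trans.
near=> t; apply: (le_lt_trans (h s t)).
apply: (@le_lt_trans _ _ ((L + 1) * `|s - t|)).
  by rewrite ler_wpM2r//; lra.
rewrite mulrC -ltr_pdivlMr; last by lra.
near: t; apply: (@cvgr_dist_lt _ R^o _ (nbhs s) _ id s cvg_id).
by apply: divr_gt0 => //; lra.
Unshelve. all: by end_near. Qed.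

Lemma cvg_le_to (I : Type) (F : set_system I) {FF : ProperFilter F}
  (f g : I -> R) (a b : R) : f @ F --> a -> g @ F --> b ->
  F [set i | f i <= g i] -> a <= b.
Proof.
move=> /cvgrPdist_lt fa /cvgrPdist_lt gb fg; rewrite leNgt; apply/negP => ba.
have e0 : 0 < (a - b) / 2 by lra.
have [i [/= h1 h2 h3]] := filterI3_ex fg (fa _ e0) (gb _ e0).
by move: h2 h3; rewrite /= !ltr_norml; lra.
Qed.

Lemma mdist_cvg (I : Type) (F : set_system I) {FF : Filter F} (f g : I -> X)
  (x y : X) : f @ F --> x -> g @ F --> y ->
  (fun i => d (f i) (g i)) @ F --> d x y.
Proof.
move=> /cvg_mdistP fx /cvg_mdistP gy.
apply/cvgrPdist_lt => e e0 /=; have e2 : 0 < e / 2 by lra.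
apply: filterS (filterI (fx _ e2) (gy _ e2)) => i [/= h1 h2].
have := metric_triangle x (f i) y; have := metric_triangle (f i) (g i) y.
have := metric_triangle (f i) x (g i); have := metric_triangle x y (g i).
by rewrite (metric_sym (f i) x) (metric_sym (g i) y) ltr_norml; lra.
Qed.

Section OneLine.
Variable c : R -> X.
Hypothesis lc : geodesic_line c.

Lemma geo_line s t (u : R) : 0 <= u <= 1 ->
  geo (c s) (c t) u = c ((1 - u) * s + u * t).
Proof.
move=> /andP[u0 u1]; apply/esym/geo_uniq; rewrite ?u0// !lc.
  rewrite (_ : _ - _ = u * (s - t)); last by ring.
  by rewrite normrM ger0_norm.
rewrite (_ : _ - _ = (1 - u) * (s - t)); last by ring.
by rewrite normrM ger0_norm//; lra.
Qed.

Lemma line_convex x s t (u : R) : 0 <= u <= 1 ->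
  d x (c ((1 - u) * s + u * t)) <= (1 - u) * d x (c s) + u * d x (c t).
Proof. by move=> u01; rewrite -geo_line//; exact: geo_dist_convex. Qed.

Lemma line_lip x s t : `|d x (c s) - d x (c t)| <= `|s - t|.
Proof. by rewrite -lc; exact: mdist_lip. Qed.

Definition is_proj x a := forall s, d x (c a) <= d x (c s).

Lemma ex_proj x : exists a, is_proj x a.
Proof.
pose A := 2 * d x (c 0).
have A0 : 0 <= A by rewrite mulr_ge0// mdist_ge0.
have [||a aA h] := @EVT_min R (fun s => d x (c s)) (- A) A; first by lra.
  apply: continuous_subspaceT; apply: (@lip_continuous _ 1) => s t.
  by rewrite mul1r; exact: line_lip.
exists a => s; have [sA|sA] := boolP (s \in `[- A, A]); first exact: h.
have := h 0; rewrite in_itv/= A0 oppr_le0 A0 => /(_ isT) /le_trans; apply.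
have : A < `|s|.
  by move: sA; rewrite in_itv/= -ler_norml -ltNge.
have := metric_triangle (c 0) x (c s); rewrite lc sub0r normrN /A.
by rewrite (metric_sym _ x); lra.
Qed.

Definition pj x : R := sval (cid (ex_proj x)).

Lemma pjP x : is_proj x (pj x). Proof. exact: svalP. Qed.

(** First variation at the nearest point: the CN inequality on the segment from [c a] to [c s] at a
    small parameter [u]. The value of [u] used makes the quadratic term half the linear one. *)
Lemma proj_pythagoras x a s : is_proj x a ->
  d x (c a) ^+ 2 + (s - a) ^+ 2 <= d x (c s) ^+ 2.
Proof.
move=> pa; rewrite leNgt; apply/negP => lt.
have key (u : R) : 0 <= u <= 1 ->
    u * (d x (c a) ^+ 2 + (s - a) ^+ 2 - d x (c s) ^+ 2) <= u * (u * (s - a) ^+ 2).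
  move=> u01; have := geo_cn M x (c a) (c s) u01.
  rewrite geo_line// lc => h.
  have : d x (c a) ^+ 2 <= d x (c ((1 - u) * a + u * s)) ^+ 2.
    by rewrite ler_pXn2r ?nnegrE ?mdist_ge0.
  have e : `|a - s| ^+ 2 = (s - a) ^+ 2 by rewrite real_normK ?num_real//; ring.
  by rewrite e in h; move: h; clear; lra.
set D := d x (c a) ^+ 2 + (s - a) ^+ 2 - d x (c s) ^+ 2 in key.
have D0 : 0 < D by rewrite /D; lra.
have h1 := key 1; rewrite !mul1r in h1.
have {}h1 : D <= (s - a) ^+ 2 by apply: h1; lra.
have Q0 : 0 < (s - a) ^+ 2 by lra.
have u0 : 0 < D / (2 * (s - a) ^+ 2) by rewrite divr_gt0// mulr_gt0.
have := key (D / (2 * (s - a) ^+ 2)).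
rewrite ler_pM2l// ltW//= ler_pdivrMr; last by rewrite mulr_gt0.
have -> : D <= 1 * (2 * (s - a) ^+ 2) by lra.
move=> /(_ isT); have -> : D / (2 * (s - a) ^+ 2) * (s - a) ^+ 2 = D / 2.
  by field; rewrite -sqrf_eq0; lra.
by lra.
Qed.

Lemma proj_uniq x a b : is_proj x a -> is_proj x b -> a = b.
Proof.
move=> pa pb; have := proj_pythagoras b pa; have := proj_pythagoras a pb.
move=> h1 h2; apply/eqP; rewrite -subr_eq0 -sqrf_eq0 eq_le sqr_ge0 andbT.
have := sqr_ge0 (b - a); lra.
Qed.

Lemma pjE x a : is_proj x a -> pj x = a.
Proof. by move=> pa; exact: proj_uniq (pjP x) pa. Qed.

Lemma pj_line s : pj (c s) = s.
Proof. by apply: pjE => t; rewrite mdistxx mdist_ge0. Qed.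

Definition ht x := d x (c (pj x)).

Lemma htE x : ht x = d x (c (pj x)). Proof. by []. Qed.

Lemma ht_ge0 x : 0 <= ht x. Proof. exact: mdist_ge0. Qed.

Lemma ht_le x s : ht x <= d x (c s). Proof. exact: pjP. Qed.

(** Summing the two Pythagorean inequalities and the quadrilateral inequality with weight 1 cancels
    all mixed distances. *)
Lemma pj_lip x y : `|pj x - pj y| <= d x y.
Proof.
apply: sqr_le_le; first exact: mdist_ge0.
have := proj_pythagoras (pj y) (pjP x); have := proj_pythagoras (pj x) (pjP y).
have := @quadrilateral R X M x (c (pj x)) (c (pj y)) y 1 ltr01.
rewrite invr1 !mul1r lc !real_normK ?num_real// (metric_sym (c _) y).
have -> : (pj y - pj x) ^+ 2 = (pj x - pj y) ^+ 2 by ring.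
by lra.
Qed.

Lemma pj_dist x s : `|pj x - s| <= d x (c s).
Proof. by have := pj_lip x (c s); rewrite pj_line. Qed.

Lemma ht_convex x y (u : R) : 0 <= u <= 1 ->
  ht (geo x y u) <= (1 - u) * ht x + u * ht y.
Proof.
move=> u01; apply: (le_trans (ht_le _ ((1 - u) * pj x + u * pj y))).
by rewrite -geo_line//; exact: geo_convex.
Qed.

Lemma ht_btw x y z H : btw x y z -> ht x <= H -> ht y <= H -> ht z <= H.
Proof.
move=> /(btw_geo M)[u u01 [-> _]] hx hy; apply: (le_trans (ht_convex _ _ u01)).
by have [u0 u1] := andP u01; nra.
Qed.

Lemma pj_ivt x y m : pj x <= m <= pj y -> exists2 z, btw x y z & pj z = m.
Proof.
move=> xmy; pose f (u : R) := pj (geo x y (Num.min 1 (Num.max 0 u))).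
have cl (u : R) : 0 <= Num.min 1 (Num.max 0 u) <= 1.
  by rewrite le_min ler01 le_max lexx ge_min lexx.
have cf : continuous f.
  apply: (@lip_continuous _ (d x y)) => s t; apply: (le_trans (pj_lip _ _)).
  have := @geo_geo R X M x y y _ _ (cl s) (cl t); rewrite mdistxx.
  set a := Num.min _ _; set b := Num.min _ _ => h.
  apply: (@le_trans _ _ (d x y * `|a - b|)); last first.
    rewrite ler_wpM2l ?mdist_ge0// /a /b /Num.min /Num.max.
    by repeat case: ifP; move=> *; rewrite ler_norml; case: (lerP s t); lra.
  apply: sqr_le_le; first by rewrite mulr_ge0 ?mdist_ge0.
  by apply: (le_trans h); rewrite exprMn real_normK ?num_real//; lra.
have [||u _ fu] := @IVT R f 0 1 m ler01; first exact: continuous_subspaceT.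
  rewrite /f maxxx (min_r ler01) (max_r ler01) minxx geo0 geo1.
  by rewrite ge_min le_max; have [-> ->] := andP xmy; rewrite orbT.
by exists (geo x y (Num.min 1 (Num.max 0 u))) => //; exact: geo_btw.
Qed.

End OneLine.
End Line.

(** * Flat half-planes *)

Section HalfPlane.
Context (R : realType) (X : metricType R) (M : cnspace X).
Local Notation d := mdist.
Local Notation geo := (geo M).
Variables (I : Type) (U : set_system I) (UU : UltraFilter U).
Variables (c : R -> X) (lc : geodesic_line c).
Variables (x : I -> X) (k : R) (k1 : -1 < k < 1).
Hypothesis xoo : forall A : R, U [set i | A < d (x i) (c 0)].
Hypothesis xk : forall s, (fun i => d (x i) (c s) - d (x i) (c 0)) @ U --> k * s.

Let r i s := d (x i) (c s).
(** The point at distance [t] from [c s] towards [x i] as soon as [r i s] exceeds [t], which holds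
    for most [i]. *)
Let P i s t := geo (c s) (x i) (t / r i s).

Lemma hp_far s A : U [set i | A < r i s].
Proof.
apply: filterS (xoo (A + `|s|)) => i /=.
by have := line_lip lc (x i) s 0; rewrite subr0 ler_norml /r; lra.
Qed.

Lemma hp_frac i s t : 0 <= t < r i s -> 0 <= t / r i s <= 1.
Proof.
move=> /andP[t0 tr]; apply/andP; split; first by apply: divr_ge0; lra.
by rewrite ler_pdivrMr; lra.
Qed.

Lemma hp_base i s t : 0 <= t < r i s -> d (c s) (P i s t) = t.
Proof.
move=> tr; rewrite /P geo_distl ?hp_frac// metric_sym divfK//.
by have [t0 tr'] := andP tr; rewrite gt_eqF//; rewrite /r in tr'; lra.
Qed.

Lemma hp_cvg_ex s t : 0 <= t -> exists z : X, (fun i => P i s t) @ U --> z.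
Proof.
move=> t0; apply: (@cn_proper _ _ M I U _ (c s) t UU).
by apply: filterS (hp_far s t) => i /= h; rewrite hp_base ?t0.
Qed.

Let Q s t := xget (c s) [set z : X | (fun i => P i s t) @ U --> z].

Lemma hp_cvg s t : 0 <= t -> (fun i => P i s t) @ U --> Q s t.
Proof. by move=> /(hp_cvg_ex s) /(xgetPex (c s)). Qed.

Lemma hp_baseQ s t : 0 <= t -> d (c s) (Q s t) = t.
Proof.
move=> t0.
have h : (fun i => d (c s) (P i s t)) @ U --> d (c s) (Q s t).
  by apply: mdist_cvg; [exact: cvg_cst|exact: hp_cvg].
have h' : (fun i => d (c s) (P i s t)) @ U --> t.
  apply: cvg_near_cst; apply: filterS (hp_far s t) => i /= ri.
  by rewrite hp_base// t0.
exact: (cvg_unique (@Rhausdorff R) h h').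
Qed.

(** Law of cosines at the common end [x i], with the factor [a * b <= 1] dropped from a nonnegative
    term. *)
Lemma hp_upper_fin i s t s' t' : 0 <= t < r i s -> 0 <= t' < r i s' ->
  d (P i s t) (P i s' t') ^+ 2 <=
  (s - s') ^+ 2 - 2 * (r i s - r i s') * (t - t') + (t - t') ^+ 2.
Proof.
move=> ht ht'; rewrite /P (geo_sym M (c s) (x i) (hp_frac ht)).
rewrite (geo_sym M (c s') (x i) (hp_frac ht')).
set a := 1 - t / _; set b := 1 - t' / _.
have [ta tb] := andP ht; have [ta' tb'] := andP ht'.
have a01 : 0 <= a <= 1 by have := hp_frac ht; rewrite /a; lra.
have b01 : 0 <= b <= 1 by have := hp_frac ht'; rewrite /b; lra.
apply: (le_trans (geo_geo M (x i) _ _ a01 b01)).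
rewrite lc -/(r i s) -/(r i s').
have ea : a * r i s = r i s - t.
  by rewrite /a mulrBl mul1r divfK// gt_eqF; lra.
have eb : b * r i s' = r i s' - t'.
  by rewrite /b mulrBl mul1r divfK// gt_eqF; lra.
have := line_lip lc (x i) s s'; rewrite -/(r i s) -/(r i s') => lip.
have h : (r i s - r i s') ^+ 2 <= (s - s') ^+ 2.
  rewrite -[leRHS]real_normK ?num_real// -[leLHS]real_normK ?num_real//.
  by rewrite ler_pXn2r ?nnegrE.
have ab : a * b <= 1 by have [? ?] := andP a01; have [? ?] := andP b01; nra.
rewrite real_normK ?num_real//.
have e : a ^+ 2 * r i s ^+ 2 + b ^+ 2 * r i s' ^+ 2 +
    a * b * ((s - s') ^+ 2 - r i s ^+ 2 - r i s' ^+ 2) =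
    (a * r i s - b * r i s') ^+ 2 +
    a * b * ((s - s') ^+ 2 - (r i s - r i s') ^+ 2) by ring.
rewrite e ea eb.
have h0 : 0 <= (s - s') ^+ 2 - (r i s - r i s') ^+ 2 by lra.
have := ler_wpM2r h0 ab; rewrite mul1r; lra.
Qed.

Lemma hp_upper s t s' t' : 0 <= t -> 0 <= t' ->
  d (Q s t) (Q s' t') ^+ 2 <=
  (s - s') ^+ 2 - 2 * (k * (s - s')) * (t - t') + (t - t') ^+ 2.
Proof.
move=> t0 t'0.
have h1 : (fun i => d (P i s t) (P i s' t') ^+ 2) @ U -->
    d (Q s t) (Q s' t') ^+ 2.
  by rewrite expr2; under eq_fun do rewrite expr2; apply: cvgM;
    apply: mdist_cvg; exact: hp_cvg.
have h2 : (fun i => r i s - r i s') @ U --> k * (s - s').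
  rewrite mulrBr.
  have -> : (fun i => r i s - r i s') =
      (fun i => (r i s - r i 0) - (r i s' - r i 0)).
    by apply/funext => i; ring.
  by apply: cvgB; exact: xk.
have h3 : (fun i => (s - s') ^+ 2 - 2 * (r i s - r i s') * (t - t') +
    (t - t') ^+ 2) @ U -->
    (s - s') ^+ 2 - 2 * (k * (s - s')) * (t - t') + (t - t') ^+ 2.
  apply: cvgD; last exact: cvg_cst.
  apply: cvgB; first exact: cvg_cst.
  apply: cvgM; last exact: cvg_cst.
  by apply: cvgM => //; exact: cvg_cst.
apply: (cvg_le_to h1 h3).
apply: filterS (filterI (hp_far s t) (hp_far s' t')) => i [/= ? ?].
by apply: hp_upper_fin; apply/andP.
Qed.

Lemma hp_ray s t t' : 0 <= t -> 0 <= t' -> d (Q s t) (Q s t') = `|t - t'|.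
Proof.
move=> t0 t'0; apply/eqP; rewrite eq_le; apply/andP; split.
  apply: sqr_le_le => //; apply: (le_trans (hp_upper _ _ t0 t'0)).
  by rewrite real_normK ?num_real//; lra.
rewrite -{1}(hp_baseQ s t0) -{1}(hp_baseQ s t'0); exact: mdist_lip.
Qed.

Let w := Num.sqrt (1 - k ^+ 2).

Lemma hp_w : 0 < w /\ w ^+ 2 = 1 - k ^+ 2.
Proof.
have h : 0 < 1 - k ^+ 2 by have [? ?] := andP k1; nra.
by rewrite /w sqrtr_gt0 sqr_sqrtr// ltW.
Qed.

Let F s t := Q (s + k * (t / w)) (t / w).

Lemma hp_F0 s : F s 0 = c s.
Proof.
by apply/esym/mdist_positivity; rewrite /F mul0r mulr0 addr0 hp_baseQ.
Qed.

Lemma hp_Fdiv t : 0 <= t -> 0 <= t / w.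
Proof. by have [w0 _] := hp_w; move=> t0; rewrite divr_ge0// ltW. Qed.

Lemma hp_Fupper s t s' t' : 0 <= t -> 0 <= t' ->
  d (F s t) (F s' t') ^+ 2 <= (s - s') ^+ 2 + (t - t') ^+ 2.
Proof.
move=> t0 t'0; have [w0 we] := hp_w.
apply: (le_trans (hp_upper _ _ (hp_Fdiv t0) (hp_Fdiv t'0))).
have e : t - t' = w * (t / w - t' / w) by field; rewrite gt_eqF.
rewrite e exprMn we; lra.
Qed.

(** [F] does not increase flat distances. Were this horizontal distance too short, the path from
    [c (- v)] to [c v] through the two points would be shorter than [2 * v]: for large [v] its
    slanted sides exceed their horizontal extents by at most [e / 2]. *)
Lemma hp_Fhoriz_le s s' t : 0 <= t -> s <= s' -> s' - s <= d (F s t) (F s' t).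
Proof.
move=> t0 ss'; apply/ler_addgt0Pr => e e0.
pose v := `|s| + `|s'| + 1 + 2 * t ^+ 2 / e.
have v0 : 0 <= 2 * t ^+ 2 / e by rewrite divr_ge0 ?mulr_ge0 ?sqr_ge0// ltW.
have side (a b : R) : 0 < b -> 2 * t ^+ 2 / e <= b ->
    d (F a t) (F (a + b) 0) <= b + e / 2 /\ d (F a t) (F (a - b) 0) <= b + e / 2.
  move=> b0 eb.
  have te : 2 * t ^+ 2 <= b * e by rewrite -ler_pdivrMr.
  split; apply: sqr_le_le; try lra;
    apply: (le_trans (hp_Fupper _ _ t0 (lexx 0))); rewrite subr0.
    by have := sqr_ge0 e; nra.
  by have := sqr_ge0 e; nra.
have n1 := ler_norm s'; have n2 := ler_norm (- s); rewrite normrN in n2.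
have n3 := normr_ge0 s'; have n4 := normr_ge0 s.
have [||_ h2] := side s (s + v); try by rewrite /v; lra.
have [||h1 _] := side s' (v - s'); try by rewrite /v; lra.
move: h1 h2; rewrite !hp_F0 (_ : s - (s + v) = - v); last by ring.
rewrite (_ : s' + (v - s') = v); last by ring.
move=> h1 h2.
have := metric_triangle (c (- v)) (F s t) (c v).
have := metric_triangle (F s t) (F s' t) (c v).
rewrite (metric_sym (c (- v)) (F s t)) lc.
have v1 : 0 <= v by rewrite /v; lra.
by clearbody v; rewrite ler0_norm; lra.
Qed.

Lemma hp_Fhoriz s s' t : 0 <= t -> d (F s t) (F s' t) = `|s - s'|.
Proof.
move=> t0; apply/eqP; rewrite eq_le; apply/andP; split.
  apply: sqr_le_le => //; apply: (le_trans (hp_Fupper _ _ t0 t0)).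
  by rewrite real_normK ?num_real// subrr expr0n addr0.
have [ss'|ss'] := leP s s'; first by rewrite ler0_norm ?opprB ?hp_Fhoriz_le//; lra.
rewrite ger0_norm ?(metric_sym (F s t)); last by lra.
by apply: hp_Fhoriz_le => //; exact: ltW.
Qed.

Lemma hp_F s s' t t' : 0 <= t -> 0 <= t' ->
  d (F s t) (F s' t') = Num.sqrt ((s - s') ^+ 2 + (t - t') ^+ 2).
Proof.
move=> t0 t'0; have [w0 we] := hp_w.
suff h : d (F s t) (F s' t') ^+ 2 = (s - s') ^+ 2 + (t - t') ^+ 2.
  by rewrite -h sqrtr_sqr ger0_norm// mdist_ge0.
apply/eqP; rewrite eq_le hp_Fupper//=.
(* With this [u], the points [F s t] and [F u t'] lie on one limit ray, where distances are exact.
   The CN inequality at [F u t'], the midpoint of [F s' t'] and its mirror image, turns the upper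
   bound for the mirror image into the lower bound for [F s' t']. *)
pose u := s + k * (t / w) - k * (t' / w).
have eu : d (F s t) (F u t') = `|t / w - t' / w|.
  by rewrite /F /u subrK hp_ray// hp_Fdiv.
have half : 0 <= (2^-1 : R) <= 1 by lra.
have mid : F u t' = geo (F s' t') (F (2 * u - s') t') 2^-1.
  apply: geo_uniq => //; rewrite !hp_Fhoriz//.
    rewrite (_ : s' - (2 * u - s') = 2 * (s' - u)); last by ring.
    by rewrite normrM ger0_norm ?mulKf// pnatr_eq0.
  rewrite (_ : s' - (2 * u - s') = 2 * (s' - u)); last by ring.
  rewrite (_ : u - (2 * u - s') = s' - u); last by ring.
  by rewrite normrM ger0_norm//; lra.
have := geo_cn M (F s t) (F s' t') (F (2 * u - s') t') half.
rewrite -mid eu hp_Fhoriz// !real_normK ?num_real//.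
have := hp_Fupper s (2 * u - s') t0 t'0.
have e : (s - u) ^+ 2 + (t - t') ^+ 2 = (t / w - t' / w) ^+ 2.
  have e1 : t - t' = w * (t / w - t' / w) by field; rewrite gt_eqF.
  by rewrite e1 exprMn we /u; ring.
rewrite -e; lra.
Qed.

(* k is the slope along c of the limit of the distance functions to x i. The point
   of the half-plane with coordinates a, b, where b >= 0, is the limit of the
   points at distance b / w from c (a + k b / w) on the geodesics to x i, with
   w = sqrt (1 - k^2): these rays make the angle arccos (- k) with c. *)
Lemma half_plane : bounds_flat_half_plane c.
Proof.
by exists F; split=> [s|s s' t t' t0 t'0]; [exact: hp_F0|exact: hp_F].
Qed.

End HalfPlane.

(** * Contraction along rank one axes *)

Section SlopeGap.
Context (R : realType) (X : metricType R) (M : cnspace X).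
Local Notation d := mdist.
Local Notation geo := (geo M).

Definition translated (c : R -> X) (l : R) :=
  exists2 f : X -> X, (forall x y, d (f x) (f y) = d x y) &
    forall s, f (c s) = c (s + l).

(** Translations along the line are kept in both directions, as mere distance-preserving maps, so
    that reversing the line preserves the record. *)
Record rank_one_line (c : R -> X) (l : R) : Prop := RankOneLine {
  rol_line : geodesic_line c ;
  rol_gt0 : 0 < l ;
  rol_fwd : translated c l ;
  rol_bwd : translated c (- l) ;
  rol_flat : ~ bounds_flat_half_plane c }.

Lemma rank_one_line_rev c l :
  rank_one_line c l -> rank_one_line (fun s => c (- s)) l.
Proof.
move=> [lc l0 [f fi fc] [g gi gc] nf]; split => //.
- by move=> s t; rewrite lc -opprD normrN.
- by exists g => // s; rewrite gc; congr c; ring.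
- by exists f => // s; rewrite fc; congr c; ring.
- move=> [F [F0 Fd]]; apply: nf; exists (fun s t => F (- s) t); split=> [s|].
    by rewrite F0 opprK.
  by move=> s s' t t' t0 t'0; rewrite Fd//; congr Num.sqrt; ring.
Qed.

Lemma rank_one_line_axis (h : isometryType X) c : axis h c ->
  ~ bounds_flat_half_plane c ->
  exists2 l, rank_one_line c l & forall s, h (c s) = c (s + l).
Proof.
move=> [lc [l l0 hc]] nf; exists l => //; split=> //.
  by exists h => //; exact: isomP.
exists (isom_inv h); first exact: isomP.
move=> s; rewrite -{1}(subrK l s) -hc; apply: mdist_positivity.
by rewrite -(isomP h) /= isom_inv_funK mdistxx.
Qed.

Variables (c : R -> X) (l : R) (Hc : rank_one_line c l).
Let lc := rol_line Hc.

Lemma iter_translated (m : R) : translated c m ->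
  forall n : nat, translated c (n%:R * m).
Proof.
move=> [f fi fc]; elim=> [|n [g gi gc]].
  by exists id => // s; rewrite mul0r addr0.
exists (f \o g) => [x y|s] /=; first by rewrite fi.
by rewrite gc fc; congr c; rewrite -natr1; ring.
Qed.

Lemma shift_window (r : R) : exists (f : X -> X) (r' : R),
  [/\ forall x y, d (f x) (f y) = d x y, 0 <= r' <= l &
      forall s, f (c (s + r)) = c (s + r')].
Proof.
have l0 := rol_gt0 Hc.
pose n := Num.truncn (`|r| / l).
have nr : `|r| < n.+1%:R * l.
  have := truncn_itv (divr_ge0 (normr_ge0 r) (ltW l0)).
  by move=> /andP[_]; rewrite ltr_pdivrMr.
have rn : 0 <= r + n.+1%:R * l.
  by have := ler_norm (- r); rewrite normrN; lra.
pose m := Num.truncn ((r + n.+1%:R * l) / l).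
have [f fi fc] := iter_translated (rol_fwd Hc) n.+1.
have [g gi gc] := iter_translated (rol_bwd Hc) m.
have := truncn_itv (divr_ge0 rn (ltW l0)); rewrite -/m.
rewrite ler_pdivlMr// ltr_pdivrMr// -natr1 => /andP[h1 h2].
exists (g \o f), (r + n.+1%:R * l + m%:R * - l); split.
- by move=> x y; rewrite /= gi fi.
- by lra.
- by move=> s; rewrite /= fc gc; congr c; ring.
Qed.

Lemma line_convex3 x p q r : p <= q -> q <= r ->
  (r - p) * d x (c q) <= (r - q) * d x (c p) + (q - p) * d x (c r).
Proof.
move=> pq qr; have [rp|rp] := eqVneq r p.
  have qr' : q = r by lra.
  by rewrite qr' rp; lra.
have r0 : 0 < r - p by rewrite subr_gt0 lt_neqAle eq_sym rp; lra.
have u01 : 0 <= (q - p) / (r - p) <= 1.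
  by apply/andP; split; [apply: divr_ge0; lra|rewrite ler_pdivrMr//; lra].
have := line_convex M lc x p r u01.
have -> : (1 - (q - p) / (r - p)) * p + (q - p) / (r - p) * r = q.
  by field; lra.
rewrite -(ler_pM2l r0) => /le_trans; apply.
rewrite le_eqVlt; apply/orP; left; apply/eqP.
by field; lra.
Qed.

(** Chord slopes of the convex function [d x (c s)] increase; denominators are cleared to allow
    degenerate intervals. *)
Lemma slope_mono x p q r s : p <= q -> q <= r -> r <= s ->
  (d x (c q) - d x (c p)) * (s - r) <= (d x (c s) - d x (c r)) * (q - p).
Proof.
move=> pq qr rs; have [sq|sq] := eqVneq s q.
  have qr' : r = q by lra.
  by rewrite qr' sq !subrr mulr0 mul0r.
have s0 : 0 < s - q by rewrite subr_gt0 lt_neqAle eq_sym sq; lra.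
have h1 := line_convex3 x pq (le_trans qr rs); have h2 := line_convex3 x qr rs.
set gp := d x (c p) in h1 *; set gq := d x (c q) in h1 h2 *.
set gr := d x (c r) in h2 *; set gs := d x (c s) in h1 h2 *.
have k1 : (gq - gp) * (s - q) <= (gs - gq) * (q - p) by lra.
have k2 : (gs - gq) * (s - r) <= (gs - gr) * (s - q) by lra.
have sr : 0 <= s - r by lra.
have qp : 0 <= q - p by lra.
have := ler_wpM2r sr k1; have := ler_wpM2r qp k2.
by move=> a b; rewrite -(ler_pM2r s0); lra.
Qed.

Lemma right_mono x s t : pj lc x <= s -> s <= t -> d x (c s) <= d x (c t).
Proof.
move=> as_ st; have [e|ne] := eqVneq s (pj lc x).
  by rewrite e; exact: pjP.
have h := slope_mono x as_ (lexx s) st; have p := pjP lc x s.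
have a0 : 0 < s - pj lc x by rewrite subr_gt0 lt_neqAle eq_sym ne.
rewrite -subr_ge0 -(pmulr_lge0 _ a0); apply: le_trans h.
by rewrite mulr_ge0//; lra.
Qed.

(** Finite stage of the hypotheses of [half_plane]: as [N] grows, [x] recedes and its distance
    function becomes affine on longer windows; [1 - e] keeps the limit slope below 1. *)
Definition almost_affine (e N : R) := exists (x : X) (u k : R),
  [/\ 0 <= k <= 1 - e, N <= d x (c u) & forall w, `|w - u| <= N / 2 ->
     `|d x (c w) - d x (c u) - k * (w - u)| <= `|w - u| / N].

(** Otherwise [m] would rise by more than 1 on each of [n.+1] disjoint triples of indices. *)
Lemma pigeonhole (m : nat -> R) (n : nat) :
  (forall j, m j <= m j.+1) -> 0 <= m 0%N -> m (3 * n.+1)%N < n.+1%:R ->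
  exists2 j : nat, (j < n.+1)%N & m (3 * j).+2 <= m (3 * j)%N + 1.
Proof.
move=> mm m0 mn; apply: contrapT => h.
have key j : (j <= n.+1)%N -> j%:R <= m (3 * j)%N.
  elim: j => [|j IH] jn; first by rewrite muln0.
  have jn' := IH (ltnW jn).
  have : m (3 * j)%N + 1 < m (3 * j).+2.
    by rewrite ltNge; apply/negP => h'; apply: h; exists j.
  have := mm (3 * j).+2; rewrite (_ : (3 * j).+3 = (3 * j.+1)%N); last by lia.
  by rewrite -natr1; lra.
by have := key n.+1 (leqnn _); lra.
Qed.

(** By convexity, the increments of the distance over consecutive intervals of length [N] after the
    projection are nonnegative, increase, and stay below [(1 - e) * N] before [s]. Hence three
    consecutive ones differ by at most 1, and the function is almost affine about the middle of the
    middle interval. *)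
Lemma slope_defect_affine (e : R) (n : nat) x s s' :
  let N := n.+1%:R in 0 < e < 1 ->
  pj lc x + 3 * N * N + N <= s -> s <= s' ->
  d x (c s') < d x (c s) + (1 - e) * (s' - s) -> almost_affine e N.
Proof.
move=> N e01 xs ss' hlt; set a := pj lc x in xs.
have N0 : 0 < N by rewrite /N ltr0n.
pose g v := d x (c v).
have ss : s < s'.
  by rewrite lt_neqAle ss' andbT; apply/eqP => ess; move: hlt; rewrite ess; lra.
pose m (j : nat) := g (a + j%:R * N + N) - g (a + j%:R * N).
have mm j : m j <= m j.+1.
  have := @slope_mono x (a + j%:R * N) (a + j%:R * N + N)
     (a + j.+1%:R * N) (a + j.+1%:R * N + N).
  rewrite -natr1 => /(_ ltac:(lra) ltac:(lra) ltac:(lra)).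
  rewrite (addrAC _ N) subrr add0r (addrAC _ N) subrr add0r ler_pM2r// => h.
  by rewrite /m -natr1.
have m0 : 0 <= m 0%N.
  by rewrite /m subr_ge0; apply: right_mono; rewrite -/a mul0r; lra.
have gN q : q + N <= s -> g (q + N) - g q <= (1 - e) * N.
  move=> qs; have := @slope_mono x q (q + N) s s'.
  move=> /(_ ltac:(lra) ltac:(lra) ltac:(lra)).
  rewrite (addrAC _ N) subrr add0r => h.
  have s0 : 0 < s' - s by lra.
  rewrite -(ler_pM2r s0) /g; apply: (le_trans h).
  have : d x (c s') - d x (c s) <= (1 - e) * (s' - s) by lra.
  by move=> /(ler_wpM2r (ltW N0)); lra.
have mN : m (3 * n.+1)%N < N.
  have : m (3 * n.+1)%N <= (1 - e) * N by apply: gN; rewrite natrM -/N; lra.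
  by nra.
have [j jn mj] := @pigeonhole m n mm m0 mN.
pose v := a + (3 * j)%:R * N.
have va : a <= v by rewrite lerDl mulr_ge0// ltW.
have jN : j%:R + 1 <= N by rewrite natr1 /N ler_nat.
have vs : v + 3 * N <= s.
  have h : j%:R * N <= (N - 1) * N by apply: ler_wpM2r; lra.
  by apply: le_trans xs; rewrite /v natrM; lra.
pose K := g (v + N) - g v.
have mK : m (3 * j)%N = K by [].
have m2 : g (v + 2 * N + N) - g (v + 2 * N) <= K + 1.
  move: mj; rewrite mK /m -addn2 natrD mulrDl /v.
  by rewrite (addrA a).
have K0 : 0 <= K by rewrite subr_ge0; apply: right_mono => //; lra.
have KN : K <= (1 - e) * N by apply: gN; lra.
exists x, (v + N + N / 2), (K / N); split.
- by apply/andP; split; [apply: divr_ge0; lra|rewrite ler_pdivrMr].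
- by have := pj_dist M lc x (v + N + N / 2); rewrite ler_norml -/a; lra.
move=> w; set u := v + N + N / 2.
have eu : u = v + N + N / 2 by []; clearbody u.
move=> wu; rewrite ler_pdivlMr//.
rewrite -[X in `|_| * X <= _](ger0_norm (ltW N0)) -normrM.
have -> : (d x (c w) - d x (c u) - K / N * (w - u)) * N =
    (g w - g u) * N - K * (w - u) by rewrite /g; field; lra.
move: wu; rewrite ler_norml => /andP[w1 w2].
have [uw|wu] := leP u w.
  have := @slope_mono x v (v + N) u w ltac:(lra) ltac:(lra) uw.
  rewrite (addrAC _ N) subrr add0r -!/(g _) -/K => h1.
  have := @slope_mono x u w (v + 2 * N) (v + 2 * N + N) uw ltac:(lra) ltac:(lra).
  rewrite (addrAC _ N) subrr add0r -!/(g _) => h2.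
  have h3 : (g (v + 2 * N + N) - g (v + 2 * N)) * (w - u) <= (K + 1) * (w - u).
    by apply: ler_wpM2r => //; lra.
  by rewrite (ger0_norm (_ : 0 <= w - u)) ?ler_norml; lra.
have := @slope_mono x v (v + N) w u ltac:(lra) ltac:(lra) (ltW wu).
rewrite (addrAC _ N) subrr add0r -!/(g _) -/K => h1.
have := @slope_mono x w u (v + 2 * N) (v + 2 * N + N) (ltW wu) ltac:(lra) ltac:(lra).
rewrite (addrAC _ N) subrr add0r -!/(g _) => h2.
have h3 : (g (v + 2 * N + N) - g (v + 2 * N)) * (u - w) <= (K + 1) * (u - w).
  by apply: ler_wpM2r => //; lra.
by rewrite (ler0_norm (_ : w - u <= 0)) ?ler_norml; lra.
Qed.

Lemma almost_affine_half_plane (e : R) : 0 < e < 1 ->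
  (forall n : nat, almost_affine e n.+1%:R) -> False.
Proof.
move=> e01 H; apply: (rol_flat Hc).
have {}H (n : nat) : exists t : X * (R * R), [/\ 0 <= t.2.1 <= l,
    0 <= t.2.2 <= 1 - e, n.+1%:R <= d t.1 (c t.2.1) &
    forall s, `|s - t.2.1| <= n.+1%:R / 2 ->
      `|d t.1 (c s) - d t.1 (c t.2.1) - t.2.2 * (s - t.2.1)|
        <= `|s - t.2.1| / n.+1%:R].
  have [x [u [k [k01 xu hx]]]] := H n.
  have [f [r' [fi r'l fc]]] := shift_window u.
  have dfc s : d (f x) (c s) = d x (c (s - r' + u)).
    by rewrite -(fi x) fc subrK.
  exists (f x, (r', k)); split=> //=.
    by rewrite dfc subrr add0r.
  move=> s hs; rewrite !dfc subrr add0r.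
  by have := hx (s - r' + u); rewrite addrK; apply.
have [t tP] := choice H; clear H.
have [U [UU ooU]] := ultra_oo.
have [k [/= k01 kU]] : `[0, 1 - e]%classic `&`
    [set k : R | (fun n => (t n).2.2) @ U --> k] !=set0.
  have := @segment_compact R 0 (1 - e); rewrite compact_ultra.
  apply; first exact: fmap_ultra.
  apply: (fmapS _ filterT) => n _ /=; rewrite in_itv/=.
  by have [] := tP n.
rewrite in_itv/= in k01.
have l0 := rol_gt0 Hc.
have big A : U [set n | A < n.+1%:R :> R].
  have [A0|A0] := leP A 0.
    by apply: filterS filterT => n _ /=; apply: (le_lt_trans A0); rewrite ltr0n.
  have iA : 0 < A^-1 by rewrite invr_gt0.
  apply: filterS (ooU _ (near_infty_natSinv_lt (PosNum iA))) => n /=.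
  by rewrite ltf_pV2 ?posrE// ltr0n.
have est n s : `|s| + l <= n.+1%:R / 2 ->
   `|d (t n).1 (c s) - d (t n).1 (c 0) - (t n).2.2 * s|
     <= (`|s| + 2 * l) / n.+1%:R.
  move=> sn; have [/andP[r0 rl] _ _ hs] := tP n.
  have n0 := normr_ge0 s; have n1 := ler_norm s; have n2 := ler_norm (- s).
  rewrite normrN in n2.
  have N0 : 0 < n.+1%:R :> R by rewrite ltr0n.
  have a1 : `|s - (t n).2.1| <= `|s| + l by rewrite ler_norml; lra.
  have h1 := hs s (le_trans a1 sn).
  have a2 : `|0 - (t n).2.1| <= l by rewrite ler_norml; lra.
  have h2 := hs 0 ltac:(lra).
  have b1 : `|s - (t n).2.1| / n.+1%:R <= (`|s| + l) / n.+1%:R.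
    by rewrite ler_pM2r// invr_gt0.
  have b2 : `|0 - (t n).2.1| / n.+1%:R <= l / n.+1%:R.
    by rewrite ler_pM2r// invr_gt0.
  move: (le_trans h1 b1) (le_trans h2 b2).
  rewrite !ler_norml => /andP[c1 c2] /andP[c3 c4].
  rewrite (_ : (_ + 2 * l) / _ = (`|s| + l) / n.+1%:R + l / n.+1%:R); last first.
    by field; rewrite gt_eqF.
  by move: c1 c2 c3 c4; set A := _ / _; set B := _ / _; clearbody A B; lra.
apply: (@half_plane R X M nat U UU c lc (fun n => (t n).1) k).
- by lra.
- move=> A; apply: filterS (big (A + l)) => n /= An.
  have [/andP[r0 rl] _ h _] := tP n.
  have := line_lip lc (t n).1 (t n).2.1 0; rewrite subr0 (ger0_norm r0).
  rewrite ler_norml => /andP[_ h2].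
  have h3 := lt_le_trans An h; lra.
move=> s.
have -> : (fun n => d (t n).1 (c s) - d (t n).1 (c 0)) =
   (fun n => (d (t n).1 (c s) - d (t n).1 (c 0) - (t n).2.2 * s) + (t n).2.2 * s).
  by apply/funext => n; rewrite subrK.
rewrite -[k * s]add0r; apply: cvgD; last by apply: cvgM => //; exact: cvg_cst.
apply/cvgrPdist_lt => ep ep0.
apply: filterS (filterI (big (2 * (`|s| + l))) (big ((`|s| + 2 * l) / ep))).
move=> n [/= h1 h2]; rewrite sub0r normrN.
apply: (le_lt_trans (est n s _)).
  by rewrite ler_pdivlMr//; lra.
rewrite ltr_pdivrMr ?ltr0n// [ep * _]mulrC.
by move: h2; rewrite ltr_pdivrMr.
Qed.

(* Otherwise d(x, c s) is almost affine, of slope in [0, 1 - e], on arbitrarily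
   long intervals; moving these to a bounded window by powers of the isometry, an
   ultralimit produces a flat half-plane. *)
Lemma slope_gap (e : R) : 0 < e < 1 -> exists2 S, 0 < S &
  forall x s s', pj lc x + S <= s -> s <= s' ->
    d x (c s) + (1 - e) * (s' - s) <= d x (c s').
Proof.
move=> e01; apply: contrapT => h; apply: (almost_affine_half_plane e01) => n.
apply: contrapT => na; apply: h.
exists (3 * n.+1%:R * n.+1%:R + n.+1%:R).
  by rewrite ltr_wpDl ?mulr_ge0 ?ltr0n.
move=> x s s' xs ss'; rewrite leNgt; apply/negP => lt; apply: na.
by apply: (@slope_defect_affine e n x s s'); rewrite // -addrA.
Qed.

End SlopeGap.

(** * Geodesics whose end points have distant projections *)

Section Contraction.
Context (R : realType) (X : metricType R) (M : cnspace X).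
Local Notation d := mdist.
Local Notation geo := (geo M).

Lemma geo_lip x y (u v : R) : 0 <= u <= 1 -> 0 <= v <= 1 ->
  d (geo x y u) (geo x y v) <= `|u - v| * d x y.
Proof.
move=> u01 v01; apply: sqr_le_le; first by rewrite mulr_ge0 ?mdist_ge0.
apply: (le_trans (geo_geo M x y y u01 v01)).
by rewrite mdistxx exprMn real_normK ?num_real//; lra.
Qed.

Section OneLine.
Variables (c : R -> X) (l : R) (Hc : rank_one_line c l).
Local Notation lc := (rol_line Hc).
Local Notation pj := (pj lc).
Local Notation ht := (ht lc).

Lemma mdist_le_ht x y : d x y <= ht x + `|pj x - pj y| + ht y.
Proof.
have := metric_triangle x (c (pj x)) y.
have := metric_triangle (c (pj x)) (c (pj y)) y.
by rewrite lc !htE (metric_sym (c (pj y))); lra.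
Qed.

(** The slope gap at [e / 2] starts at [pj x + S]; beyond [2 * S / e] its better rate has made up
    for the initial stretch. *)
Lemma triangle_gap (e : R) : 0 < e < 1 -> exists2 L, 0 < L &
  forall x s, pj x + L <= s -> ht x + (1 - e) * (s - pj x) <= d x (c s).
Proof.
move=> e01.
have [|S S0 h] := slope_gap M Hc (e := e / 2); first lra.
exists (2 * S / e); first by rewrite divr_gt0 ?mulr_gt0//; lra.
move=> x s xs.
have e0 : 0 < e by lra.
have Se : 2 * S <= e * (s - pj x).
  by rewrite [e * _]mulrC -ler_pdivrMr//; lra.
have xS : pj x + S <= s.
  have : e * (s - pj x) <= s - pj x.
    have : 0 <= e * (s - pj x) by lra.
    by rewrite pmulr_rge0// => ?; rewrite ler_piMl//; lra.
  by lra.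
have := h x (pj x + S) s (lexx _) xS; have := ht_le lc x (pj x + S).
move=> h1 h2.
have : (1 - e) * (s - pj x) <= (1 - e / 2) * (s - (pj x + S)).
  have : 0 < e * S by rewrite mulr_gt0.
  by lra.
by lra.
Qed.

End OneLine.

Lemma pj_rev (c : R -> X) (l : R) (Hc : rank_one_line c l) x :
  pj (rol_line (rank_one_line_rev Hc)) x = - pj (rol_line Hc) x.
Proof.
apply: pjE => // s; rewrite /= opprK; exact: pjP.
Qed.

Lemma ht_rev (c : R -> X) (l : R) (Hc : rank_one_line c l) x :
  ht (rol_line (rank_one_line_rev Hc)) x = ht (rol_line Hc) x.
Proof. by rewrite /ht pj_rev opprK. Qed.

Section Bounds.
Variables (c : R -> X) (l : R) (Hc : rank_one_line c l).
Local Notation lc := (rol_line Hc).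
Local Notation pj := (pj lc).
Local Notation ht := (ht lc).

(** The weight [d x y / D] turns the quadrilateral inequality into its product form; [triangle_gap]
    at 1/2, from both ends, bounds the diagonals. The squared heights cancel, and a division by [D]
    is left. *)
Lemma quadrilateral_gap : exists2 K, 0 < K & forall x y, pj x + K <= pj y ->
  (ht x + ht y) / 2 + (pj y - pj x) / 4 <= d x y.
Proof.
have h2 : 0 < (2^-1 : R) < 1 by lra.
have [L L0 h] := triangle_gap Hc h2.
have [L' L'0 h'] := triangle_gap (rank_one_line_rev Hc) h2.
exists (L + L'); first by lra.
move=> x y xy; have h1 := h x (pj y); have h3 := h' y (- pj x).
rewrite pj_rev ht_rev !opprK (addrC (- pj x)) in h3.
have {}h1 : ht x + (1 - 2^-1) * (pj y - pj x) <= d x (c (pj y)) by apply: h1; lra.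
have {}h3 : ht y + (1 - 2^-1) * (pj y - pj x) <= d y (c (pj x)) by apply: h3; lra.
set D := pj y - pj x in h1 h3 *.
have D0 : 0 < D by rewrite /D; lra.
have xyD := pj_lip M lc x y; have hx := ht_ge0 lc x; have hy := ht_ge0 lc y.
have xy0 : 0 < d x y by move: xyD; rewrite ler_norml; lra.
have := quadrilateral M x (c (pj x)) (c (pj y)) y (divr_gt0 xy0 D0).
rewrite lc (metric_sym (c (pj x)) y) real_normK ?num_real//.
have -> : (pj x - pj y) ^+ 2 = D ^+ 2 by rewrite /D; ring.
rewrite -/(ht x) -/(ht y).
have -> : d x y / D * D ^+ 2 = d x y * D by field; lra.
have -> : (d x y / D)^-1 * d x y ^+ 2 = d x y * D by field; lra.
have q1 : (ht x + (1 - 2^-1) * D) ^+ 2 <= d x (c (pj y)) ^+ 2.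
  by rewrite ler_pXn2r ?nnegrE ?mdist_ge0//; lra.
have q2 : (ht y + (1 - 2^-1) * D) ^+ 2 <= d y (c (pj x)) ^+ 2.
  by rewrite ler_pXn2r ?nnegrE ?mdist_ge0//; lra.
move=> q3; rewrite -(ler_pM2l D0); lra.
Qed.

Variables (K : R) (K0 : 0 < K).
Hypothesis qgap : forall x y, pj x + K <= pj y ->
  (ht x + ht y) / 2 + (pj y - pj x) / 4 <= d x y.

(** Cut where the projection has advanced by [K]: each piece has length at least
    [(K + K) / 2 + K / 4]. *)
Lemma high_geodesic_long (n : nat) x y : n%:R * K <= pj y - pj x ->
  (forall z, btw x y z -> K <= ht z) -> 5 / 4 * (n%:R * K) <= d x y.
Proof.
elim: n x => [|n IH] x; first by rewrite mul0r mulr0 mdist_ge0.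
rewrite -natr1 mulrDl mul1r => xy high; have Kp := K0.
have nK0 : 0 <= n%:R * K by rewrite mulr_ge0// ltW.
have [z xyz pz] : exists2 z, btw x y z & pj z = pj x + K.
  by apply: (pj_ivt M); apply/andP; split; lra.
have h1 : 5 / 4 * (n%:R * K) <= d z y.
  apply: IH => [|w zw]; first by rewrite pz; lra.
  by apply: high; have [] := btw_transr xyz zw.
have := qgap (x := x) (y := z); rewrite pz => /(_ (lexx _)).
have := high x (btwl x y); have := high z xyz.
by move: xyz; rewrite /btw; lra.
Qed.

(** A geodesic staying above height [K] is too long: [5 / 4] of its projection, up to one step [K],
    against the detour through the line, of length at most [2 * H] plus the projection. The two
    bounds meet at [8 * H + 5 * K]. *)
Lemma low_point x y H : ht x <= H -> ht y <= H ->
  8 * H + 5 * K <= pj y - pj x -> exists2 z, btw x y z & ht z < K.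
Proof.
move=> hx hy xy; apply: contrapT => hn; have Kp := K0.
have high z : btw x y z -> K <= ht z.
  by move=> xyz; rewrite leNgt; apply/negP => lt; apply: hn; exists z.
have H0 : 0 <= H by apply: le_trans hx; exact: ht_ge0.
have L0 : 0 <= pj y - pj x by lra.
have := truncn_itv (divr_ge0 L0 (ltW K0)).
rewrite ler_pdivlMr// ltr_pdivrMr// -natr1 => /andP[n1 n2].
have := high_geodesic_long n1 high; have := mdist_le_ht Hc x y.
rewrite distrC (ger0_norm L0); lra.
Qed.

(** Height is convex along geodesics, so low points before and after [z] make [z] low. *)
Lemma pass_near x y H m : ht x <= H -> ht y <= H ->
  pj x + (8 * H + 5 * K) <= m -> m + (8 * H + 5 * K) <= pj y ->
  exists2 z, btw x y z & d z (c m) <= K.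
Proof.
move=> hx hy xm my; have Kp := K0.
have H0 : 0 <= H by apply: le_trans hx; exact: ht_ge0.
have [z xyz pz] : exists2 z, btw x y z & pj z = m.
  by apply: (pj_ivt M); apply/andP; split; lra.
have hz := ht_btw M xyz hx hy.
have [|w1 xz1 h1] := low_point (x := x) (y := z) hx hz; first by rewrite pz; lra.
have [|w2 zy2 h2] := low_point (x := z) (y := y) hz hy; first by rewrite pz; lra.
exists z => //; rewrite -pz; change (ht z <= K).
have [_ x2z] := btw_transr xyz zy2.
have [_ zz] := btw_trans x2z xz1.
by apply: (ht_btw M zz); exact: ltW.
Qed.

Section Triangle.
Variables (e S : R).
(** [D] is the improved distance [K + 1] plus one unit of drift. [B] bounds, in [corner_improve],
    how far the low point [w] projects from the corner: [D], plus a piece of geodesic of length at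
    most [D + (8 * D + 5 * K) + D]. The condition on [e] is what [near_corner] asks at distance
    [B]. *)
Let D := K + 2.
Let B := 11 * D + 5 * K.
Hypotheses (e01 : 0 < e < 1) (eB : B ^+ 2 * (2 * e) <= 1) (S0 : 0 < S).
Hypothesis sgap : forall x s s', pj x + S <= s -> s <= s' ->
    d x (c s) + (1 - e) * (s' - s) <= d x (c s').

(** Past the corner the distance from [x] grows at rate almost 1, so the triangle [x],
    [c (pj x + S)], [c s] is almost degenerate: the squared distance in question is at most
    [2 * e * B ^+ 2]. *)
Lemma near_corner x s : pj x + S <= s -> s - (pj x + S) <= B ->
  exists2 z, btw x (c s) z & d z (c (pj x + S)) <= 1.
Proof.
have [Kp e01' eB' Sp] := And4 K0 e01 eB S0.
move=> xs sB; set a := pj x + S in xs sB *.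
have := sgap (lexx _) xs; rewrite -/a.
have tr : `|d x (c s) - d x (c a)| <= `|s - a| by exact: (line_lip lc).
set r := d x (c a) in tr *; set L := d x (c s) in tr *; set k := s - a in sB tr *.
move=> rL; have k0 : 0 <= k by rewrite subr_ge0.
have r0 : 0 <= r := mdist_ge0 _ _.
rewrite (ger0_norm k0) ler_norml in tr.
have ek : 0 <= (1 - e) * k by rewrite mulr_ge0//; lra.
have [L0|L0] := eqVneq L 0.
  exists x; first exact: btwl.
  by rewrite -/r; lra.
have Lp : 0 < L by rewrite lt_neqAle eq_sym L0 mdist_ge0.
have u01 : 0 <= r / L <= 1.
  by apply/andP; split; [apply: divr_ge0; lra|rewrite ler_pdivrMr//; lra].
exists (geo x (c s) (r / L)); first exact: geo_btw.
rewrite metric_sym; apply: sqr_le_le => //.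
apply: (le_trans (geo_cn M _ _ _ u01)).
rewrite lc (metric_sym _ x) -/L -/r distrC (ger0_norm k0).
have -> : (1 - r / L) * r ^+ 2 + r / L * k ^+ 2 - r / L * (1 - r / L) * L ^+ 2
   = r / L * (k ^+ 2 - (L - r) ^+ 2) by field.
have kk : 0 <= k ^+ 2 - (L - r) ^+ 2.
  by rewrite subr_sqr mulr_ge0//; lra.
have [_ u1] := andP u01.
apply: (@le_trans _ _ (k ^+ 2 - (L - r) ^+ 2)); first by rewrite ler_piMl.
have k2 : k ^+ 2 <= B ^+ 2 by rewrite ler_pXn2r ?nnegrE//; lra.
have e0 : 0 <= 2 * e by lra.
have := ler_wpM2r e0 k2.
have : ((1 - e) * k) ^+ 2 <= (L - r) ^+ 2 by rewrite ler_pXn2r ?nnegrE//; lra.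
have := sqr_ge0 (e * k).
by rewrite expr1n; lra.
Qed.

(** The geodesic beyond [z] contains a point [w] of height at most [K] near the corner. If [w]
    projects before the corner, some later point projects onto it with height at most [K]; otherwise
    [near_corner] applies with [s := pj w], and replacing [c (pj w)] by [w] costs at most [K]. *)
Lemma corner_improve x s z : pj x + S <= s -> btw x (c s) z ->
  d z (c (pj x + S)) <= D ->
  exists2 z', btw x (c s) z' & d z' (c (pj x + S)) <= D - 1.
Proof.
have [Kp Sp] := conj K0 S0.
have De : D = K + 2 by [].
have Be : B = 11 * D + 5 * K by [].
move=> xs xz zD; set a := pj x + S in xs zD *.
have hz : ht z <= D by apply: le_trans zD; exact: ht_le.
have pz := pj_dist M lc z a.
have hcs : ht (c s) = 0 by rewrite htE (pj_line M) mdistxx.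
have [w [xw hw wB]] : exists w, [/\ btw x (c s) w, ht w <= K & `|pj w - a| <= B].
  have [far|close] := leP (8 * D + 5 * K) (s - pj z); last first.
    exists (c s); split; [exact: btwr|by rewrite hcs ltW|].
    by rewrite (pj_line M)//; move: pz; rewrite !ler_norml; lra.
  have [y zy py] : exists2 y, btw z (c s) y & pj y = pj z + (8 * D + 5 * K).
    by apply: (pj_ivt M) => //; rewrite (pj_line M)//; lra.
  have hy : ht y <= D by apply: (ht_btw M zy) => //; rewrite hcs; lra.
  have [|w zw hw] := low_point (x := z) (y := y) hz hy; first by rewrite py; lra.
  have [zcw _] := btw_trans zy zw.
  have [xw _] := btw_transr xz zcw.
  exists w; split=> //; first exact: ltW.
  apply: (le_trans (pj_dist M lc w a)).
  have := metric_triangle w z (c a); have := mdist_le_ht Hc z y.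
  rewrite py opprD addrA subrr sub0r normrN ger0_norm; last by lra.
  move: zw; rewrite /btw (metric_sym w z); have := mdist_ge0 w y.
  by lra.
have [wa|wa] := leP (pj w) a.
  have [z' wz' pz'] : exists2 z', btw w (c s) z' & pj z' = a.
    by apply: (pj_ivt M) => //; rewrite (pj_line M)//; lra.
  exists z'; first by have [] := btw_transr xw wz'.
  rewrite -pz' -/(ht z').
  have : ht z' <= K by apply: (ht_btw M wz') => //; rewrite hcs ltW.
  by lra.
have [|z1 xz1 z1a] := near_corner (x := x) (s := pj w) (ltW wa).
  by rewrite -/a; move: wB; rewrite ler_norml; lra.
have [z2 xz2 z12] := btw_transport M w xz1.
exists z2; first by have [] := btw_trans xw xz2.
have := metric_triangle z2 z1 (c a); rewrite (metric_sym z2 z1).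
rewrite -/a in z1a; move: z12; rewrite (metric_sym (c (pj w))) -/(ht w); lra.
Qed.

(* Induction on s: moving s by at most 1 degrades the distance D - 1 to at most D,
   and corner_improve brings it back to D - 1. *)
Lemma triangle_corner x s : pj x + S <= s ->
  exists2 z, btw x (c s) z & d z (c (pj x + S)) <= D.
Proof.
have [Kp Sp] := conj K0 S0.
have De : D = K + 2 by [].
have Be : B = 11 * D + 5 * K by [].
move=> xs; set a := pj x + S in xs *.
suff h (n : nat) t : a <= t <= a + n%:R ->
    exists2 z, btw x (c t) z & d z (c a) <= D - 1.
  have [|z xz za] := h (Num.truncn (s - a)).+1 s.
    rewrite xs/=; have sa : 0 <= s - a by lra.
    by have := truncn_itv sa => /andP[_ /ltW]; lra.
  by exists z => //; lra.
elim: n t => [|n IH] t.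
  rewrite addr0 => at_; have -> : t = a by apply/eqP; rewrite eq_le; lra.
  by exists (c a); [exact: btwr|rewrite mdistxx; lra].
rewrite -natr1 => at_; have n0 : 0 <= n%:R :> R by [].
pose t' := Num.max a (t - 1).
have t'1 : a <= t' <= a + n%:R by rewrite /t' le_max lexx/= ge_max; lra.
have t'2 : `|t' - t| <= 1.
  by rewrite /t' ler_norml /Num.max; case: ifP => ?; lra.
have [z xz za] := IH t' t'1.
have [z' xz' zz'] := btw_transport M (c t) xz.
apply: (corner_improve _ xz'); first by rewrite -/a; lra.
have := metric_triangle z' z (c a); rewrite (metric_sym z' z) -/a.
by move: zz'; rewrite lc; lra.
Qed.

End Triangle.

Lemma ex_triangle_corner : exists S D, [/\ 0 < S, 0 < D & forall x s,
  pj x + S <= s -> exists2 z, btw x (c s) z & d z (c (pj x + S)) <= D].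
Proof.
have Kp := K0; pose B := 11 * (K + 2) + 5 * K.
have B1 : 1 <= B by rewrite /B; lra.
have B2 : 1 <= B ^+ 2 by nra.
pose e := (2 * B ^+ 2)^-1.
have e0 : 0 < e by rewrite invr_gt0; lra.
have eB : B ^+ 2 * (2 * e) = 1 by rewrite /e; field; lra.
have e1 : e < 1 by nra.
have [|S S0 sgap] := slope_gap M Hc (e := e); first by rewrite e0.
exists S, (K + 2); split=> [//||]; first lra.
move=> x s; apply: (@triangle_corner e) => //; first by rewrite e0.
by rewrite eB.
Qed.

End Bounds.

Section Quadrilateral.
Variables (c : R -> X) (l : R) (Hc : rank_one_line c l).
Local Notation lc := (rol_line Hc).
Local Notation pj := (pj lc).
Local Notation ht := (ht lc).

Lemma pj_geo y (u : R) : 0 <= u <= 1 ->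
  pj y = pj (geo (c (pj y)) y u).
Proof.
move=> u01; apply/esym/pjE => // s.
have h1 := geo_distl M (c (pj y)) y u01.
have h2 := geo_distr M (c (pj y)) y u01.
have h3 := metric_triangle y (geo (c (pj y)) y u) (c s).
have h4 := pjP lc y s.
rewrite (metric_sym _ (c (pj y))) h1.
by move: h3 h4 h2; rewrite (metric_sym y (geo _ _ _)) (metric_sym y (c (pj y))); lra.
Qed.

(** The end [y] is pulled to its projection [c b] along a segment on which the projection is
    constant, then moved back in steps of length at most 1. A pass at distance [K + 1] from [c m] is
    improved to [K]: the corner estimate from both ends gives points [w1], [w2] of the geodesic at
    height at most [H], between which [pass_near] applies. *)
Lemma strong_contraction : exists2 C, 0 < C & forall x y m,
  pj x + C <= m -> m + C <= pj y -> exists2 z, btw x y z & d z (c m) <= C.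
Proof.
have [K K0 qgap] := quadrilateral_gap Hc.
have [S [D [S0 D0 tc]]] := ex_triangle_corner K0 qgap.
have [S' [D' [S'0 D'0 tc']]] : exists S D, [/\ 0 < S, 0 < D & forall x s,
    s + S <= pj x -> exists2 z, btw x (c s) z & d z (c (pj x - S)) <= D].
  have [K' K'0 qgap'] := quadrilateral_gap (rank_one_line_rev Hc).
  have [S' [D' [S'0 D'0 h]]] := ex_triangle_corner K'0 qgap'.
  exists S', D'; split=> // x s xs; have := h x (- s).
  rewrite pj_rev opprK (_ : - (- pj x + S') = pj x - S'); last by ring.
  by apply; lra.
pose H := D + D' + K + 1; pose C := S + S' + (K + 1) + H + 8 * H + 5 * K.
have He : H = D + D' + K + 1 by [].
have Ce : C = S + S' + (K + 1) + H + 8 * H + 5 * K by [].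
exists C; first by lra.
move=> x y m xm my; set b := pj y in my.
pose yu u := geo (c b) y u.
have improve (u : R) z : 0 <= u <= 1 -> btw x (yu u) z -> d z (c m) <= K + 1 ->
    exists2 z', btw x (yu u) z' & d z' (c m) <= K.
  move=> u01 xz zm; have pz := pj_dist M lc z m.
  have hz : ht z <= K + 1 by apply: le_trans zm; exact: ht_le.
  have pb : pj (yu u) = b by rewrite -pj_geo.
  move: (le_trans pz zm); rewrite ler_norml => /andP[pz1 pz2].
  have [|z1 xz1 z1c] := tc x (pj z); first by lra.
  have [w1 xw1 zw1] := btw_transport M z xz1.
  have [|z2 yz2 z2c] := tc' (yu u) (pj z); first by rewrite pb; lra.
  have [w2 /btw_sym w2z zw2] := btw_transport M z yz2.
  rewrite (metric_sym (c _)) -/(ht z) in zw1.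
  rewrite (metric_sym (c _)) -/(ht z) in zw2.
  have e1 : d w1 (c (pj x + S)) <= H.
    by have := metric_triangle w1 z1 (c (pj x + S)); rewrite (metric_sym w1 z1); lra.
  have e2 : d w2 (c (b - S')) <= H.
    rewrite pb in z2c.
    by have := metric_triangle w2 z2 (c (b - S')); rewrite (metric_sym w2 z2); lra.
  have p1 := pj_dist M lc w1 (pj x + S); have p2 := pj_dist M lc w2 (b - S').
  move: p1 p2; rewrite !ler_norml => p1 p2.
  have [||||z' wz' z'm] := @pass_near _ _ Hc K K0 qgap w1 w2 H m.
  - by apply: le_trans e1; exact: ht_le.
  - by apply: le_trans e2; exact: ht_le.
  - by lra.
  - by lra.
  exists z' => //.
  have [xw2 x2z] := btw_transr xz w2z.
  have [x2w1 _] := btw_trans x2z xw1.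
  have [x2z' _] := btw_transr x2w1 wz'.
  by have [] := btw_trans xw2 x2z'.
pose L := d (c b) y; pose n := (Num.truncn L).+1.
have nL : L < n%:R.
  by have := truncn_itv (mdist_ge0 (c b) y) => /andP[].
have n0 : 0 < n%:R :> R by rewrite ltr0n.
suff h (k : nat) : (k <= n)%N ->
    exists2 z, btw x (yu (k%:R / n%:R)) z & d z (c m) <= K.
  have [z xz zm] := h n (leqnn n).
  move: xz; rewrite divff ?gt_eqF// /yu geo1 => xz.
  by exists z => //; lra.
elim: k => [_|k IH kn].
  rewrite mul0r /yu geo0.
  have [|z0 xz0 z0c] := tc x b; first by lra.
  have p0 := pj_dist M lc z0 (pj x + S); rewrite ler_norml in p0.
  have hb : ht (c b) = 0 by rewrite htE (pj_line M) mdistxx.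
  have [||||z' wz' z'm] := @pass_near _ _ Hc K K0 qgap z0 (c b) H m.
  - by have := ht_le lc z0 (pj x + S); lra.
  - by rewrite hb; lra.
  - by lra.
  - by rewrite (pj_line M); lra.
  by exists z' => //; have [] := btw_transr xz0 wz'.
have [z xz zm] := IH (ltnW kn).
have f01 (j : nat) : (j <= n)%N -> 0 <= (j%:R / n%:R : R) <= 1.
  move=> jn; apply/andP; split; first by rewrite divr_ge0.
  by rewrite ler_pdivrMr// mul1r ler_nat.
have [z' xz' zz'] := btw_transport M (yu (k.+1%:R / n%:R)) xz.
apply: (improve _ z'); [exact: f01|by []|].
have := geo_lip (c b) y (f01 _ (ltnW kn)) (f01 _ kn).
rewrite -/(yu _) -/(yu _) -/L -mulrBl -natr1 opprD addrA subrr sub0r.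
rewrite normrM normrN1 mul1r (ger0_norm (_ : 0 <= n%:R^-1)) ?invr_ge0// => h1.
have h2 : n%:R^-1 * L <= 1 by rewrite mulrC ler_pdivrMr// mul1r ltW.
have := metric_triangle z' z (c m); rewrite (metric_sym z' z).
rewrite -natr1 in zz'; move: (le_trans zz' (le_trans h1 h2)).
by move: zm; clear; lra.
Qed.

End Quadrilateral.
End Contraction.

(** * Rays and the cone topology *)

Section Rays.
Context (R : realType) (X : metricType R) (M : cnspace X).
Local Notation d := mdist.
Local Notation geo := (geo M).

Lemma ray_dist (r : ray X) s t : 0 <= s -> 0 <= t -> d (r s) (r t) = `|s - t|.
Proof. by move=> s0 t0; rewrite (rayP r)// in_itv/= ?s0 ?t0. Qed.

Lemma bclassP (r r' : ray X) : bclass r = bclass r' <->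
  exists C : R, forall t, 0 <= t -> d (r t) (r' t) <= C.
Proof. by split=> [/eqquotP/asboolP|h]; last exact/eqquotP/asboolP. Qed.

Lemma breprK (xi : boundary X) : bclass (brepr xi) = xi.
Proof. exact: reprK. Qed.

Lemma ray_geo (r : ray X) t T : 0 <= t <= T -> 0 < T ->
  r t = geo (r 0) (r T) (t / T).
Proof.
move=> /andP[t0 tT] T0; apply: geo_uniq.
- by rewrite divr_ge0 ?(ltW T0)//= ler_pdivrMr// mul1r.
- rewrite !ray_dist ?(ltW T0)// !sub0r !normrN !ger0_norm ?(ltW T0)//.
  by rewrite divfK// gt_eqF.
- rewrite !ray_dist ?(ltW T0)// sub0r normrN (ger0_norm (ltW T0)).
  rewrite ler0_norm ?subr_le0// le_eqVlt; apply/orP; left; apply/eqP.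
  by field; rewrite gt_eqF.
Qed.

Lemma ray_frac (t T : R) : 0 <= t <= T -> 0 < T -> 0 <= t / T <= 1.
Proof.
by move=> /andP[t0 tT] T0; rewrite divr_ge0 ?(ltW T0)//= ler_pdivrMr// mul1r.
Qed.

Lemma ray_convex (r r' : ray X) t T : 0 <= t <= T -> 0 < T ->
  d (r t) (r' t) <= (1 - t / T) * d (r 0) (r' 0) + t / T * d (r T) (r' T).
Proof.
move=> tT T0; rewrite (ray_geo r tT T0) (ray_geo r' tT T0).
by apply: geo_convex; exact: ray_frac.
Qed.

Lemma ray_spread (r r' : ray X) t T : r 0 = r' 0 -> 0 <= t <= T -> 0 < T ->
  d (r t) (r' t) <= t / T * d (r T) (r' T).
Proof.
move=> r0 tT T0; have := ray_convex r r' tT T0.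
by rewrite r0 mdistxx mulr0 add0r.
Qed.

(** A bounded convex function on a half-line does not increase. [T] makes the contribution of the
    bound [C] at most [e]. *)
Lemma asymptotic_close (r r' : ray X) t : bclass r = bclass r' -> 0 <= t ->
  d (r t) (r' t) <= d (r 0) (r' 0).
Proof.
move=> /bclassP[C hC] t0; apply/ler_addgt0Pr => e e0.
have C0 : 0 <= C by apply: le_trans (hC 0 (lexx 0)); exact: mdist_ge0.
pose T := t + 1 + t * C / e.
have tCe : 0 <= t * C / e by rewrite divr_ge0 ?mulr_ge0// ltW.
have T0 : 0 < T by rewrite /T; lra.
have tT : 0 <= t <= T by rewrite t0 /T; lra.
apply: (le_trans (ray_convex r r' tT T0)).
have /andP[f0 f1] := ray_frac tT T0.
have h1 : (1 - t / T) * d (r 0) (r' 0) <= d (r 0) (r' 0).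
  by rewrite ler_piMl ?mdist_ge0//; lra.
have h2 : t / T * d (r T) (r' T) <= t / T * C.
  by apply: ler_wpM2l => //; apply: hC; exact: ltW.
have h3 : t / T * C <= e.
  rewrite mulrAC ler_pdivrMr// [e * T]mulrC -ler_pdivrMr// /T; lra.
by lra.
Qed.

Lemma asymptotic_eq (r r' : ray X) t : bclass r = bclass r' -> r 0 = r' 0 ->
  0 <= t -> r t = r' t.
Proof.
move=> rr' r0 t0; apply/mdist_positivity/eqP; rewrite eq_le mdist_ge0 andbT.
by apply: le_trans (asymptotic_close rr' t0) _; rewrite r0 mdistxx.
Qed.

Section RayFrom.
Variables (p : X) (c : ray X) (U : set_system nat).
Hypotheses (UU : UltraFilter U) (ooU : \oo `<=` U).

Let L (n : nat) := d p (c n%:R).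
Let P (n : nat) t := geo p (c n%:R) (t / L n).

Lemma ray_from_length (n : nat) : `|L n - n%:R| <= d p (c 0).
Proof.
have := mdist_lip (c n%:R) p (c 0); rewrite ray_dist// subr0 normr_nat.
by rewrite metric_sym.
Qed.

Lemma ray_from_far A : U [set n | A < L n].
Proof.
apply: filterS (ooU (nbhs_infty_gtr (A + d p (c 0)))) => n /= hn.
by have := ray_from_length n; rewrite ler_norml; move: hn; set N := n%:R; lra.
Qed.

Lemma ray_from_dist n s t : 0 <= s < L n -> 0 <= t < L n ->
  d (P n s) (P n t) = `|s - t|.
Proof.
move=> /andP[s0 sL] /andP[t0 tL]; have L0 : 0 < L n by lra.
have fs : 0 <= s / L n <= 1 by apply: ray_frac => //; rewrite s0 ltW.
have ft : 0 <= t / L n <= 1 by apply: ray_frac => //; rewrite t0 ltW.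
apply/eqP; rewrite eq_le; apply/andP; split.
  apply: (le_trans (geo_lip M _ _ fs ft)).
  rewrite -/(L n) -mulrBl normrM (ger0_norm (_ : 0 <= (L n)^-1)) ?invr_ge0 ?(ltW L0)//.
  by rewrite divfK ?gt_eqF.
have := mdist_lip p (P n s) (P n t); rewrite /P !geo_distl// -/(L n).
by rewrite !divfK ?gt_eqF.
Qed.

Lemma ray_from_cvg t : 0 <= t -> exists z : X, P n t @[n --> U] --> z.
Proof.
move=> t0; apply: (@cn_proper _ _ M nat U (P^~ t) p t UU).
apply: filterS (ray_from_far t) => n /= tL.
rewrite /P geo_distl ?ray_frac//.
- by rewrite -/(L n) divfK// gt_eqF//; lra.
- by rewrite t0 ltW.
- by lra.
Qed.

(** Ultralimit of the geodesics from [p] to [c n%:R], which stay within twice [d p (c 0)] of [c]. *)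
Lemma ex_ray_from : exists r : ray X, r 0 = p /\ bclass r = bclass c.
Proof.
pose Q t := xget p [set z : X | P n t @[n --> U] --> z].
have QP t : 0 <= t -> P n t @[n --> U] --> Q t.
  by move=> /ray_from_cvg /(xgetPex p).
have Qd s t : 0 <= s -> 0 <= t -> d (Q s) (Q t) = `|s - t|.
  move=> s0 t0.
  have h : (fun n => d (P n s) (P n t)) @ U --> d (Q s) (Q t).
    by apply: mdist_cvg; exact: QP.
  have h' : (fun n => d (P n s) (P n t)) @ U --> `|s - t|.
    apply: cvg_near_cst.
    apply: filterS (filterI (ray_from_far s) (ray_from_far t)) => n [/= hs ht].
    by rewrite ray_from_dist ?s0 ?t0.
  exact: (cvg_unique (@Rhausdorff R) h h').
have Qr : geodesic_ray Q.
  by move=> s t; rewrite !in_itv/= !andbT; exact: Qd.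
exists (Ray Qr); split=> /=.
  apply/esym/mdist_positivity.
  have h : (fun n => d p (P n 0)) @ U --> d p (Q 0).
    by apply: mdist_cvg; [exact: cvg_cst|exact: QP].
  have h' : (fun n => d p (P n 0)) @ U --> (0 : R).
    apply: cvg_near_cst; apply: filterS filterT => n _.
    by rewrite /P mul0r geo0 mdistxx.
  exact: (cvg_unique (@Rhausdorff R) h h').
apply/bclassP; exists (2 * d p (c 0)) => t t0 /=.
have h : (fun n => d (P n t) (c t)) @ U --> d (Q t) (c t).
  by apply: mdist_cvg; [exact: QP|exact: cvg_cst].
have h' : (fun n : nat => 2 * d p (c 0)) @ U --> 2 * d p (c 0) by exact: cvg_cst.
apply: (cvg_le_to h h').
apply: filterS (filterI (ray_from_far t) (ooU (nbhs_infty_gtr 0))) => n [/= tL n0].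
have L0 : 0 < L n by lra.
have ft : 0 <= t / L n <= 1 by apply: ray_frac => //; rewrite t0 ltW.
have [f0 f1] := andP ft.
have h1 := geo_convexr M (c n%:R) p (c 0) ft.
have h2 : d (geo (c 0) (c n%:R) (t / L n)) (c t) <= d p (c 0).
  have tn : 0 <= t / L n * n%:R <= n%:R by rewrite mulr_ge0//= ler_piMl.
  have := ray_geo c tn n0; rewrite mulfK ?gt_eqF// => <-.
  rewrite ray_dist//; last by case/andP: tn.
  have -> : t / L n * n%:R - t = t / L n * (n%:R - L n) by field; rewrite gt_eqF.
  rewrite normrM (ger0_norm f0); apply: (@le_trans _ _ `|n%:R - L n|).
    by rewrite ler_piMl.
  by rewrite distrC; exact: ray_from_length.
have h3 : (1 - t / L n) * d p (c 0) <= d p (c 0).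
  by rewrite ler_piMl ?mdist_ge0//; lra.
apply: (le_trans (metric_triangle _ (geo (c 0) (c n%:R) (t / L n)) _)).
by rewrite mulr_natl mulr2n; apply: lerD => //; exact: le_trans h1 h3.
Qed.

End RayFrom.

Lemma ex_ray (p : X) (xi : boundary X) : exists r : ray X, r 0 = p /\ bclass r = xi.
Proof.
have [U [UU ooU]] := ultra_oo.
by have [r [r0 rc]] := ex_ray_from p (brepr xi) UU ooU; exists r; rewrite -(breprK xi).
Qed.

Definition rayto p xi : ray X := sval (cid (ex_ray p xi)).

Lemma rayto0 p xi : rayto p xi 0 = p.
Proof. by have [] := svalP (cid (ex_ray p xi)). Qed.

Lemma bclass_rayto p xi : bclass (rayto p xi) = xi.
Proof. by have [] := svalP (cid (ex_ray p xi)). Qed.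

Lemma raytoE (r : ray X) t : 0 <= t -> rayto (r 0) (bclass r) t = r t.
Proof. by move=> t0; apply: asymptotic_eq => //; rewrite ?bclass_rayto ?rayto0. Qed.

Lemma rayto_base p q xi t : 0 <= t -> d (rayto p xi t) (rayto q xi t) <= d p q.
Proof.
move=> t0; have := @asymptotic_close (rayto p xi) (rayto q xi) t.
by rewrite !bclass_rayto !rayto0; apply.
Qed.

Lemma rayto_act (f : isometryType X) p xi t : 0 <= t ->
  rayto (f p) (bact f xi) t = f (rayto p xi t).
Proof.
move=> t0; have := @raytoE (ray_comp f (rayto p xi)) t t0.
rewrite /= rayto0 => <-; congr (rayto _ _ t).
apply/bclassP; have := breprK xi; rewrite -{2}(bclass_rayto p xi).
move=> /bclassP[C hC]; exists C => s s0 /=; rewrite isomP; exact: hC.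
Qed.

End Rays.

(** * The bordification seen from a base point *)

Section Cone.
Context (R : realType) (X : metricType R) (M : cnspace X) (o : X).
Local Notation d := mdist.
Local Notation geo := (geo M).
Local Notation rayto := (rayto M).
Local Notation Xbar := (bordification o).

(** The unit speed geodesic from [o] to [x], resting at [x] on arrival; for [x = o] the quotient is
    0 by convention, which yields [o]. *)
Definition stopped x (t : R) := geo o x (Num.min 1 (t / d o x)).

Definition at_time (z : Xbar) (t : R) : X :=
  match z with inl x => stopped x t | inr xi => rayto o xi t end.

Lemma stopped_frac x t : 0 <= t -> 0 <= Num.min 1 (t / d o x) <= 1.
Proof.
by move=> t0; rewrite le_min ler01 divr_ge0 ?mdist_ge0//= ge_min lexx.
Qed.

Lemma stopped_lt x t : 0 <= t <= d o x -> 0 < d o x ->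
  stopped x t = geo o x (t / d o x).
Proof.
move=> /andP[t0 tx] x0; rewrite /stopped min_r//.
by rewrite ler_pdivrMr// mul1r.
Qed.

Lemma stopped_ge x t : d o x <= t -> stopped x t = x.
Proof.
move=> xt; rewrite /stopped; have [x0|x0] := eqVneq (d o x) 0.
  by rewrite -(mdist_positivity _ _ x0) geoxx// stopped_frac// (le_trans _ xt)// mdist_ge0.
have xp : 0 < d o x by rewrite lt_neqAle eq_sym x0 mdist_ge0.
by rewrite min_l ?geo1// ler_pdivlMr// mul1r.
Qed.

Lemma stopped_dist x t : 0 <= t -> d o (stopped x t) = Num.min (d o x) t.
Proof.
move=> t0; have [xt|tx] := leP (d o x) t; first by rewrite stopped_ge.
have x0 : 0 < d o x by lra.
by rewrite stopped_lt ?t0 ?ltW// geo_distl ?ray_frac ?t0 ?ltW// divfK// gt_eqF.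
Qed.

Lemma geodesic_from_at_time (z : Xbar) c t : geodesic_from z c -> 0 <= t ->
  c t = at_time z t.
Proof.
case: z => [x|xi] /=.
  move=> [[c0 c1 ci] cx] t0; have [xt|tx] := leP (d o x) t.
    by rewrite cx// stopped_ge.
  have x0 : 0 < d o x by lra.
  rewrite stopped_lt ?t0 ?ltW//; apply: geo_uniq.
  - by rewrite ray_frac ?t0 ?ltW.
  - rewrite divfK ?gt_eqF// -{1}c0 ci ?in_itv/= ?lexx ?t0 ?mdist_ge0 ?(ltW tx)//.
    by rewrite sub0r normrN ger0_norm.
  - rewrite mulrBl mul1r divfK ?gt_eqF// -{1}c1 ci ?in_itv/= ?lexx ?t0 ?mdist_ge0 ?(ltW tx)//.
    by rewrite distrC ger0_norm//; lra.
move=> [r rxi [r0 ->]] t0; rewrite -rxi -r0; apply/esym; exact: raytoE.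
Qed.

Lemma ex_geodesic_from (z : Xbar) : exists c, geodesic_from z c.
Proof.
case: z => [x|xi] /=; last first.
  by exists (rayto o xi), (rayto o xi); rewrite ?bclass_rayto ?rayto0.
exists (fun t => if t < 0 then o else stopped x t).
have x0 := mdist_ge0 o x.
split; last by move=> t xt; rewrite ltNge (le_trans x0 xt) stopped_ge.
have [xx|xx] := eqVneq (d o x) 0.
  have xo := mdist_positivity _ _ xx; rewrite -xo in xx x0 *.
  split; rewrite ?mdistxx ?ltxx ?stopped_ge ?mdistxx// => s t.
  rewrite !in_itv/= => /andP[s0 s1] /andP[t0 t1].
  have -> : s = 0 by lra.
  have -> : t = 0 by lra.
  by rewrite ltxx mdistxx subrr normr0.
have xp : 0 < d o x by rewrite lt_neqAle eq_sym xx x0.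
split.
- by rewrite ltxx stopped_lt ?lexx// mul0r geo0.
- by rewrite ltNge x0/= stopped_ge.
move=> s t; rewrite !in_itv/= => /andP[s0 s1] /andP[t0 t1].
rewrite !ltNge s0 t0/= !stopped_lt ?s0 ?t0//.
have fs : 0 <= s / d o x <= 1 by apply: ray_frac => //; rewrite s0.
have ft : 0 <= t / d o x <= 1 by apply: ray_frac => //; rewrite t0.
apply/eqP; rewrite eq_le; apply/andP; split.
  apply: (le_trans (geo_lip M _ _ fs ft)).
  rewrite -mulrBl normrM (ger0_norm (_ : 0 <= (d o x)^-1)) ?invr_ge0//.
  by rewrite divfK.
have := mdist_lip o (geo o x (s / d o x)) (geo o x (t / d o x)).
by rewrite !geo_distl// !divfK.
Qed.

Lemma cone_nbhdP (z : Xbar) r e w : cone_nbhd z r e w <->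
  forall t, 0 <= t <= r -> d (at_time z t) (at_time w t) < e.
Proof.
split=> [[c [c' [zc wc' h]]] t tr|h].
  have [t0 _] := andP tr.
  by rewrite -(geodesic_from_at_time zc t0) -(geodesic_from_at_time wc' t0) h.
have [c zc] := ex_geodesic_from z; have [c' wc'] := ex_geodesic_from w.
exists c, c'; split=> // t tr; have [t0 _] := andP tr.
by rewrite (geodesic_from_at_time zc t0) (geodesic_from_at_time wc' t0) h.
Qed.

Lemma continuous_at_time t : 0 <= t -> continuous (fun z : Xbar => at_time z t).
Proof.
move=> t0; apply/continuousP => A oA.
change (@cone_open R X o ((fun z : Xbar => at_time z t) @^-1` A)).
move=> z Az.
have := open_nbhs_nbhs (conj oA Az); move=> /nbhs_mdist[e e0 eA].
exists (t + 1); first lra.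
exists e => // w /cone_nbhdP h; apply: eA; apply: h; lra.
Qed.

Lemma nbhs_boundary_bordification (xi : boundary X) (A : set Xbar) :
  nbhs (inr xi : Xbar) A -> exists r e : R, [/\ 0 < r, 0 < e &
    forall w : Xbar, (forall t, 0 <= t <= r -> d (rayto o xi t) (at_time w t) < e)
      -> A w].
Proof.
rewrite nbhsE => -[B [oB Bxi] BA].
have oB' : cone_open B by exact: oB.
have [r r0 [e e0 h]] := oB' _ Bxi.
by exists r, e; split=> // w hw; apply/BA/h/cone_nbhdP.
Qed.

Lemma stopped_ray_close x (xi : boundary X) t r : 0 <= t <= r -> 0 < r -> r <= d o x ->
  d (rayto o xi t) (stopped x t) <= t / r * d (rayto o xi r) (stopped x r).
Proof.
move=> tr r0 rx; have [t0 tr'] := andP tr.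
have x0 : 0 < d o x by lra.
have tx : t <= d o x := le_trans tr' rx.
rewrite (ray_geo M (rayto o xi) tr r0) rayto0.
have e : stopped x t = geo o (stopped x r) (t / r).
  have rx' : 0 <= r <= d o x by rewrite (ltW r0).
  have tx' : 0 <= t <= d o x by rewrite t0.
  apply: geo_uniq; first exact: ray_frac.
    by rewrite !stopped_dist ?(ltW r0)// (min_r tx) (min_r rx) divfK ?gt_eqF.
  rewrite !stopped_dist ?(ltW r0)// (min_r rx) !stopped_lt//.
  apply: (le_trans (geo_lip M _ _ (ray_frac tx' x0) (ray_frac rx' x0))).
  rewrite -mulrBl normrM (ger0_norm (_ : 0 <= (d o x)^-1)) ?invr_ge0 ?(ltW x0)//.
  rewrite divfK ?gt_eqF// ler0_norm; last lra.
  by rewrite mulrBl mul1r divfK ?gt_eqF// opprB.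
by rewrite e; apply: geo_convexl; exact: ray_frac.
Qed.

(** Geodesics issuing from [o] spread convexly, so closeness at the single time [r] controls all
    earlier times, provided [x n] is not reached before [r]. *)
Lemma cvg_boundary (I : Type) (F : set_system I) {FF : Filter F} (x : I -> X)
    (xi : boundary X) :
  (inl (x n) : Xbar) @[n --> F] --> (inr xi : Xbar) <->
  (forall A, F [set n | A < d o (x n)]) /\
  (forall r e, 0 < r -> 0 < e ->
    F [set n | d (rayto o xi r) (stopped (x n) r) < e]).
Proof.
split=> [h|[far h]].
  have cvg_t t : 0 <= t ->
      stopped (x n) t @[n --> F] --> (rayto o xi t : X).
    move=> t0; have := @continuous_at_time t t0 (inr xi : Xbar).
    exact: cvg_comp h.
  split=> [A|r e r0 e0]; last by have /cvg_mdistP := cvg_t _ (ltW r0); apply.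
  have A0 : 0 <= `|A| + 2 by have := normr_ge0 A; lra.
  have /cvg_mdistP/(_ 1 ltr01) := cvg_t _ A0.
  apply: filterS => n /= hn.
  have := metric_triangle o (stopped (x n) (`|A| + 2)) (rayto o xi (`|A| + 2)).
  have := ray_dist (rayto o xi) (lexx 0) A0; rewrite rayto0 sub0r normrN (ger0_norm A0).
  rewrite stopped_dist// (metric_sym (stopped _ _)).
  have : Num.min (d o (x n)) (`|A| + 2) <= d o (x n) by rewrite ge_min lexx.
  by have := ler_norm A; lra.
move=> A /nbhs_boundary_bordification[r [e [r0 e0 hA]]].
apply: (fmapS _ (filterI (far r) (h r e r0 e0))) => n [/= rx hn].
apply: hA => t tr /=.
apply: (le_lt_trans (stopped_ray_close _ tr r0 (ltW rx))).
apply: le_lt_trans hn; rewrite ler_piMl ?mdist_ge0//.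
by have /andP[] := ray_frac tr r0.
Qed.

End Cone.

(** * Topology of the boundary *)

Section BoundaryTopology.
Context (R : realType) (X : metricType R) (M : cnspace X) (o : X).
Context (xi0 : boundary X).
Local Notation d := mdist.
Local Notation rayto := (rayto M).
Local Notation bX := (tboundary o xi0).

Lemma continuous_rayto_base t : 0 <= t ->
  continuous (fun xi : bX => (rayto o xi t : X)).
Proof.
move=> t0 xi.
have c1 : continuous (inr : bX -> bordification o) by exact: initial_continuous.
exact: (cvg_comp _ _ (c1 xi) (@continuous_at_time R X M o t t0 (inr xi : bordification o))).
Qed.

Lemma nbhs_boundary (xi : bX) (A : set bX) : nbhs xi A <->
  exists r e : R, [/\ 0 < r, 0 < e & forall z : bX,
    d (rayto o xi r) (rayto o z r) < e -> A z].
Proof.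
split=> [|[r [e [r0 e0 h]]]].
  rewrite nbhsE => -[B [[C oC CB] Bxi] BA].
  have : nbhs (inr xi : bordification o) C.
    by apply: open_nbhs_nbhs; split=> //; rewrite -CB in Bxi.
  move=> /(nbhs_boundary_bordification M)[r [e [r0 e0 h]]].
  exists r, e; split=> // z hz; apply: BA; rewrite -CB; apply: h => t tr /=.
  apply: le_lt_trans hz.
  apply: (le_trans (@ray_spread R X M (rayto o xi) (rayto o z) t r _ tr r0)).
    by rewrite !rayto0.
  by have /andP[? ?] := ray_frac tr r0; rewrite ler_piMl ?mdist_ge0.
have /cvg_mdistP := @continuous_rayto_base r (ltW r0) xi.
by move=> /(_ e e0); apply: filterS.
Qed.

(** Neighbourhoods are described by rays from [o]. Changing the base point costs a bounded amount
    [D] at time [T], which convexity scales by [t / T] at time [t]. *)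
Lemma continuous_rayto p t : 0 <= t ->
  continuous (fun xi : bX => (rayto p xi t : X)).
Proof.
move=> t0 xi.
apply: (proj2 (@cvg_mdistP R X bX (nbhs xi) (nbhs_filter xi) _ _)) => e e0.
apply/nbhs_boundary.
pose D := 2 * d p o + 1; pose T := t + 1 + t * D / e.
have D0 : 0 < D by have := mdist_ge0 p o; rewrite /D; lra.
have tDe : 0 <= t * D / e by rewrite divr_ge0 ?mulr_ge0// ltW.
have T0 : 0 < T by rewrite /T; lra.
have tT : 0 <= t <= T by rewrite t0 /T; lra.
exists T, 1; split=> // z /= h.
apply: (@le_lt_trans _ _ (t / T * d (rayto p xi T) (rayto p z T))).
  by apply: ray_spread => //; rewrite !rayto0.
have hD : d (rayto p xi T) (rayto p z T) <= D.
  have := metric_triangle (rayto p xi T) (rayto o xi T) (rayto p z T).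
  have := metric_triangle (rayto o xi T) (rayto o z T) (rayto p z T).
  have := rayto_base M p o xi (ltW T0); have := rayto_base M o p z (ltW T0).
  by rewrite (metric_sym o p) /D; lra.
have /andP[f0 f1] := ray_frac tT T0.
apply: (le_lt_trans (ler_wpM2l f0 hD)).
rewrite mulrAC ltr_pdivrMr// [e * T]mulrC -ltr_pdivrMr// /T; lra.
Qed.

Lemma open_rayto p t (A : set X) : 0 <= t -> open A ->
  open [set xi : bX | A (rayto p xi t)].
Proof. by move=> t0; move: A; apply/continuousP; exact: continuous_rayto. Qed.

Lemma compact_boundary : compact [set: bX].
Proof.
rewrite compact_ultra => F UF _.
have ex t : 0 <= t -> exists z : X, rayto o xi t @[xi --> F] --> z.
  move=> t0; apply: (@cn_proper _ _ M bX F _ o t UF).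
  apply: filterS filterT => xi _ /=.
  have := ray_dist (rayto o xi) (lexx 0) t0; rewrite rayto0 => ->.
  by rewrite sub0r normrN ger0_norm.
pose Q t := xget o [set z : X | rayto o xi t @[xi --> F] --> z].
have QP t : 0 <= t -> rayto o xi t @[xi --> F] --> Q t.
  by move=> /ex /(xgetPex o).
have Qd s t : 0 <= s -> 0 <= t -> d (Q s) (Q t) = `|s - t|.
  move=> s0 t0.
  have h : (fun xi => d (rayto o xi s) (rayto o xi t)) @ F --> d (Q s) (Q t).
    by apply: mdist_cvg; exact: QP.
  have h' : (fun xi => d (rayto o xi s) (rayto o xi t)) @ F --> `|s - t|.
    by apply: cvg_near_cst; apply: filterS filterT => xi _; rewrite ray_dist.
  exact: (cvg_unique (@Rhausdorff R) h h').
have Qr : geodesic_ray Q.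
  by move=> s t; rewrite !in_itv/= !andbT; exact: Qd.
have Q0 : Q 0 = o.
  apply/esym/mdist_positivity.
  have h : (fun xi => d o (rayto o xi 0)) @ F --> d o (Q 0).
    by apply: mdist_cvg; [exact: cvg_cst|exact: QP].
  have h' : (fun xi => d o (rayto o xi 0)) @ F --> (0 : R).
    by apply: cvg_near_cst; apply: filterS filterT => xi _; rewrite rayto0 mdistxx.
  exact: (cvg_unique (@Rhausdorff R) h h').
exists (bclass (Ray Qr) : bX); split=> // A /nbhs_boundary[r [e [r0 e0 h]]].
have /cvg_mdistP/(_ e e0) := QP r (ltW r0); apply: filterS => xi /= hxi.
apply: h; have := @raytoE R X M (Ray Qr) r (ltW r0).
by rewrite /= Q0 => ->.
Qed.

(* Lindelof: finitely many balls of scale [m] cover the compact boundary. *)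
Lemma countable_base : exists V : nat -> nat -> set bX,
  (forall m i, open (V m i)) /\ forall (A : set bX) xi, open A -> A xi ->
    exists m i, V m i xi /\ V m i `<=` A.
Proof.
pose N (m : nat) (z : bX) : set bX :=
  [set xi : bX | d (rayto o z m.+1%:R) (rayto o xi m.+1%:R) < m.+1%:R^-1].
have oN m z : open (N m z).
  rewrite openE => xi /= Nxi.
  have := @continuous_rayto o m.+1%:R (ler0n _ _) xi.
  have e0 : 0 < m.+1%:R^-1 - d (rayto o z m.+1%:R) (rayto o xi m.+1%:R).
    by rewrite subr_gt0.
  move=> /cvg_mdistP/(_ _ e0); apply: filterS => w /= hw.
  apply: (le_lt_trans (metric_triangle _ (rayto o xi m.+1%:R) _)).
  by rewrite addrC -ltrBrDr.
have fin m : exists s : nat -> bX, forall xi, exists i, N m (s i) xi.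
  have := compact_boundary; rewrite compact_cover.
  move=> /(_ bX setT (N m)) [|xi _|D _ cD].
  - by move=> z _; exact: oN.
  - by exists xi => //; rewrite /N/= mdistxx invr_gt0.
  exists (nth xi0 (finmap.enum_fset D)) => xi.
  have [z zD Nz] := cD xi I.
  by exists (index z (finmap.enum_fset D)); rewrite nth_index.
have [s hs] := choice fin.
exists (fun m i => N m (s m i)); split=> // A xi oA Axi.
have /nbhs_boundary[r [e [r0 e0 h]]] := open_nbhs_nbhs (conj oA Axi).
have [m [/= mr me]] : exists m : nat, r < m.+1%:R /\ m.+1%:R^-1 < e / 2.
  have e20 : 0 < e / 2 by lra.
  have h1 : \oo [set m : nat | m.+1%:R^-1 < e / 2].
    exact: (near_infty_natSinv_lt (PosNum e20)).
  have h2 : \oo [set m : nat | r < m%:R] by exact: nbhs_infty_gtr.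
  have [m /= {}h1 {}h2] := filterI_ex h1 h2.
  exists m; split=> //; apply: (lt_trans h2); by rewrite ltr_nat.
have [i hi] := hs m xi; exists m, i; split=> // z hz; apply: h.
have m0 : 0 < m.+1%:R :> R by rewrite ltr0n.
have rm : 0 <= r <= m.+1%:R by rewrite !ltW.
apply: (le_lt_trans (@ray_spread R X M (rayto o xi) (rayto o z) r _ _ rm m0)).
  by rewrite !rayto0.
have /andP[? f1] := ray_frac rm m0.
apply: (@le_lt_trans _ _ (d (rayto o xi m.+1%:R) (rayto o z m.+1%:R))).
  by rewrite ler_piMl ?mdist_ge0.
apply: (le_lt_trans (metric_triangle _ (rayto o (s m i) m.+1%:R) _)).
rewrite (metric_sym (rayto o xi _)).
have a1 := lt_trans hi me; have a2 := lt_trans hz me.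
by rewrite [e]splitr; exact: ltrD.
Qed.

End BoundaryTopology.

(** * Independent rank one isometries *)

Section PingPong.
Context (R : realType) (X : metricType R) (M : cnspace X).
Local Notation d := mdist.
Local Notation geo := (geo M).

(** If some [x] projects far along both lines, the geodesic from [c 0] to [x] passes near [c s] and
    near [c' s], at nearly equal distances from [c 0]; so these points are close, with a bound
    independent of [s]. *)
Lemma separated_lines (c c' : R -> X) (l l' : R) (Hc : rank_one_line c l)
    (Hc' : rank_one_line c' l') :
  ~ (exists C : R, forall s, 0 <= s -> d (c s) (c' s) <= C) ->
  exists2 T, 0 < T & forall x, T < pj (rol_line Hc) x ->
    pj (rol_line Hc') x <= T.
Proof.
move=> nasym; have [C C0 hC] := strong_contraction M Hc.
have [C' C'0 hC'] := strong_contraction M Hc'.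
apply: contrapT => hT; apply: nasym.
pose E := d (c 0) (c' 0).
exists (4 * (C + C') + 3 * E) => s s0.
have E0 : 0 <= E by exact: mdist_ge0.
have lc := rol_line Hc; have lc' := rol_line Hc'.
have [sC|sC] := leP s (C + C' + E).
  have := metric_triangle (c s) (c 0) (c' s).
  have := metric_triangle (c 0) (c' 0) (c' s).
  by rewrite -/E lc lc' !(subr0, sub0r) normrN !ger0_norm//; lra.
have [x [h1 h2]] : exists x, s + C + C' < pj (rol_line Hc) x /\
    s + C + C' < pj (rol_line Hc') x.
  apply: contrapT => hx; apply: hT; exists (s + C + C'); first by lra.
  move=> x h1; rewrite leNgt; apply/negP => h2; apply: hx; by exists x.
have p0 := pj_line M (rol_line Hc) 0.
have p0' := pj_dist M (rol_line Hc') (c 0) 0.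
rewrite -/E subr0 ler_norml in p0'.
have [||z oz zs] := hC (c 0) x s; [by rewrite p0; lra|by lra|].
have [||z' oz' z's] := hC' (c 0) x s; [by lra|by lra|].
have a1 := mdist_lip (c 0) (c s) z; have a2 := mdist_lip (c 0) (c' s) z'.
rewrite lc sub0r normrN (ger0_norm s0) (metric_sym (c s)) ler_norml in a1.
rewrite (metric_sym (c' s)) ler_norml in a2.
have a3 := metric_triangle (c 0) (c' 0) (c' s).
have a4 := metric_triangle (c' 0) (c 0) (c' s).
rewrite lc' sub0r normrN (ger0_norm s0) -/E in a3.
rewrite lc' sub0r normrN (ger0_norm s0) (metric_sym (c' 0) (c 0)) -/E in a4.
have zz : d z z' <= 2 * C + 2 * C' + 2 * E.
  move: oz oz' => /(btw_geo M)[u u01 [ze zu]] /(btw_geo M)[v v01 [ze' zv]].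
  rewrite {1}ze {1}ze'.
  apply: (le_trans (geo_lip M _ _ u01 v01)).
  rewrite -(ger0_norm (mdist_ge0 (c 0) x)) -normrM mulrBl -zu -zv ler_norml.
  by lra.
have := metric_triangle (c s) z (c' s); have := metric_triangle z z' (c' s).
by rewrite (metric_sym (c s) z); lra.
Qed.

Lemma geodesic_line_ray (c : R -> X) : geodesic_line c -> geodesic_ray c.
Proof. by move=> lc s t _ _; exact: lc. Qed.

Lemma fixed_asymptotic (f : isometryType X) (r : ray X) (C : R) :
  (forall s, 0 <= s -> d (f (r s)) (r s) <= C) -> fixed_points f (bclass r).
Proof.
move=> h; rewrite /fixed_points/=.
have e : bact f (bclass r) = bclass (ray_comp f r).
  apply/bclassP; have /bclassP[D hD] := breprK (bclass r).
  by exists D => t t0 /=; rewrite isomP; exact: hD.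
by rewrite e; apply/bclassP; exists C.
Qed.

Lemma translation_displacement (f : isometryType X) c (m : R) :
  geodesic_line c -> (forall s, f (c s) = c (s + m)) ->
  forall s, d (f (c s)) (c s) <= `|m|.
Proof. by move=> lc fc s; rewrite fc lc addrAC subrr add0r. Qed.

Lemma pj_translate (f : isometryType X) (c : R -> X) (lc : geodesic_line c)
    (m : R) :
  (forall s, f (c s) = c (s + m)) -> forall x, pj lc (f x) = pj lc x + m.
Proof.
move=> fc x; apply: (pjE M) => s; rewrite -fc isomP.
have -> : s = (s - m) + m by rewrite subrK.
by rewrite -fc isomP; exact: pjP.
Qed.

(* P and Q are the projections to an axis c of h and to an axis of g; a and b are
   the translation lengths. *)
Record ping_pong (g h : isometryType X) (P Q : X -> R) (c : R -> X)
    (a b C T : R) : Prop := PingPong {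
  pp_a : 0 < a ;
  pp_b : 0 < b ;
  pp_C : 0 < C ;
  pp_T : 0 < T ;
  pp_h : forall x, P (h x) = P x + a ;
  pp_g : forall x, Q (g x) = Q x + b ;
  pp_lip : forall x y, `|P x - P y| <= d x y ;
  pp_sep : forall x, T < `|P x| -> `|Q x| <= T ;
  pp_contract : forall x y m, P x + C <= m -> m + C <= P y ->
    exists2 z, btw x y z & d z (c m) <= C }.

(** The ends of an axis are fixed by its isometry, so no end of one axis is asymptotic to an end of
    the other, and [separated_lines] applies to all four pairs of orientations. *)
Lemma independent_ping_pong (g h : isometryType X) :
  independent_rank_one g h ->
  exists P Q c a b C T, ping_pong g h P Q c a b C T.
Proof.
move=> [[cg axg ng] [ch axh nh] disj].
have [b Hg gc] := rank_one_line_axis axg ng.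
have [a Hh hc] := rank_one_line_axis axh nh.
have nas (c c' : R -> X) (m m' : R) : geodesic_line c -> geodesic_line c' ->
    (forall s, g (c s) = c (s + m)) -> (forall s, h (c' s) = c' (s + m')) ->
    ~ exists C : R, forall s, 0 <= s -> d (c s) (c' s) <= C.
  move=> lc lc' gcm hcm asym.
  have f1 : fixed_points g (bclass (Ray (geodesic_line_ray lc))).
    by apply: (@fixed_asymptotic _ _ `|m|) => s _; exact: translation_displacement.
  have f2 : fixed_points h (bclass (Ray (geodesic_line_ray lc'))).
    by apply: (@fixed_asymptotic _ _ `|m'|) => s _; exact: translation_displacement.
  have e : bclass (Ray (geodesic_line_ray lc)) = bclass (Ray (geodesic_line_ray lc')).
    exact/bclassP.
  have : (fixed_points g `&` fixed_points h) (bclass (Ray (geodesic_line_ray lc))).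
    by split=> //; rewrite e.
  by rewrite disj.
have lg := rol_line Hg; have lh := rol_line Hh.
have lg' := rol_line (rank_one_line_rev Hg).
have lh' := rol_line (rank_one_line_rev Hh).
have gc' s : g (cg (- s)) = cg (- (s - b)) by rewrite gc; congr cg; ring.
have hc' s : h (ch (- s)) = ch (- (s - a)) by rewrite hc; congr ch; ring.
have [T1 T10 h1] := separated_lines Hg Hh (nas _ _ _ _ lg lh gc hc).
have [T2 T20 h2] := separated_lines Hg (rank_one_line_rev Hh)
  (nas _ _ _ (- a) lg lh' gc hc').
have [T3 T30 h3] := separated_lines (rank_one_line_rev Hg) Hh
  (nas _ _ (- b) _ lg' lh gc' hc).
have [T4 T40 h4] := separated_lines (rank_one_line_rev Hg) (rank_one_line_rev Hh)
  (nas _ _ (- b) (- a) lg' lh' gc' hc').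
have [C C0 hC] := strong_contraction M Hh.
exists (pj (rol_line Hh)), (pj (rol_line Hg)), ch, a, b, C, (T1 + T2 + T3 + T4).
split=> //; [exact: rol_gt0 Hh|exact: rol_gt0 Hg|lra|exact: pj_translate|
  exact: pj_translate|exact: (pj_lip M)|].
move=> x; apply: contraTT; rewrite -!ltNge -leNgt.
move: (h1 x) (h2 x) (h3 x) (h4 x); rewrite !(pj_rev M).
set p := pj _ x; set q := pj _ x => k1 k2 k3 k4.
rewrite ltr_normr ler_norml => /orP[qT|qT].
  by have := k1 ltac:(lra); have := k2 ltac:(lra); lra.
by have := k3 ltac:(lra); have := k4 ltac:(lra); lra.
Qed.

Lemma ping_pong_mono g h P Q c a b C T T' : T <= T' ->
  ping_pong g h P Q c a b C T -> ping_pong g h P Q c a b C T'.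
Proof.
move=> TT' [a0 b0 C0 T0 Ph Qg lip sep con]; split=> //; first lra.
by move=> x /(le_lt_trans TT') /sep /le_trans; apply.
Qed.

(** A return behind [m - C] would make the geodesic from [r t] back to [r t0] pass within [C] of
    [c m]; but all its points are at distance at least [t0] from [r 0]. *)
Lemma persistence g h P Q c a b C T (r : ray X) m t0 t :
  ping_pong g h P Q c a b C T -> 0 <= t0 -> d (r 0) (c m) + C < t0 ->
  m + C <= P (r t0) -> t0 <= t -> m - C < P (r t).
Proof.
move=> pp t00 rm mP t0t; rewrite ltNge; apply/negP => Pm.
have [|z btz zm] := pp_contract pp (x := r t) (y := r t0) (m := m) _ mP; first lra.
have t0' : 0 <= t by lra.
have := ray_dist r (lexx 0) t0'; rewrite sub0r normrN (ger0_norm t0').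
have := ray_dist r t0' t00; rewrite ger0_norm; last lra.
have := metric_triangle (r 0) z (r t); have := metric_triangle (r 0) (c m) z.
move: btz; rewrite /btw (metric_sym (r t) z) (metric_sym (c m) z).
by have := mdist_ge0 z (r t0); lra.
Qed.

(** For large [t] the geodesic from [r' 0] to [r t] is close to [r'] on bounded sets, and the
    passing points [z] stay within [E] of [r' 0]; [t] is chosen so that the remaining error [v * D]
    is below 1. *)
Lemma asymptotic_pass (r r' : ray X) (w : X) (C t0 : R) :
  bclass r' = bclass r -> 0 <= C ->
  (forall t, t0 <= t -> exists2 z, btw (r' 0) (r t) z & d z w <= C) ->
  exists2 t, 0 <= t & d (r' t) w < C + 1.
Proof.
move=> rr C0 h; set p := r' 0 in h *.
pose D := d p (r 0); pose E := d p w + C.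
have D0 : 0 <= D by exact: mdist_ge0.
have E0 : 0 <= E by rewrite addr_ge0 ?mdist_ge0.
have ED0 : 0 <= E * D by exact: mulr_ge0.
pose t := `|t0| + 1 + D + E * D + E.
have te : t = `|t0| + 1 + D + E * D + E by [].
have n0 := normr_ge0 t0; have n1 := ler_norm t0.
have t_gt0 : 0 < t by lra.
have [|z pz zw] := h t; first by lra.
have [v v01 [zv pzv]] := btw_geo M pz; have [v0 v1] := andP v01.
have rt : t - D <= d p (r t).
  have := metric_triangle (r 0) p (r t).
  have := ray_dist r (lexx 0) (ltW t_gt0).
  by rewrite sub0r normrN (ger0_norm (ltW t_gt0)) (metric_sym (r 0) p) -/D; lra.
have zE : d p z <= E by have := metric_triangle p w z; rewrite (metric_sym w) /E; lra.
exists (v * t); first by rewrite mulr_ge0// ltW.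
have vt : 0 <= v * t <= t by rewrite mulr_ge0 ?(ltW t_gt0)//= ler_piMl// ltW.
rewrite (ray_geo M r' vt t_gt0) mulfK ?gt_eqF// -/p.
have h1 : d (geo p (r' t) v) z <= v * D.
  rewrite zv; apply: (le_trans (geo_convexl M _ _ _ v01)).
  by apply: ler_wpM2l => //; exact: (asymptotic_close M rr (ltW t_gt0)).
have h2 : v * D < 1.
  have k1 : v * (t - D) <= E by apply: le_trans zE; rewrite pzv ler_wpM2l.
  have k2 : v * D * (t - D) <= E * D.
    by have := ler_wpM2r D0 k1; lra.
  rewrite ltNge; apply/negP => k3.
  have k4 : t - D <= v * D * (t - D) by rewrite ler_peMl//; clear rr; lra.
  by clear rr h1; lra.
by clear rr; have := metric_triangle (geo p (r' t) v) z w; lra.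
Qed.

End PingPong.

(** * Rays in the product *)

Section Product.
Context (R : realType) (X1 X2 : metricType R).
Context (M1 : cnspace X1) (M2 : cnspace X2).
Local Notation d := mdist.
Local Notation X := (l2prod X1 X2).
Local Notation M := (prod_cnspace M1 M2).

Lemma geo_dist (Y : metricType R) (N : cnspace Y) x y (u v : R) :
  0 <= u <= 1 -> 0 <= v <= 1 ->
  d (geo N x y u) (geo N x y v) = `|u - v| * d x y.
Proof.
move=> u01 v01; apply/eqP; rewrite eq_le geo_lip//=.
have := mdist_lip x (geo N x y u) (geo N x y v).
by rewrite !geo_distl// -mulrBl normrM (ger0_norm (mdist_ge0 _ _)).
Qed.

Lemma rayto_close (Y : metricType R) (N : cnspace Y) (c : ray Y) xi p t :
  bclass c = xi -> 0 <= t -> d (rayto N p xi t) (c t) <= d p (c 0).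
Proof.
move=> cxi t0; have := @asymptotic_close _ _ N (rayto N p xi) c t.
by rewrite bclass_rayto rayto0; apply.
Qed.

Lemma prod_geodesic_ray (c1 : ray X1) (c2 : ray X2) (a b : R) :
  0 <= a -> 0 <= b -> a ^+ 2 + b ^+ 2 = 1 ->
  geodesic_ray (fun t => (c1 (t * a), c2 (t * b)) : X).
Proof.
move=> a0 b0 ab s t; rewrite !in_itv/= !andbT => s0 t0.
rewrite mdist_l2prod/= !ray_dist ?mulr_ge0// -!mulrBl !normrM !exprMn.
rewrite !real_normK ?num_real// -mulrDr ab mulr1.
by rewrite sqrtr_sqr.
Qed.

Lemma rayto_prod (c1 : ray X1) (c2 : ray X2) (a b : R) (xi : boundary X) p t :
  0 <= a -> 0 <= b -> a ^+ 2 + b ^+ 2 = 1 ->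
  (exists2 c : ray X, bclass c = xi &
    forall t, 0 <= t -> c t = (c1 (t * a), c2 (t * b))) ->
  0 <= t -> rayto M p xi t =
    (rayto M1 p.1 (bclass c1) (t * a), rayto M2 p.2 (bclass c2) (t * b)).
Proof.
move=> a0 b0 ab [c cxi cE] t0.
pose r : ray X := Ray (prod_geodesic_ray (rayto M1 p.1 (bclass c1))
  (rayto M2 p.2 (bclass c2)) a0 b0 ab).
have rxi : bclass r = xi.
  rewrite -cxi; apply/bclassP.
  exists (d p.1 (c1 0) + d p.2 (c2 0)) => s s0; rewrite cE//.
  apply: (le_trans (mdist_l2prod_le _ _)); rewrite /=; apply: lerD.
    by apply: rayto_close; rewrite ?mulr_ge0.
  by apply: rayto_close; rewrite ?mulr_ge0.
have := raytoE M r t0; rewrite /= !mul0r !rayto0 -surjective_pairing rxi.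
by [].
Qed.

Section Speeds.
Variables (p : X) (xi : boundary X).
Local Notation rho := (rayto M p xi).

(** The two speeds are the cosine and sine of the slope, read off at time 1 and hence available
    before a slope is known. *)
Definition speed1 := d p.1 (rho 1).1.
Definition speed2 := d p.2 (rho 1).2.

Lemma speed1E : speed1 = d p.1 (rho 1).1. Proof. by []. Qed.

Lemma speed2E : speed2 = d p.2 (rho 1).2. Proof. by []. Qed.

Lemma speed_sqr : speed1 ^+ 2 + speed2 ^+ 2 = 1.
Proof.
rewrite -(sqr_mdist_l2prod p (rho 1)).
have := ray_dist rho (lexx 0) ler01; rewrite rayto0 => ->.
by rewrite sub0r normrN normr1 expr1n.
Qed.

(** On [[0, T]] the ray is a product geodesic, so its components are geodesics of the factors run at
    constant speed. *)
Lemma rayto_components s t : 0 <= s -> 0 <= t ->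
  d (rho s).1 (rho t).1 = speed1 * `|s - t| /\
  d (rho s).2 (rho t).2 = speed2 * `|s - t|.
Proof.
move=> s0 t0; pose T := s + t + 1.
have T0 : 0 < T by rewrite /T; lra.
have sT : 0 <= s <= T by rewrite s0 /T; lra.
have tT : 0 <= t <= T by rewrite t0 /T; lra.
have oT : 0 <= (1 : R) <= T by apply/andP; split=> //; rewrite /T; lra.
have zT : 0 <= (0 : R) <= T by rewrite lexx ltW.
have [A1 [B1 [A2 [B2 h]]]] : exists A1 B1 A2 B2, forall r, 0 <= r <= T ->
    rho r = (geo M1 A1 B1 (r / T), geo M2 A2 B2 (r / T)).
  exists (rho 0).1, (rho T).1, (rho 0).2, (rho T).2 => r rT.
  exact: (ray_geo M rho rT T0).
have key (x : R) : `|s / T - t / T| * x = `|0 / T - 1 / T| * x * `|s - t|.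
  rewrite mul0r sub0r normrN -mulrBl !normrM normr1 mul1r.
  by ring.
rewrite /speed1 /speed2 -[in d p.1](rayto0 M p xi) -[in d p.2](rayto0 M p xi).
by rewrite !h//= !geo_dist ?ray_frac.
Qed.

Lemma component_ray1 : 0 < speed1 ->
  geodesic_ray (fun t => (rho (t / speed1)).1).
Proof.
move=> u0 s t; rewrite !in_itv/= !andbT => s0 t0.
have [-> _] := rayto_components (divr_ge0 s0 (ltW u0)) (divr_ge0 t0 (ltW u0)).
rewrite -mulrBl normrM (ger0_norm (_ : 0 <= speed1^-1)) ?invr_ge0 ?(ltW u0)//.
by rewrite mulrCA divff ?gt_eqF// mulr1.
Qed.

Lemma component_ray2 : 0 < speed2 ->
  geodesic_ray (fun t => (rho (t / speed2)).2).
Proof.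
move=> u0 s t; rewrite !in_itv/= !andbT => s0 t0.
have [_ ->] := rayto_components (divr_ge0 s0 (ltW u0)) (divr_ge0 t0 (ltW u0)).
rewrite -mulrBl normrM (ger0_norm (_ : 0 <= speed2^-1)) ?invr_ge0 ?(ltW u0)//.
by rewrite mulrCA divff ?gt_eqF// mulr1.
Qed.

Lemma ex_bpoint (theta : R) : 0 < speed1 -> 0 < speed2 ->
  speed1 = cos theta -> speed2 = sin theta ->
  exists eta1 eta2, bpoint eta1 eta2 theta xi.
Proof.
move=> u1 u2 e1 e2; pose c1 := Ray (component_ray1 u1).
pose c2 := Ray (component_ray2 u2).
exists (bclass c1), (bclass c2), c1, c2, rho; split=> //; first exact: bclass_rayto.
move=> t t0 /=; rewrite -e1 -e2 !mulfK ?gt_eqF//.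
exact: surjective_pairing.
Qed.

Lemma ex_bpoint1 : speed2 = 0 -> exists eta1, bpoint1 eta1 xi.
Proof.
move=> u2; have u1 : speed1 = 1.
  have := speed_sqr; rewrite u2 expr0n addr0 => h.
  have : speed1 ^+ 2 = 1 ^+ 2 by rewrite h expr1n.
  by move=> /eqP; rewrite eqrXn2 ?mdist_ge0// => /eqP.
have u10 : 0 < speed1 by rewrite u1.
pose c1 := Ray (component_ray1 u10).
exists (bclass c1), c1, p.2, rho; split=> //; first exact: bclass_rayto.
move=> t t0 /=; rewrite u1 divr1 [LHS]surjective_pairing; congr (_, _).
apply: mdist_positivity; have [_] := rayto_components t0 (lexx 0).
by rewrite rayto0 u2 mul0r.
Qed.

Lemma ex_bpoint2 : speed1 = 0 -> exists eta2, bpoint2 eta2 xi.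
Proof.
move=> u1; have u2 : speed2 = 1.
  have := speed_sqr; rewrite u1 expr0n add0r => h.
  have : speed2 ^+ 2 = 1 ^+ 2 by rewrite h expr1n.
  by move=> /eqP; rewrite eqrXn2 ?mdist_ge0// => /eqP.
have u20 : 0 < speed2 by rewrite u2.
pose c2 := Ray (component_ray2 u20).
exists (bclass c2), p.1, c2, rho; split=> //; first exact: bclass_rayto.
move=> t t0 /=; rewrite u2 divr1 [LHS]surjective_pairing; congr (_, _).
apply: mdist_positivity; have [+ _] := rayto_components t0 (lexx 0).
by rewrite rayto0 u1 mul0r.
Qed.

End Speeds.

Lemma quadrant_trig (theta : R) : 0 < theta < pi / 2 ->
  [/\ 0 < cos theta, 0 < sin theta & cos theta ^+ 2 + sin theta ^+ 2 = 1].
Proof.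
move=> /andP[t0 tp]; have p0 := pi_gt0 R; split; last exact: cos2Dsin2.
  by apply: cos_gt0_pihalf; rewrite tp andbT; lra.
by apply: sin_gt0_pi; rewrite t0/=; lra.
Qed.

Lemma bpoint_rayto eta1 eta2 (theta : R) xi p t : 0 < theta < pi / 2 ->
  bpoint eta1 eta2 theta xi -> 0 <= t -> rayto M p xi t =
    (rayto M1 p.1 eta1 (t * cos theta), rayto M2 p.2 eta2 (t * sin theta)).
Proof.
move=> /quadrant_trig[c0 s0 cs] [c1 [c2 [c [e1 e2 e3 e4]]]] t0.
by rewrite -e1 -e2; apply: rayto_prod => //; [exact: ltW|exact: ltW|exists c].
Qed.

Lemma bpoint_speed eta1 eta2 (theta : R) xi p : 0 < theta < pi / 2 ->
  bpoint eta1 eta2 theta xi ->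
  speed1 p xi = cos theta /\ speed2 p xi = sin theta.
Proof.
move=> th bp; have [c0 s0 _] := quadrant_trig th.
rewrite /speed1 /speed2 (bpoint_rayto p th bp ler01)/= !mul1r; split.
  have := ray_dist (rayto M1 p.1 eta1) (lexx 0) (ltW c0).
  by rewrite rayto0 sub0r normrN (ger0_norm (ltW c0)).
have := ray_dist (rayto M2 p.2 eta2) (lexx 0) (ltW s0).
by rewrite rayto0 sub0r normrN (ger0_norm (ltW s0)).
Qed.

Lemma bpoint1_rayto eta1 xi p t : bpoint1 eta1 xi -> 0 <= t ->
  rayto M p xi t = (rayto M1 p.1 eta1 t, p.2).
Proof.
move=> [c1 [x2 [c [e1 e3 e4]]]] t0.
have cr : geodesic_ray (fun t => (rayto M1 p.1 eta1 t, p.2) : X).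
  move=> s s'; rewrite !in_itv/= !andbT => s0 s'0.
  rewrite mdist_l2prod/= mdistxx expr0n addr0 ray_dist// sqrtr_sqr.
  by rewrite ger0_norm.
pose r := Ray cr.
have rxi : bclass r = xi.
  rewrite -e3; apply/bclassP.
  exists (d p.1 (c1 0) + d p.2 x2) => s s0; rewrite e4//.
  apply: (le_trans (mdist_l2prod_le _ _)); rewrite /= lerD2r.
  exact: rayto_close.
have := raytoE M r t0; rewrite /= !rayto0 -surjective_pairing rxi.
by [].
Qed.

Lemma bpoint2_rayto eta2 xi p t : bpoint2 eta2 xi -> 0 <= t ->
  rayto M p xi t = (p.1, rayto M2 p.2 eta2 t).
Proof.
move=> [x1 [c2 [c [e1 e3 e4]]]] t0.
have cr : geodesic_ray (fun t => (p.1, rayto M2 p.2 eta2 t) : X).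
  move=> s s'; rewrite !in_itv/= !andbT => s0 s'0.
  rewrite mdist_l2prod/= mdistxx expr0n add0r ray_dist// sqrtr_sqr.
  by rewrite ger0_norm.
pose r := Ray cr.
have rxi : bclass r = xi.
  rewrite -e3; apply/bclassP.
  exists (d p.1 x1 + d p.2 (c2 0)) => s s0; rewrite e4//.
  apply: (le_trans (mdist_l2prod_le _ _)); rewrite /= lerD2l.
  exact: rayto_close.
have := raytoE M r t0; rewrite /= !rayto0 -surjective_pairing rxi.
by [].
Qed.

Lemma speed_theta (p : X) xi : 0 < speed1 p xi -> 0 < speed2 p xi ->
  exists theta, [/\ 0 < theta < pi / 2, speed1 p xi = cos theta &
    speed2 p xi = sin theta].
Proof.
move=> u1 u2; have us := speed_sqr p xi.
have u11 : speed1 p xi < 1.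
  by rewrite ltNge; apply/negP => h; nra.
have i1 : -1 <= speed1 p xi <= 1 by lra.
have ce := acosK (i1 : speed1 p xi \in `[-1, 1]).
have se := sin_acos i1.
have e2 : speed2 p xi = sin (acos (speed1 p xi)).
  rewrite se (_ : 1 - _ = speed2 p xi ^+ 2); last by rewrite -us; ring.
  by rewrite sqrtr_sqr ger0_norm// ltW.
exists (acos (speed1 p xi)); split=> //.
have a0 := acos_ge0 i1; have api := acos_lepi i1.
have p0 := pi_gt0 R.
apply/andP; split.
  rewrite lt_neqAle a0 andbT; apply/eqP => h.
  by move: u2; rewrite e2 -h sin0 ltxx.
rewrite ltNge; apply/negP => h.
have : cos (acos (speed1 p xi)) <= cos (pi / 2).
  by rewrite leNgt ltr_cos ?in_itv/= -?leNgt ?a0 ?api//; lra.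
by rewrite cos_pihalf ce; lra.
Qed.

Lemma boundary_slopeP (theta : R) (p : X) xi : 0 < theta < pi / 2 ->
  boundary_slope theta xi <-> speed1 p xi = cos theta.
Proof.
move=> th; have [c0 s0 cs] := quadrant_trig th; split.
  by move=> [e1 [e2 /(bpoint_speed p th)[]]].
move=> u1; have u2 : speed2 p xi = sin theta.
  have := speed_sqr p xi; rewrite u1 -cs => /addrI/eqP.
  by rewrite eqrXn2 ?mdist_ge0 ?(ltW s0)// => /eqP.
have [|||//|eta1 [eta2 bp]] := @ex_bpoint p xi theta; rewrite ?u1 ?u2//.
by exists eta1, eta2.
Qed.

End Product.

(** * Shadows and radial limit points *)

Section Shadows.
Context (R : realType) (X1 X2 : metricType R).
Context (M1 : cnspace X1) (M2 : cnspace X2).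
Local Notation d := mdist.
Local Notation X := (l2prod X1 X2).
Local Notation M := (prod_cnspace M1 M2).
Local Notation G := (isometryType X1 * isometryType X2)%type.
Context (o : X) (xi0 : boundary X).
Local Notation bX := (tboundary o xi0).
Local Notation speed1 := (speed1 M1 M2).
Local Notation speed2 := (speed2 M1 M2).

Lemma open_lip_lt (f : X -> R) p t c :
  (forall x y, `|f x - f y| <= d x y) -> 0 <= t ->
  open [set xi : bX | f (rayto M p xi t) < c].
Proof.
move=> lf t0; apply: (@open_rayto _ _ M o xi0 p t [set x : X | f x < c] t0).
rewrite openE => x /= fx; apply/nbhs_mdist; exists (c - f x); first lra.
by move=> y xy /=; have := lf x y; rewrite ler_norml; lra.
Qed.

Lemma open_lip_gt (f : X -> R) p t c :
  (forall x y, `|f x - f y| <= d x y) -> 0 <= t ->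
  open [set xi : bX | c < f (rayto M p xi t)].
Proof.
move=> lf t0; apply: (@open_rayto _ _ M o xi0 p t [set x : X | c < f x] t0).
rewrite openE => x /= fx; apply/nbhs_mdist; exists (f x - c); first lra.
by move=> y xy /=; have := lf x y; rewrite ler_norml; lra.
Qed.

Lemma mdist1_lip (a : X1) (x y : X) : `|d a x.1 - d a y.1| <= d x y.
Proof. exact: le_trans (mdist_lip _ _ _) (mdist_l2prod1 _ _). Qed.

Lemma mdist2_lip (a : X2) (x y : X) : `|d a x.2 - d a y.2| <= d x y.
Proof. exact: le_trans (mdist_lip _ _ _) (mdist_l2prod2 _ _). Qed.

Lemma open_measurable_boundary (A : set bX) : open A -> measurable A.
Proof. by move=> oA; exact: sub_sigma_algebra. Qed.

Definition hit1 p (y : X) (c : R) : set bX :=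
  [set xi | exists2 t, 0 <= t & d y.1 (rayto M p xi t).1 < c].

Definition hit2 p (y : X) (c : R) : set bX :=
  [set xi | exists2 t, 0 <= t & d y.2 (rayto M p xi t).2 < c].

Lemma open_hit1 p y c : open (hit1 p y c).
Proof.
rewrite (_ : hit1 p y c = \bigcup_(t in [set t : R | 0 <= t])
  [set xi : bX | d y.1 (rayto M p xi t).1 < c]).
  apply: bigcup_open => t /= t0.
  exact: (@open_lip_lt (fun x => d y.1 x.1) p t c (mdist1_lip y.1) t0).
by apply/seteqP; split=> xi [t t0 h]; exists t.
Qed.

Lemma open_hit2 p y c : open (hit2 p y c).
Proof.
rewrite (_ : hit2 p y c = \bigcup_(t in [set t : R | 0 <= t])
  [set xi : bX | d y.2 (rayto M p xi t).2 < c]).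
  apply: bigcup_open => t /= t0.
  exact: (@open_lip_lt (fun x => d y.2 x.2) p t c (mdist2_lip y.2) t0).
by apply/seteqP; split=> xi [t t0 h]; exists t.
Qed.

Lemma measurable_boundary_slope (theta : R) : 0 < theta < pi / 2 ->
  measurable (boundary_slope theta : set bX).
Proof.
move=> th; rewrite (_ : boundary_slope theta =
  ~` ([set xi : bX | speed1 o xi < cos theta] `|`
      [set xi : bX | cos theta < speed1 o xi])).
  apply: measurableC; apply: open_measurable_boundary; apply: openU.
    exact: (@open_lip_lt (fun x => d o.1 x.1) o 1 _ (mdist1_lip o.1) ler01).
  exact: (@open_lip_gt (fun x => d o.1 x.1) o 1 _ (mdist1_lip o.1) ler01).
apply/seteqP; split=> xi.
  by move=> /(boundary_slopeP M1 M2 o xi th) /= ->; rewrite ltxx; case.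
move=> /not_orP[/= /negP h1 /negP h2]; apply/(boundary_slopeP M1 M2 o xi th).
by apply/eqP; rewrite eq_le !leNgt h1 h2.
Qed.

(** The two balls may be met at different times; this matches the definition of radial limit points,
    which treats the factors separately. *)
Definition shadow (theta : R) p y c : set bX :=
  boundary_slope theta `&` (hit1 p y c `&` hit2 p y c).

Lemma measurable_shadow (theta : R) p y c : 0 < theta < pi / 2 ->
  measurable (shadow theta p y c).
Proof.
move=> th; apply: measurableI; first exact: measurable_boundary_slope.
by apply: open_measurable_boundary; apply: openI; [exact: open_hit1|exact: open_hit2].
Qed.

Lemma shadow_act (theta : R) (g : G) p y c : 0 < theta < pi / 2 ->
  (bact (prod_isom g) : bX -> bX) @^-1`
    shadow theta (prod_isom g p) (prod_isom g y) c = shadow theta p y c.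
Proof.
move=> th.
have ract xi t : 0 <= t -> rayto M (prod_isom g p) (bact (prod_isom g) xi) t =
    prod_isom g (rayto M p xi t) by exact: rayto_act.
have e1 : (bact (prod_isom g) : bX -> bX) @^-1` boundary_slope theta
    = boundary_slope theta.
  apply/seteqP; split=> xi /=.
    move=> /(boundary_slopeP M1 M2 (prod_isom g p) _ th).
    rewrite speed1E ract//= isomP => h.
    exact/(boundary_slopeP M1 M2 p xi th).
  move=> /(boundary_slopeP M1 M2 p xi th) h.
  apply/(boundary_slopeP M1 M2 (prod_isom g p) _ th).
  by rewrite speed1E ract//= isomP.
rewrite /shadow preimage_setI e1; congr (_ `&` _).
apply/seteqP; split=> xi [[t t0 h] [s s0 h']].
  by split; [exists t|exists s] => //; move: h h'; rewrite !ract//= !isomP.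
by split; [exists t|exists s] => //; rewrite ract//= isomP.
Qed.

Lemma near_rayP (Y : metricType R) (N : cnspace Y) (p : Y) (u : nat -> Y) eta :
  near_ray u eta <-> exists C : R, forall n,
    exists2 t, 0 <= t & d (u n) (rayto N p eta t) <= C.
Proof.
split=> [[c ceta [C h]]|[C h]].
  exists (C + d p (c 0)) => n; have [t t0 ht] := h n; exists t => //.
  have := metric_triangle (u n) (c t) (rayto N p eta t).
  have := rayto_close N p ceta t0.
  by rewrite (metric_sym (c t)); clear ceta; lra.
by exists (rayto N p eta); [exact: bclass_rayto|exists C].
Qed.

Section Radial.
Variable Gamma : set G.
Local Notation orb g := (prod_isom g o).

(* The last two clauses are vacuous in a factor where the ray to xi is constant;
   this covers the three cases in the definition of radial limit points. *)
Definition radial_approx (c : R) (k : nat) : set bX :=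
  [set xi | exists2 g, Gamma g & [/\ k.+1%:R < d o (orb g),
     d (rayto M o xi k.+1%:R) (stopped M o (orb g) k.+1%:R) < k.+1%:R^-1,
     0 < speed1 o xi -> hit1 o (orb g) c xi &
     0 < speed2 o xi -> hit2 o (orb g) c xi]].

(** The implications are resolved by the signs of the two speeds; in each of the four cases a union
    of open sets remains, whatever the size of [Gamma]. *)
Lemma measurable_radial_approx c k : measurable (radial_approx c k).
Proof.
pose A1 := [set xi : bX | 0 < speed1 o xi].
pose A2 := [set xi : bX | 0 < speed2 o xi].
have m1 : measurable A1.
  apply: open_measurable_boundary.
  exact: (@open_lip_gt (fun x => d o.1 x.1) o 1 _ (mdist1_lip o.1) ler01).
have m2 : measurable A2.
  apply: open_measurable_boundary.
  exact: (@open_lip_gt (fun x => d o.2 x.2) o 1 _ (mdist2_lip o.2) ler01).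
pose B g : set bX := [set xi | k.+1%:R < d o (orb g) /\
  d (rayto M o xi k.+1%:R) (stopped M o (orb g) k.+1%:R) < k.+1%:R^-1].
have oB g : open (B g).
  have [h|h] := boolP (k.+1%:R < d o (orb g)).
    rewrite (_ : B g = [set xi : bX |
      d (stopped M o (orb g) k.+1%:R) (rayto M o xi k.+1%:R) < k.+1%:R^-1]).
      apply: (@open_lip_lt (fun x => d (stopped M o (orb g) k.+1%:R) x)) => //.
      by move=> x y; exact: mdist_lip.
    apply/seteqP; split=> xi /=; first by case=> _; rewrite metric_sym.
    by rewrite metric_sym.
  rewrite (_ : B g = set0); first exact: open0.
  by apply/seteqP; split=> xi //= [h']; rewrite h' in h.
have mU (H : G -> set bX) : (forall g, open (H g)) ->
    measurable (\bigcup_(g in Gamma) (B g `&` H g)).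
  by move=> oH; apply: open_measurable_boundary; apply: bigcup_open => g _; exact: openI.
rewrite (_ : radial_approx c k =
  ((A1 `&` A2) `&` (\bigcup_(g in Gamma)
     (B g `&` (hit1 o (orb g) c `&` hit2 o (orb g) c)))) `|`
  ((A1 `&` ~` A2) `&` (\bigcup_(g in Gamma) (B g `&` hit1 o (orb g) c))) `|`
  ((~` A1 `&` A2) `&` (\bigcup_(g in Gamma) (B g `&` hit2 o (orb g) c))) `|`
  ((~` A1 `&` ~` A2) `&` (\bigcup_(g in Gamma) (B g `&` setT)))).
  apply: measurableU; [apply: measurableU; [apply: measurableU|]|].
  - apply: measurableI; first exact: measurableI.
    by apply: mU => g; apply: openI; [exact: open_hit1|exact: open_hit2].
  - apply: measurableI; first by apply: measurableI => //; exact: measurableC.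
    by apply: mU => g; exact: open_hit1.
  - apply: measurableI; first by apply: measurableI => //; exact: measurableC.
    by apply: mU => g; exact: open_hit2.
  - apply: measurableI; first by apply: measurableI; exact: measurableC.
    by apply: mU => g; exact: openT.
apply/seteqP; split=> xi.
  move=> [g Gg [h1 h2 h3 h4]].
  have [a1|a1] := pselect (A1 xi); have [a2|a2] := pselect (A2 xi).
  - by do 3 left; split=> //; exists g => //; split=> //; split; [exact: h3|exact: h4].
  - by left; left; right; split=> //; exists g => //; split=> //; exact: h3.
  - by left; right; split=> //; exists g => //; split=> //; exact: h4.
  - by right; split=> //; exists g.
move=> [[[|]|]|] [[a1 a2] [g Gg [[h1 h2] h3]]]; exists g => //; split=> //.
- by case: h3.
- by case: h3.
Qed.

(** One element of [Gamma] for each scale [k] replaces the sequence, and the distance bound may be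
    an integer; this exhibits the set by countable operations. *)
Lemma radial_limit_setE : radial_limit_set o Gamma =
  \bigcup_(c in [set: nat]) \bigcap_(k in [set: nat]) radial_approx c%:R k.
Proof.
apply/seteqP; split=> xi.
  move=> [gam [Gg /(cvg_boundary M)[far close] hr]].
  suff [C hC] : exists C : R, forall n,
      (0 < speed1 o xi -> hit1 o (orb (gam n)) C xi) /\
      (0 < speed2 o xi -> hit2 o (orb (gam n)) C xi).
    exists (Num.truncn `|C|).+1 => // k _.
    have k0 : 0 < k.+1%:R :> R by rewrite ltr0n.
    have ik0 : 0 < k.+1%:R^-1 :> R by rewrite invr_gt0.
    have [n h1 h2] := filterI_ex (far k.+1%:R) (close _ _ k0 ik0).
    have CC : C <= (Num.truncn `|C|).+1%:R.
      have := truncn_itv (normr_ge0 C) => /andP[_ /ltW]; apply: le_trans.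
      exact: ler_norm.
    exists (gam n) => //; have [g1 g2] := hC n; split=> //.
      by move=> /g1[t t0 h]; exists t => //; exact: lt_le_trans CC.
    by move=> /g2[t t0 h]; exists t => //; exact: lt_le_trans CC.
  case: hr => [[eta1 [eta2 [theta [th bp n1 n2]]]]|[eta1 bp n1]|[eta2 bp n2]].
  - have [c0 s0 _] := quadrant_trig th.
    have /(near_rayP M1 o.1)[C1 h1] := n1; have /(near_rayP M2 o.2)[C2 h2] := n2.
    have C10 : 0 <= C1 by have [t _ h] := h1 0%N; exact: le_trans (mdist_ge0 _ _) h.
    have C20 : 0 <= C2 by have [t _ h] := h2 0%N; exact: le_trans (mdist_ge0 _ _) h.
    exists (C1 + C2 + 1) => n; split=> _.
      have [t t0 ht] := h1 n; have tc := divr_ge0 t0 (ltW c0).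
      exists (t / cos theta) => //.
      by rewrite (bpoint_rayto M1 M2 o th bp tc)/= divfK ?gt_eqF//; lra.
    have [t t0 ht] := h2 n; have tc := divr_ge0 t0 (ltW s0).
    exists (t / sin theta) => //.
    by rewrite (bpoint_rayto M1 M2 o th bp tc)/= divfK ?gt_eqF//; lra.
  - have /(near_rayP M1 o.1)[C1 h1] := n1.
    exists (C1 + 1) => n; split=> [_|].
      have [t t0 ht] := h1 n; exists t => //.
      by rewrite (bpoint1_rayto M1 M2 o bp t0)/=; clear bp; lra.
    by rewrite speed2E (bpoint1_rayto M1 M2 o bp ler01)/= mdistxx ltxx.
  - have /(near_rayP M2 o.2)[C2 h2] := n2.
    exists (C2 + 1) => n; split=> [|_].
      by rewrite speed1E (bpoint2_rayto M1 M2 o bp ler01)/= mdistxx ltxx.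
    have [t t0 ht] := h2 n; exists t => //.
    by rewrite (bpoint2_rayto M1 M2 o bp t0)/=; clear bp; lra.
move=> [c _ hc].
have H k : exists g, Gamma g /\ [/\ k.+1%:R < d o (orb g),
     d (rayto M o xi k.+1%:R) (stopped M o (orb g) k.+1%:R) < k.+1%:R^-1,
     0 < speed1 o xi -> hit1 o (orb g) c%:R xi &
     0 < speed2 o xi -> hit2 o (orb g) c%:R xi].
  by have [g Gg h] := hc k I; exists g.
have [gam gP] := choice H; exists gam; split.
- by move=> n; have [] := gP n.
- apply/(cvg_boundary M); split=> [A|r e r0 e0].
    apply: filterS (nbhs_infty_gtr A) => n /= An.
    have [_ [h _ _ _]] := gP n; apply: lt_trans h; apply: (lt_trans An).
    by rewrite ltr_nat.
  have i1 : \oo [set n : nat | r < n%:R] := nbhs_infty_gtr r.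
  have i2 : \oo [set n : nat | n.+1%:R^-1 < e] := near_infty_natSinv_lt (PosNum e0).
  apply: filterS (filterI i1 i2) => n [/= rn en].
  have [_ [h1 h2 _ _]] := gP n.
  have n0 : 0 < n.+1%:R :> R by rewrite ltr0n.
  have rn' : 0 <= r <= n.+1%:R.
    by rewrite ltW//= (le_trans (ltW rn))// ler_nat.
  apply: (le_lt_trans (stopped_ray_close M xi rn' n0 (ltW h1))).
  apply: le_lt_trans (lt_trans h2 en); rewrite ler_piMl ?mdist_ge0//.
  by have /andP[] := ray_frac rn' n0.
have u1 : 0 <= speed1 o xi by exact: mdist_ge0.
have u2 : 0 <= speed2 o xi by exact: mdist_ge0.
move: u1; rewrite le_eqVlt => /predU1P[/esym u1|u1].
  have u20 : 0 < speed2 o xi.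
    have := speed_sqr M1 M2 o xi; rewrite u1 expr0n add0r => h.
    rewrite lt_neqAle u2 andbT; apply/eqP => h'.
    by move: h; rewrite -h' expr0n => /esym/eqP; rewrite oner_eq0.
  have [eta2 bp] := ex_bpoint2 u1.
  apply: Or33; exists eta2 => //; apply/(near_rayP M2 o.2); exists c%:R => n.
  have [_ [_ _ _ /(_ u20)[t t0 ht]]] := gP n; exists t => //.
  by move: ht; rewrite (bpoint2_rayto M1 M2 o bp t0)/= => /ltW.
move: u2; rewrite le_eqVlt => /predU1P[/esym u2|u2].
  have [eta1 bp] := ex_bpoint1 u2.
  apply: Or32; exists eta1 => //; apply/(near_rayP M1 o.1); exists c%:R => n.
  have [_ [_ _ /(_ u1)[t t0 ht] _]] := gP n; exists t => //.
  by move: ht; rewrite (bpoint1_rayto M1 M2 o bp t0)/= => /ltW.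
have [theta [th e1 e2]] := speed_theta u1 u2.
have [eta1 [eta2 bp]] := ex_bpoint u1 u2 e1 e2.
have [c0 s0 _] := quadrant_trig th.
apply: Or31; exists eta1, eta2, theta; split=> //.
  apply/(near_rayP M1 o.1); exists c%:R => n.
  have [_ [_ _ /(_ u1)[t t0 ht] _]] := gP n.
  exists (t * cos theta); first by rewrite mulr_ge0// ltW.
  by move: ht; rewrite (bpoint_rayto M1 M2 o th bp t0)/= => /ltW.
apply/(near_rayP M2 o.2); exists c%:R => n.
have [_ [_ _ _ /(_ u2)[t t0 ht]]] := gP n.
exists (t * sin theta); first by rewrite mulr_ge0// ltW.
by move: ht; rewrite (bpoint_rayto M1 M2 o th bp t0)/= => /ltW.
Qed.

Lemma measurable_radial_limit_set :
  measurable (radial_limit_set o Gamma : set bX).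
Proof.
rewrite radial_limit_setE; apply: bigcupT_measurable => c.
by apply: bigcapT_measurable => k; exact: measurable_radial_approx.
Qed.

End Radial.

Lemma slope_polar (x : X) :
  [/\ 0 <= slope_angle o x <= pi / 2,
     d o.1 x.1 = d o x * cos (slope_angle o x) &
     d o.2 x.2 = d o x * sin (slope_angle o x)].
Proof.
have p0 := pi_gt0 R; rewrite /slope_angle; case: ifPn => [/eqP h|h].
  rewrite cos_pihalf sin_pihalf mulr0 mulr1 h; split=> //; first lra.
  by rewrite mdist_l2prod h expr0n add0r sqrtr_sqr ger0_norm// mdist_ge0.
set a := d o.1 x.1 in h *; set b := d o.2 x.2.
have a0 : 0 < a by rewrite lt_neqAle eq_sym h mdist_ge0.
have b0 : 0 <= b by exact: mdist_ge0.
have ba0 : 0 <= b / a by rewrite divr_ge0// ltW.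
have dE : d o x = a * Num.sqrt (1 + (b / a) ^+ 2).
  rewrite mdist_l2prod -/a -/b.
  have -> : a ^+ 2 + b ^+ 2 = a ^+ 2 * (1 + (b / a) ^+ 2).
    by field; rewrite gt_eqF.
  by rewrite sqrtrM ?sqr_ge0// sqrtr_sqr (ger0_norm (ltW a0)).
have s0 : 0 < Num.sqrt (1 + (b / a) ^+ 2).
  by rewrite sqrtr_gt0 ltr_pwDl// sqr_ge0.
have ca : d o x * cos (atan (b / a)) = a.
  by rewrite cos_atan dE mulfK// gt_eqF.
split=> //.
- have [/andP[t1 t2] tE] := atan_def (b / a); rewrite (ltW t2) andbT.
  rewrite leNgt; apply/negP => t0.
  have : sin (- atan (b / a)) > 0 by apply: sin_gt0_pi; lra.
  rewrite sinN => sneg.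
  have c0 : 0 < cos (atan (b / a)) by rewrite cos_atan invr_gt0.
  have : tan (atan (b / a)) < 0.
    by rewrite /tan pmulr_llt0 ?invr_gt0//; lra.
  by rewrite tE; lra.
have [_ tE] := atan_def (b / a).
have c0 : 0 < cos (atan (b / a)) by rewrite cos_atan invr_gt0.
have -> : sin (atan (b / a)) = b / a * cos (atan (b / a)).
  by move: tE => /(congr1 ( *%R^~ (cos (atan (b / a))))) <-; rewrite /tan divfK// gt_eqF.
by rewrite mulrCA ca divfK// gt_eqF.
Qed.

(** By time [r] the first components have travelled [r * speed1 o xi] and [r] times the cosine;
    hence orbit points converging to [xi] have slopes converging to that of [xi]. *)
Lemma speed_stopped (x : X) xi (r : R) : 0 < r -> r <= d o x ->
  r * `|speed1 o xi - cos (slope_angle o x)| <=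
  d (rayto M o xi r) (stopped M o x r).
Proof.
move=> r0 rx; have x0 : 0 < d o x := lt_le_trans r0 rx.
have rx' : 0 <= r <= d o x by rewrite ltW.
have [_ e1 _] := slope_polar x.
have [h _] := rayto_components M1 M2 o xi (lexx 0) (ltW r0).
rewrite rayto0 sub0r normrN (ger0_norm (ltW r0)) in h.
have h2 : d o.1 (stopped M o x r).1 = r * cos (slope_angle o x).
  rewrite stopped_lt//= geo_distl ?ray_frac// e1.
  by rewrite mulrA divfK ?gt_eqF.
have := mdist1_lip o.1 (rayto M o xi r) (stopped M o x r).
rewrite h h2 (mulrC _ r) -mulrBr normrM (ger0_norm (ltW r0)).
by apply: le_trans.
Qed.

Lemma cos_close (theta e : R) : 0 < theta < pi / 2 -> 0 < e ->
  exists2 dl, 0 < dl & forall phi, 0 <= phi <= pi / 2 ->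
    `|cos theta - cos phi| < dl -> `|phi - theta| < e.
Proof.
move=> /andP[t0 tp] e0; have p0 := pi_gt0 R.
pose e' := Num.min e (Num.min theta (pi / 2)).
have [e'0 e'e e't e'p] : [/\ 0 < e', e' <= e, e' <= theta & e' <= pi / 2].
  rewrite /e' !lt_min !ge_min !lexx e0 t0 ?orbT/=; split=> //.
  by lra.
have c1 : cos theta < cos (theta - e') by rewrite ltr_cos ?in_itv/=; lra.
have c2 : cos (theta + e') < cos theta by rewrite ltr_cos ?in_itv/=; lra.
exists (Num.min (cos (theta - e') - cos theta) (cos theta - cos (theta + e'))).
  by rewrite lt_min !subr_gt0 c1.
move=> phi phi0; rewrite lt_min => /andP[h1 h2].
apply: (@lt_le_trans _ _ e') => //.
rewrite ltNge; apply/negP; rewrite ler_normr => /orP[k|k].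
  have : cos phi <= cos (theta + e').
    by rewrite leNgt ltr_cos ?in_itv/= -?leNgt; lra.
  by move: h2; rewrite ltr_norml; lra.
have : cos (theta - e') <= cos phi.
  by rewrite leNgt ltr_cos ?in_itv/= -?leNgt; lra.
by move: h1; rewrite ltr_norml; lra.
Qed.

End Shadows.

(** * Discreteness *)

Section IsometryTopology.
Context (R : realType) (X : metricType R).
Local Notation d := mdist.

Lemma ultra_compact (K : set X) (U : set_system nat) (x : nat -> X) :
  UltraFilter U -> compact K -> U [set n | K (x n)] ->
  exists2 y, K y & forall e, 0 < e -> U [set n | d y (x n) < e].
Proof.
move=> UU; rewrite compact_ultra => cK UK.
have [|y [Ky yU]] := cK (x @ U) (fmap_ultra x UU); first exact: UK.
by exists y => //; apply/cvg_mdistP.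
Qed.

Lemma compact_open_margin (K O : set X) (g : isometryType X) : compact K ->
  open O -> g @` K `<=` O ->
  exists2 e, 0 < e & forall x z, K x -> d (g x) z < e -> O z.
Proof.
move=> cK oO gKO; apply: contrapT => h.
have H (n : nat) : exists xz : X * X,
    [/\ K xz.1, d (g xz.1) xz.2 < n.+1%:R^-1 & ~ O xz.2].
  apply: contrapT => hn; apply: h; exists n.+1%:R^-1; first by rewrite invr_gt0.
  move=> x z Kx xz; apply: contrapT => nO; apply: hn; by exists (x, z).
have [f fP] := choice H.
have [U [UU ooU]] := ultra_oo.
have [|y Ky yU] := @ultra_compact K U (fun n => (f n).1) UU cK.
  by apply: filterS filterT => n _ /=; have [] := fP n.
have : nbhs (g y) O by apply: open_nbhs_nbhs; split=> //; apply: gKO; exists y.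
move=> /nbhs_mdist[e e0 eO]; have e20 : 0 < e / 2 by lra.
have i1 : U [set n : nat | n.+1%:R^-1 < e / 2].
  exact: ooU (near_infty_natSinv_lt (PosNum e20)).
have [n h1 h2] := filterI_ex (yU _ e20) i1.
have [_ h3 nO] := fP n; apply: nO; apply: eO.
apply: (le_lt_trans (metric_triangle _ (g (f n).1) _)).
by rewrite isomP [e]splitr ltrD// (lt_trans h3).
Qed.

Lemma cvg_isometry (H : set_system (isometryType X)) {FH : Filter H}
    (g : isometryType X) :
  (forall (K : set X) e, compact K -> 0 < e ->
    H [set h : isometryType X | forall x, K x -> d (g x) (h x) < e]) ->
  H --> g.
Proof.
move=> hH A; rewrite nbhsE => -[B [[C oC CB] Bg] BA].
apply: (filterS BA).
have : ((fun f : isometryType X => (f : {compact-open, X -> X})) @ H) C.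
  have cv : ((fun f : isometryType X => (f : {compact-open, X -> X})) @ H)
     --> (g : {compact-open, X -> X}).
    apply/compact_open_cvgP => K O cK oO gKO.
    have [e e0 he] := compact_open_margin cK oO gKO.
    apply: (fmapS _ (hH K e cK e0)) => h /= hK _ [x Kx <-].
    exact: he (hK x Kx).
  apply: cv; apply: open_nbhs_nbhs; split=> //.
  by rewrite -CB in Bg.
by rewrite -CB.
Qed.

Lemma nbhs_isometry (g : isometryType X) (A : set (isometryType X)) :
  nbhs g A -> exists K e, [/\ compact K, 0 < e &
    forall h : isometryType X, (forall x, K x -> d (g x) (h x) < e) -> A h].
Proof.
pose B (i : set X * R) : set (isometryType X) :=
  [set h | forall x, i.1 x -> d (g x) (h x) < i.2].
pose D : set (set X * R) := [set i | compact i.1 /\ 0 < i.2].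
have FH : Filter (filter_from D B).
  apply: filter_from_filter; first by exists (set0, 1); split=> //; exact: compact0.
  move=> [K e] [K' e'] [/= cK e0] [/= cK' e'0]; exists (K `|` K', Num.min e e').
    by split; [exact: compactU|rewrite lt_min e0].
  move=> h hh; split=> x Kx.
    by have := hh x (or_introl Kx); rewrite lt_min => /andP[].
  by have := hh x (or_intror Kx); rewrite lt_min => /andP[].
have : filter_from D B --> g.
  by apply: cvg_isometry => K e cK e0; exists (K, e).
by move=> /[apply] -[[K e] [/= cK e0] h]; exists K, e; split.
Qed.

Lemma isom_mulE (g h : isometryType X) x : (g * h)%g x = g (h x).
Proof. by []. Qed.

Lemma isom_oneE x : (1%g : isometryType X) x = x.
Proof. by []. Qed.

Lemma isom_invK (g : isometryType X) x : g (g^-1%g x) = x.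
Proof. exact: isom_inv_funK. Qed.

(* Pointwise limits of isometries along an ultrafilter are locally uniform. *)
Lemma ultra_isometries (M : cnspace X) (U : set_system nat)
    (f : nat -> isometryType X) (p : X) (C : R) :
  UltraFilter U -> (forall n, d p (f n p) <= C) ->
  forall (K : set X) e, compact K -> 0 < e ->
  exists2 S, U S & forall n m, S n -> S m -> forall x, K x ->
    d (f n x) (f m x) < e.
Proof.
move=> UU fC K e cK e0.
have lim x : exists z : X, f n x @[n --> U] --> z.
  apply: (@cn_proper _ _ M nat U (fun n => f n x) p (C + d p x) UU).
  apply: filterS filterT => n _ /=.
  by have := metric_triangle p (f n p) (f n x); have := fC n; rewrite isomP; lra.
pose L x := sval (cid (lim x)).
have LP x : forall e, 0 < e -> U [set n | d (L x) (f n x) < e].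
  by apply/cvg_mdistP; exact: svalP (cid (lim x)).
have Llip x y : d (L x) (L y) <= d x y.
  apply/ler_addgt0Pr => e' e'0; have e2 : 0 < e' / 2 by lra.
  have [n h1 h2] := filterI_ex (LP x _ e2) (LP y _ e2).
  have := metric_triangle (L x) (f n x) (L y).
  have := metric_triangle (f n x) (f n y) (L y).
  by move: h1 h2; rewrite /= isomP (metric_sym (f n y) (L y)); lra.
pose S := [set n | forall x, K x -> d (L x) (f n x) < e / 2].
exists S; last first.
  move=> n m Sn Sm x Kx; have := metric_triangle (f n x) (L x) (f m x).
  by have := Sn x Kx; have := Sm x Kx; rewrite (metric_sym (f n x) (L x)); lra.
have [//|US] := in_ultra_setVsetC S UU.
have bad n : exists x, (~` S) n -> K x /\ e / 2 <= d (L x) (f n x).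
  have [Sn|Sn] := pselect (S n); first by exists p.
  apply: contrapT => h; apply: Sn => x Kx; rewrite ltNge; apply/negP => hx.
  by apply: h; exists x.
have [x xP] := choice bad.
have [|y Ky yU] := @ultra_compact K U x UU cK.
  by apply: filterS US => n /xP[].
have e6 : 0 < e / 6 by lra.
have [n [h1 h2 /xP[Kx h3]]] := filterI3_ex (yU _ e6) (LP y _ e6) US.
have := metric_triangle (L (x n)) (L y) (f n (x n)).
have := metric_triangle (L y) (f n y) (f n (x n)).
have := Llip (x n) y; rewrite isomP (metric_sym (x n) y).
by move: h1 h2 => /=; lra.
Qed.

End IsometryTopology.

(** * Finiteness of orbits in balls *)

Section FiniteOrbit.
Context (R : realType) (X1 X2 : metricType R).
Context (M1 : cnspace X1) (M2 : cnspace X2).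
Local Notation d := mdist.
Local Notation X := (l2prod X1 X2).
Local Notation G := (isometryType X1 * isometryType X2)%type.

Lemma infinite_sequence (T : choiceType) (A : set T) : infinite_set A ->
  exists f : nat -> T, (forall n, A (f n)) /\ injective f.
Proof.
move=> infA.
have next (s : seq T) : exists x, A x /\ x \notin s.
  apply: contrapT => h; apply: infA; apply: (@sub_finite_set _ _ [set` s]) => //.
  by move=> x Ax /=; apply: contrapT => /negP xs; apply: h; exists x.
have [nx nxP] := choice next.
pose F := fix F n := if n is n'.+1 then nx (F n') :: F n' else [::].
pose f n := nx (F n).
have Flt n m : (n < m)%N -> f n \in F m.
  elim: m => // m IH; rewrite ltnS leq_eqVlt => /predU1P[->|/IH h].
    by rewrite /= inE eqxx.
  by rewrite /= inE h orbT.
have fA n : A (f n) /\ f n \notin F n := nxP (F n).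
clearbody f F; exists f; split=> [n|n m e]; first by have [] := fA n.
have [/Flt|/Flt|//] := ltngtP n m.
  by rewrite e => h; have [_] := fA m; rewrite h.
by rewrite -e => h; have [_] := fA n; rewrite h.
Qed.

Lemma finite_orbit (Gamma : groupClosed G) (o : X) (C : R) :
  discrete_subset [set` Gamma] ->
  finite_set [set g : G | g \in Gamma /\ d o (prod_isom g o) <= C].
Proof.
move=> disc; set A := [set g : G | _]; apply: contrapT => infA.
have [f [fA finj]] := infinite_sequence infA.
have [U [UU ooU]] := ultra_oo.
have [_ [V V1 VG]] := disc 1%g (gpred1 (s := Gamma)).
case: V1 => -[B1 B2] [/= /nbhs_isometry[K1 [e1 [cK1 e10 h1]]]].
move=> /nbhs_isometry[K2 [e2 [cK2 e20 h2]]] BV.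
have b1 n : d o.1 ((f n).1 o.1) <= C.
  by apply: le_trans (fA n).2; exact: (mdist_l2prod1 o (prod_isom (f n) o)).
have b2 n : d o.2 ((f n).2 o.2) <= C.
  by apply: le_trans (fA n).2; exact: (mdist_l2prod2 o (prod_isom (f n) o)).
have [S1 US1 hS1] := ultra_isometries M1 UU b1 cK1 e10.
have [S2 US2 hS2] := ultra_isometries M2 UU b2 cK2 e20.
have [n n1 n2] := filterI_ex US1 US2.
have gtn : U [set m | (n < m)%N] by apply: ooU; exact: nbhs_infty_gt.
have [m [m1 m2 /= nm]] := filterI3_ex US1 US2 gtn.
have : (V `&` [set` Gamma]) ((f n)^-1 * f m)%g.
  split; last first.
    by rewrite /= gpredM// ?gpredV; [exact: (fA n).1|exact: (fA m).1].
  apply: BV; split=> /=.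
    apply: h1 => x Kx; rewrite isom_oneE -(isomP (f n).1) isom_mulE isom_invK.
    exact: hS1.
  apply: h2 => x Kx; rewrite isom_oneE -(isomP (f n).2) isom_mulE isom_invK.
  exact: hS2.
rewrite VG /= => /(congr1 (fun g => (f n * g)%g)); rewrite mulgA mulgV mul1g mulg1 => e.
by move: nm; rewrite (finj _ _ e) ltnn.
Qed.

End FiniteOrbit.

(** * Dynamics on the product *)

Section FactorPass.
Context (R : realType) (X : metricType R) (M : cnspace X).
Local Notation d := mdist.

(** Persistence at [m = 2 * C] keeps the projection above [C] after time [t0], so contraction at
    [c 0] applies to the geodesics from [f q] to all later points of the ray; [asymptotic_pass]
    transfers this to the ray from [q]. *)
Lemma ping_pong_pass g h P Q c a b C T (f : isometryType X) eta p q t0 :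
  ping_pong g h P Q c a b C T -> 0 <= t0 -> d (f p) (c (2 * C)) + C < t0 ->
  3 * C < P (f (rayto M p eta t0)) -> P (f q) < - C ->
  exists2 t, 0 <= t & d (f (rayto M q eta t)) (c 0) < C + 1.
Proof.
move=> pp t00 pt0 Pp Pq; have C0 := pp_C pp.
pose r := ray_comp f (rayto M p eta); pose r' := ray_comp f (rayto M q eta).
apply: (@asymptotic_pass _ _ M r r' _ C t0 _ (ltW C0)).
  by apply/bclassP; exists (d q p) => t tge0 /=; rewrite isomP; exact: rayto_base.
move=> t t0t; apply: (pp_contract pp); first by rewrite /= rayto0; lra.
have : 2 * C - C < P (r t).
  by apply: (persistence pp t00 _ _ t0t); rewrite /= ?rayto0//; lra.
by rewrite /=; lra.
Qed.

End FactorPass.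

Lemma seq_bounded (R : realType) (T : eqType) (s : seq T) (f : T -> R) :
  exists B, forall x, x \in s -> f x <= B.
Proof.
elim: s => [|y s [B hB]]; first by exists 0.
exists (Num.max (f y) B) => x; rewrite inE le_max => /predU1P[->|/hB ->].
  by rewrite lexx.
by rewrite orbT.
Qed.

Section Dynamics.
Context (R : realType) (X1 X2 : metricType R).
Context (M1 : cnspace X1) (M2 : cnspace X2).
Local Notation d := mdist.
Local Notation X := (l2prod X1 X2).
Local Notation M := (prod_cnspace M1 M2).
Local Notation G := (isometryType X1 * isometryType X2)%type.
Context (Gamma : groupClosed G).

Section Shifts.
Variables (F1 : X1 -> R) (F2 : X2 -> R).

Definition shifts (k : G) (f1 f2 : R) :=
  (forall x, F1 (k.1 x) = F1 x + f1) /\ (forall x, F2 (k.2 x) = F2 x + f2).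

Lemma shiftsV k f1 f2 : shifts k f1 f2 -> shifts k^-1%g (- f1) (- f2).
Proof.
by move=> [h1 h2]; split=> x; [have := h1 (k^-1%g.1 x)|have := h2 (k^-1%g.2 x)];
  rewrite isom_invK => ->; rewrite addrK.
Qed.

Lemma shiftsX k f1 f2 n : shifts k f1 f2 -> shifts (k ^+ n)%g (n%:R * f1) (n%:R * f2).
Proof.
move=> [h1 h2]; elim: n => [|n [IH1 IH2]].
  by split=> x; rewrite mul0r addr0.
by rewrite expgS; split=> x; rewrite [in LHS]/= ?h1 ?h2 ?IH1 ?IH2 -natr1; ring.
Qed.

Lemma ex_large_shift k f1 f2 A : k \in Gamma -> shifts k f1 f2 -> 0 < f1 -> 0 < f2 ->
  exists k' f1' f2', [/\ k' \in Gamma, shifts k' f1' f2', A < f1' & A < f2'].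
Proof.
move=> kG kf f10 f20.
pose n := (Num.truncn (`|A| / f1 + `|A| / f2)).+1.
have n0 : `|A| / f1 + `|A| / f2 < n%:R.
  by have /andP[] := truncn_itv (addr_ge0 (divr_ge0 (normr_ge0 A) (ltW f10))
    (divr_ge0 (normr_ge0 A) (ltW f20))).
have a1 := divr_ge0 (normr_ge0 A) (ltW f10).
have a2 := divr_ge0 (normr_ge0 A) (ltW f20).
exists (k ^+ n)%g, (n%:R * f1), (n%:R * f2); split.
- exact: gpredXn.
- exact: shiftsX.
- rewrite (le_lt_trans (ler_norm A))// -ltr_pdivrMr//.
  by apply: le_lt_trans n0; rewrite lerDl.
- rewrite (le_lt_trans (ler_norm A))// -ltr_pdivrMr//.
  by apply: le_lt_trans n0; rewrite lerDr.
Qed.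

End Shifts.

Context (g h : G) (P1 Q1 : X1 -> R) (P2 Q2 : X2 -> R).
Context (c1 : R -> X1) (c2 : R -> X2) (a1 d1 C1 a2 d2 C2 T : R).
Hypotheses (gG : g \in Gamma) (hG : h \in Gamma).
Hypothesis pp1 : ping_pong g.1 h.1 P1 Q1 c1 a1 d1 C1 T.
Hypothesis pp2 : ping_pong g.2 h.2 P2 Q2 c2 a2 d2 C2 T.

(* Since f1 and f2 exceed 2 T, the Q-value of at most one of y, k y, k^-1 y falls
   in [- T, T], in either factor; so one of the three is good for both. *)
Lemma centring : exists L : seq G, {subset L <= Gamma} /\ forall y : X,
  exists2 k, k \in L & `|P1 (k.1 y.1)| <= T /\ `|P2 (k.2 y.2)| <= T.
Proof.
have [k [f1 [f2 [kG kf f1T f2T]]]] := ex_large_shift (2 * T) gG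
  (conj (pp_g pp1) (pp_g pp2)) (pp_b pp1) (pp_b pp2).
have kf' := shiftsV kf.
exists [:: 1%g; k; k^-1%g]; split.
  by move=> x; rewrite !inE => /or3P[]/eqP->; rewrite ?gpred1 ?gpredV.
move=> y; have T0 := pp_T pp1.
suff [k' k'L [h1 h2]] : exists2 k', k' \in [:: 1%g; k; k^-1%g] &
    T < `|Q1 (k'.1 y.1)| /\ T < `|Q2 (k'.2 y.2)|.
  exists k' => //; split; rewrite leNgt; apply/negP.
    by move=> /(pp_sep pp1); rewrite leNgt h1.
  by move=> /(pp_sep pp2); rewrite leNgt h2.
have sep (q f : R) : 2 * T < f -> [\/ T < `|q| /\ T < `|q + f|,
    T < `|q| /\ T < `|q - f| | T < `|q + f| /\ T < `|q - f|].
  move=> fT; rewrite !ltr_normr.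
  have [q1|q1] := ltP q (- T); first by apply: Or32; split; apply/orP; right; lra.
  have [q2|q2] := ltP T q; first by apply: Or31; split; apply/orP; left; lra.
  by apply: Or33; split; apply/orP; [left|right]; lra.
have e1 x : Q1 ((1%g : G).1 x) = Q1 x by [].
have e2 x : Q2 ((1%g : G).2 x) = Q2 x by [].
have [k1 k2] := kf; have [k1' k2'] := kf'.
have [[u1 u2]|[u1 u2]|[u1 u2]] := sep (Q1 y.1) f1 f1T;
have [[v1 v2]|[v1 v2]|[v1 v2]] := sep (Q2 y.2) f2 f2T;
  first [by exists 1%g; rewrite ?inE ?eqxx//
  | by exists k; rewrite ?inE ?eqxx ?orbT// k1 k2
  | by exists k^-1%g; rewrite ?inE ?eqxx ?orbT// k1' k2'].
Qed.

(** From a centred position, one power of [h], or its inverse, moves both projections past the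
    bound. *)
Lemma pushing A : exists L : seq G, {subset L <= Gamma} /\ forall y : X,
  (exists2 k, k \in L & A < P1 (k.1 y.1) /\ A < P2 (k.2 y.2)) /\
  (exists2 k, k \in L & P1 (k.1 y.1) < - A /\ P2 (k.2 y.2) < - A).
Proof.
have [L [LG hL]] := centring.
have [k [f1 [f2 [kG kf f1T f2T]]]] := ex_large_shift (A + T) hG
  (conj (pp_h pp1) (pp_h pp2)) (pp_a pp1) (pp_a pp2).
have [k1' k2'] := shiftsV kf; have [k1 k2] := kf.
exists ([seq k * l | l <- L] ++ [seq k^-1 * l | l <- L])%g; split.
  by move=> x; rewrite mem_cat => /orP[]/mapP[l /LG lG ->]; rewrite gpredM ?gpredV.
move=> y; have [l lL [l1 l2]] := hL y.
rewrite !ler_norml in l1 l2; split.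
  exists (k * l)%g; first by rewrite mem_cat map_f.
  by rewrite /= k1 k2; split; lra.
exists (k^-1 * l)%g; first by rewrite mem_cat map_f ?orbT.
by move: (k1' (l.1 y.1)) (k2' (l.2 y.2)) => /= -> ->; split; lra.
Qed.

Context (o : X) (xi0 : boundary X) (theta : R).
Hypothesis theta_in : 0 < theta < pi / 2.
Local Notation bX := (tboundary o xi0).

(* The element k of the conclusion is f^-1 l, where f moves a far point of the ray
   to xi to the attracting side of both axes and l moves y to the repelling one:
   the geodesics from l y to f W pass near the origins of the axes, hence near
   l o. *)
Lemma shadow_cover (xi : bX) : exists (W : set bX) (L : seq G) (c : R),
  [/\ open W, W xi, {subset L <= Gamma}, 0 < c & forall y : X,
   exists2 k, k \in L & W `&` boundary_slope theta `<=`
      shadow M1 M2 theta (prod_isom k y) (prod_isom k o) c].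
Proof.
have C10 := pp_C pp1; have C20 := pp_C pp2.
have [co si _] := quadrant_trig theta_in.
have [L [LG hL]] := pushing (3 * (C1 + C2)).
have [B1 hB1] := seq_bounded L (fun k => d (k.1 o.1) (c1 (2 * C1))).
have [B2 hB2] := seq_bounded L (fun k => d (k.2 o.2) (c2 (2 * C2))).
have [D1 hD1] := seq_bounded L (fun k => d (k.1 o.1) (c1 0)).
have [D2 hD2] := seq_bounded L (fun k => d (k.2 o.2) (c2 0)).
(* [f] is chosen from the point at time [t0], so [t0] must be fixed before [f] and serve all
   elements of [L]. *)
pose t0 := (`|B1| + C1 + 1) / cos theta + (`|B2| + C2 + 1) / sin theta.
have u1 : 0 < (`|B1| + C1 + 1) / cos theta.
  by rewrite divr_gt0//; have := normr_ge0 B1; lra.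
have u2 : 0 < (`|B2| + C2 + 1) / sin theta.
  by rewrite divr_gt0//; have := normr_ge0 B2; lra.
have t00 : 0 <= t0 by rewrite /t0; lra.
have t01 : B1 + C1 < t0 * cos theta.
  apply: (@lt_le_trans _ _ (`|B1| + C1 + 1)); first by have := ler_norm B1; lra.
  by rewrite -ler_pdivrMr//; rewrite /t0; lra.
have t02 : B2 + C2 < t0 * sin theta.
  apply: (@lt_le_trans _ _ (`|B2| + C2 + 1)); first by have := ler_norm B2; lra.
  by rewrite -ler_pdivrMr//; rewrite /t0; lra.
have [[f fL [f1 f2]] _] := hL (rayto M o xi t0).
pose W1 := [set z : bX | 3 * C1 < P1 (f.1 (rayto M o z t0).1)].
pose W2 := [set z : bX | 3 * C2 < P2 (f.2 (rayto M o z t0).2)].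
pose c := `|D1| + `|D2| + C1 + C2 + 1.
have n1 := normr_ge0 D1; have n2 := normr_ge0 D2.
have m1 := ler_norm D1; have m2 := ler_norm D2.
exists (W1 `&` W2), [seq (f^-1 * k)%g | k <- L], c; split.
- apply: openI.
    apply: (@open_lip_gt _ _ _ M1 M2 o xi0 (fun x => P1 (f.1 x.1))) => // x y.
    by apply: (le_trans (pp_lip pp1 _ _)); rewrite isomP; exact: mdist_l2prod1.
  apply: (@open_lip_gt _ _ _ M1 M2 o xi0 (fun x => P2 (f.2 x.2))) => // x y.
  by apply: (le_trans (pp_lip pp2 _ _)); rewrite isomP; exact: mdist_l2prod2.
- by split; rewrite /W1 /W2 /=; lra.
- by move=> x /mapP[k /LG kG ->]; apply: gpredM => //; rewrite gpredV; exact: LG.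
- by rewrite /c; lra.
move=> y; have [_ [k kL [k1 k2]]] := hL y.
have [k' [k'L e1 e2]] : exists k', [/\ k' \in [seq (f^-1 * k)%g | k <- L],
    forall x, f.1 (k'.1 x) = k.1 x & forall x, f.2 (k'.2 x) = k.2 x].
  exists (f^-1 * k)%g; split; first exact: map_f.
    by move=> x; rewrite isom_mulE isom_invK.
  by move=> x; rewrite isom_mulE isom_invK.
exists k' => // z [[z1 z2] zth]; split=> //; move: (zth) => [eta1 [eta2 bp]].
rewrite /W1 /W2 /= !(bpoint_rayto M1 M2 o theta_in bp t00)/= in z1 z2.
have q1 : P1 (f.1 (k'.1 y.1)) < - C1 by rewrite e1; lra.
have q2 : P2 (f.2 (k'.2 y.2)) < - C2 by rewrite e2; lra.
have tc : 0 <= t0 * cos theta by rewrite mulr_ge0// ltW.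
have ts : 0 <= t0 * sin theta by rewrite mulr_ge0// ltW.
have b1 : d (f.1 o.1) (c1 (2 * C1)) + C1 < t0 * cos theta.
  by have := hB1 f fL; lra.
have b2 : d (f.2 o.2) (c2 (2 * C2)) + C2 < t0 * sin theta.
  by have := hB2 f fL; lra.
have [t tge0 ht] := ping_pong_pass pp1 tc b1 z1 q1.
have [s sge0 hs] := ping_pong_pass pp2 ts b2 z2 q2.
split.
  have tt := divr_ge0 tge0 (ltW co); exists (t / cos theta) => //.
  rewrite (bpoint_rayto M1 M2 _ theta_in bp tt)/= divfK ?gt_eqF//.
  rewrite -(isomP f.1) e1.
  have := metric_triangle (k.1 o.1) (c1 0) (f.1 (rayto M1 (k'.1 y.1) eta1 t)).
  rewrite (metric_sym (c1 0)); have := hD1 k kL.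
  by move: ht; rewrite /c /=; clear bp; lra.
have tt := divr_ge0 sge0 (ltW si); exists (s / sin theta) => //.
rewrite (bpoint_rayto M1 M2 _ theta_in bp tt)/= divfK ?gt_eqF//.
rewrite -(isomP f.2) e2.
have := metric_triangle (k.2 o.2) (c2 0) (f.2 (rayto M2 (k'.2 y.2) eta2 s)).
rewrite (metric_sym (c2 0)); have := hD2 k kL.
by move: hs; rewrite /c /=; clear bp; lra.
Qed.

End Dynamics.

(** * Busemann functions and the shadow lemma *)

Section Busemann.
Context (R : realType) (X : metricType R) (M : cnspace X).
Local Notation d := mdist.

(** By the triangle inequality [t - d x (c t)] is nondecreasing and bounded; the clamp at 0 makes
    this true on the whole line. *)
Lemma busemann_cvg (c : ray X) x :
  exists l : R, (d x (c t) - t) @[t --> +oo] --> l.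
Proof.
pose f (t : R) := Num.max 0 t - d x (c (Num.max 0 t)).
have ndf : nondecreasing_fun f.
  move=> s t st; rewrite /f.
  have s0 : 0 <= Num.max 0 s by rewrite le_max lexx.
  have t0 : 0 <= Num.max 0 t by rewrite le_max lexx.
  have st' : Num.max 0 s <= Num.max 0 t by rewrite ge_max t0 le_max st orbT.
  have := metric_triangle x (c (Num.max 0 s)) (c (Num.max 0 t)).
  by rewrite ray_dist// distrC ger0_norm ?subr_ge0//; lra.
have ubf : has_ubound (range f).
  exists (d x (c 0)) => _ [t _ <-]; rewrite /f.
  have t0 : 0 <= Num.max 0 t by rewrite le_max lexx.
  have := metric_triangle (c 0) x (c (Num.max 0 t)).
  by rewrite ray_dist// sub0r normrN ger0_norm// (metric_sym (c 0) x); lra.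
exists (- sup (range f)).
apply: cvg_trans (cvgN (nondecreasing_cvgr ndf ubf)).
apply: near_eq_cvg; near=> t.
have t0 : 0 <= t by near: t; apply: nbhs_pinfty_ge; rewrite num_real.
by rewrite fctE /f max_r// opprB.
Unshelve. all: by end_near. Qed.

Lemma busemann_between (eta : boundary X) (x y : X) (a b t0 : R) :
  (forall t, t0 <= t -> a <= d x (brepr eta t) - d y (brepr eta t) <= b) ->
  a <= busemann eta x y <= b.
Proof.
move=> h; have [lx hx] := busemann_cvg (brepr eta) x.
have [ly hy] := busemann_cvg (brepr eta) y.
have hxy : (d x (brepr eta t) - d y (brepr eta t)) @[t --> +oo] --> lx - ly.
  apply: cvg_trans (cvgB hx hy); apply: near_eq_cvg.
  by apply: nearW => t; rewrite !fctE; ring.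
rewrite /busemann (cvg_lim _ hxy)//.
have near0 : \forall t \near +oo, t0 <= t by apply: nbhs_pinfty_ge; rewrite num_real.
apply/andP; split.
  apply: (cvg_le_to (cvg_cst a) hxy); apply: filterS near0 => t /h /andP[+ _].
  exact.
apply: (cvg_le_to hxy (cvg_cst b)); apply: filterS near0 => t /h /andP[_].
exact.
Qed.

Lemma busemann_bound (eta : boundary X) (x y : X) : `|busemann eta x y| <= d x y.
Proof.
rewrite ler_norml; apply: (@busemann_between _ _ _ _ _ 0) => t _.
rewrite -ler_norml; have := mdist_lip (brepr eta t) x y.
by rewrite !(metric_sym (brepr eta t)).
Qed.

(** [busemann] uses the representative [brepr eta], at bounded distance from the ray from [x]. For
    large [t] the geodesic from [x] to [brepr eta t] passes within 1/2 of the ray point at time [s],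
    so a detour through [y] wastes at most [2 * c + 1]. *)
Lemma busemann_hit (eta : boundary X) (x y : X) (s c : R) :
  0 <= s -> d y (rayto M x eta s) < c ->
  - d x y <= busemann eta y x <= 2 * c + 1 - d x y.
Proof.
move=> s0 hs; set r := rayto M x eta in hs *.
have /bclassP[K0 hK] : bclass r = bclass (brepr eta) by rewrite breprK bclass_rayto.
have r0 : r 0 = x by exact: rayto0.
have K00 : 0 <= K0 by apply: le_trans (hK 0 (lexx 0)); exact: mdist_ge0.
have sK : 0 <= s * K0 by exact: mulr_ge0.
pose t0 := s + 2 * (s * K0) + 1.
apply: (@busemann_between _ _ _ _ _ t0) => t t0t.
have t_gt0 : 0 < t by move: t0t; rewrite /t0; lra.
set z := brepr eta t.
apply/andP; split.
  by have := metric_triangle x y z; rewrite -subr_ge0; lra.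
have st : 0 <= s <= t by rewrite s0/=; move: t0t; rewrite /t0; lra.
have rz : d (r t) z <= K0 by exact: hK (ltW t_gt0).
have f01 := ray_frac st t_gt0.
have sKt : s / t * K0 <= 1 / 2.
  rewrite mulrAC ler_pdivrMr//; move: t0t; rewrite /t0; lra.
pose w := geo M x z (s / t).
have wr : d w (r s) <= 1 / 2.
  apply: le_trans sKt; rewrite (ray_geo M r st t_gt0) r0 /w.
  apply: (le_trans (geo_convexl M _ _ _ f01)); rewrite (metric_sym z).
  by apply: ler_wpM2l rz; have /andP[] := f01.
have xt : t - K0 <= d x z.
  have := metric_triangle x z (r t).
  have := ray_dist r (lexx 0) (ltW t_gt0).
  by rewrite r0 sub0r normrN (ger0_norm (ltW t_gt0)) (metric_sym z); lra.
have wz : d w z <= d x z - s + 1 / 2.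
  rewrite /w geo_distr// mulrBl mul1r.
  have : s / t * (t - K0) <= s / t * d x z.
    by apply: ler_wpM2l xt; have /andP[] := f01.
  by rewrite mulrBr divfK ?gt_eqF//; lra.
have sx : d x y - c <= s.
  have := metric_triangle x (r s) y; have := ray_dist r (lexx 0) s0.
  by rewrite r0 sub0r normrN (ger0_norm s0) (metric_sym (r s)); lra.
have := metric_triangle y (r s) z; have := metric_triangle (r s) w z.
by rewrite (metric_sym (r s) w); lra.
Qed.

End Busemann.

Lemma prod_isomK (R : realType) (X1 X2 : metricType R)
    (k : isometryType X1 * isometryType X2) (x : l2prod X1 X2) :
  prod_isom k (prod_isom k^-1%g x) = x.
Proof.
by rewrite /prod_isom/=; case: x => x1 x2; congr (_, _); exact: isom_invK.
Qed.

(** * Densities and the measure of shadows *)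

Section Densities.
Context (R : realType) (X1 X2 : metricType R).
Context (M1 : cnspace X1) (M2 : cnspace X2).
Local Notation d := mdist.
Local Notation X := (l2prod X1 X2).
Local Notation M := (prod_cnspace M1 M2).
Local Notation G := (isometryType X1 * isometryType X2)%type.
Context (o : X) (xi0 : boundary X) (Gamma : groupClosed G) (theta b1 b2 : R).
Local Notation bX := (tboundary o xi0).
Context (mu : X -> {finite_measure set bX -> \bar R}).
Hypothesis theta_in : 0 < theta < pi / 2.
Hypothesis density : invariant_density [set` Gamma] b1 b2 theta mu.
Local Notation shadow := (shadow M1 M2 theta).
Local Open Scope ereal_scope.

(** Off the support every point has a null neighbourhood, and a countable base reduces these to
    countably many. *)
Lemma ae_msupport (nu : {finite_measure set bX -> \bar R}) :
  {ae nu, forall xi, msupport nu xi}.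
Proof.
have [V [oV hV]] := @countable_base R X M o xi0.
pose V' m i := if nu (V m i) == 0 then V m i else set0.
have V'0 m i : nu.-negligible (V' m i).
  apply/negligibleP; rewrite /V'; case: ifPn => // /eqP//.
  by move=> _; exact: open_measurable_boundary.
apply: (@negligibleS _ _ _ _ (\bigcup_m \bigcup_i V' m i)); last first.
  by apply: negligible_bigcup => m; exact: negligible_bigcup.
move=> xi /= nxi.
have [U [oU [Uxi U0]]] : exists U : set bX, open U /\ U xi /\ nu U = 0.
  apply: contrapT => h; apply: nxi => U oU Uxi; rewrite lt0e measure_ge0 andbT.
  by apply/eqP => U0; apply: h; exists U.
have [m [i [Vxi VU]]] := hV U xi oU Uxi.
exists m => //; exists i => //; rewrite /V'; case: ifPn => // /negP[].
rewrite eq_le measure_ge0 andbT -U0 le_measure ?inE//; exact: open_measurable_boundary.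
Qed.

Lemma ae_mono (nu : {finite_measure set bX -> \bar R}) (P Q : bX -> Prop) :
  {ae nu, forall xi, P xi} -> (forall xi, P xi -> Q xi) ->
  {ae nu, forall xi, Q xi}.
Proof. by move=> hP PQ; apply: negligibleS hP => xi /= nQ /PQ. Qed.

Definition exponent (x : X) (eta1 : boundary X1) (eta2 : boundary X2) : R :=
  (b1 * busemann eta1 o.1 x.1 + b2 * busemann eta2 o.2 x.2)%R.

Local Notation RN x := (Radon_Nikodym (charge_of_finite_measure (mu x)) (mu o)).

Lemma density_RN x : {ae mu o, forall xi, exists eta1 eta2,
  bpoint eta1 eta2 theta xi /\ RN x xi = (expR (exponent x eta1 eta2))%:E}.
Proof.
apply: filterS2 (ae_msupport (mu o)) (density_derivative density x) => xi sxi.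
have [_ [eta1 [eta2 bp]]] := density_support density sxi.
by move=> /(_ sxi _ _ bp) e; exists eta1, eta2.
Qed.

Lemma measurable_RN x (E : set bX) : measurable_fun E (RN x : bX -> \bar R).
Proof.
have dom : (charge_of_finite_measure (mu x)) `<< mu o := density_dominated density x.
apply: measurable_funTS.
have := Radon_Nikodym_integrable dom.
exact: measurable_int.
Qed.

(** The positive part makes the integrand nonnegative everywhere; the derivative itself is positive
    almost everywhere. *)
Lemma density_integral x (E : set bX) : measurable E ->
  mu x E = \int[mu o]_(xi in E) ((RN x : bX -> \bar R) ^\+ xi).
Proof.
move=> mE.
have dom : (charge_of_finite_measure (mu x)) `<< mu o := density_dominated density x.
rewrite -(_ : charge_of_finite_measure (mu x) E = mu x E)//.
rewrite (Radon_Nikodym_integral dom mE).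
apply: ae_eq_integral => //; first exact: measurable_RN.
  by apply: measurable_funepos; exact: measurable_RN.
apply: (ae_mono (density_RN x)) => xi [eta1 [eta2 [_ e]]] _.
by rewrite -[LHS]/(RN x xi) funeposE e max_l// lee_fin expR_ge0.
Qed.

Lemma measurable_RNpos x (E : set bX) :
  measurable_fun E ((RN x : bX -> \bar R) ^\+).
Proof. by apply: measurable_funepos; exact: measurable_RN. Qed.

Lemma density_ge x (E : set bX) (m : R) : measurable E ->
  (forall xi eta1 eta2, E xi -> bpoint eta1 eta2 theta xi ->
     (m <= exponent x eta1 eta2)%R) ->
  (expR m)%:E * mu o E <= mu x E.
Proof.
move=> mE h; rewrite (density_integral x mE) -(@integral_cst _ _ _ (mu o) E mE).
apply: ae_ge0_le_integral => //; try exact: measurable_RNpos.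
- by move=> xi _; rewrite lee_fin expR_ge0.
apply: (ae_mono (density_RN x)) => xi [eta1 [eta2 [bp e]]] Exi.
rewrite /= funeposE e max_l ?lee_fin ?expR_ge0// ler_expR.
exact: h bp.
Qed.

Lemma density_le x (E : set bX) (m : R) : measurable E ->
  (forall xi eta1 eta2, E xi -> bpoint eta1 eta2 theta xi ->
     (exponent x eta1 eta2 <= m)%R) ->
  mu x E <= (expR m)%:E * mu o E.
Proof.
move=> mE h; rewrite (density_integral x mE) -(@integral_cst _ _ _ (mu o) E mE).
apply: ae_ge0_le_integral => //; try exact: measurable_RNpos.
- by move=> xi _; rewrite lee_fin expR_ge0.
apply: (ae_mono (density_RN x)) => xi [eta1 [eta2 [bp e]]] Exi.
rewrite /= funeposE e max_l ?lee_fin ?expR_ge0// ler_expR.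
exact: h bp.
Qed.

Lemma density_slope : {ae mu o, forall xi, boundary_slope theta xi}.
Proof.
apply: (ae_mono (ae_msupport (mu o))) => xi /(density_support density).
by case.
Qed.

Lemma shadow_translate k p x y c : k \in Gamma ->
  mu (prod_isom k p) (shadow (prod_isom k x) (prod_isom k y) c : set bX) =
  mu p (shadow x y c : set bX).
Proof.
move=> kG; have mS : measurable (shadow (prod_isom k x) (prod_isom k y) c : set bX).
  exact: measurable_shadow.
rewrite -(density_invariant density p kG mS) /pushforward.
by rewrite (@shadow_act _ _ _ M1 M2 o xi0 theta k x y c theta_in).
Qed.

Lemma shadow_orbit k c : k \in Gamma ->
  mu o (shadow o (prod_isom k o) c : set bX) =
  mu (prod_isom k^-1%g o) (shadow (prod_isom k^-1%g o) o c : set bX).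
Proof.
move=> kG; set x := prod_isom k^-1%g o.
by rewrite -(shadow_translate x x o c kG) prod_isomK.
Qed.

Local Close Scope ereal_scope.

Lemma exponent_bound x eta1 eta2 :
  `|exponent x eta1 eta2| <= (`|b1| + `|b2|) * d o x.
Proof.
rewrite mulrDl; apply: (le_trans (ler_normD _ _)); rewrite !normrM.
apply: lerD; apply: ler_wpM2l => //.
  apply: (le_trans (busemann_bound eta1 o.1 x.1)); exact: mdist_l2prod1.
apply: (le_trans (busemann_bound eta2 o.2 x.2)); exact: mdist_l2prod2.
Qed.

Definition weight (x : X) : R := b1 * d o.1 x.1 + b2 * d o.2 x.2.

(** A ray from [x] passing near [o] in both factors has Busemann values [- d o.1 x.1] and
    [- d o.2 x.2] up to [2 * c + 1]. *)
Lemma exponent_shadow x c (xi : bX) eta1 eta2 : shadow x o c xi ->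
  bpoint eta1 eta2 theta xi ->
  `|exponent x eta1 eta2 + weight x| <= (`|b1| + `|b2|) * (2 * c + 1).
Proof.
move=> [_ [[t t0 ht] [s s0 hs]]] bp.
have [co si _] := quadrant_trig theta_in.
rewrite (bpoint_rayto M1 M2 x theta_in bp t0)/= in ht.
rewrite (bpoint_rayto M1 M2 x theta_in bp s0)/= in hs.
have := busemann_hit (mulr_ge0 t0 (ltW co)) ht.
have := busemann_hit (mulr_ge0 s0 (ltW si)) hs.
rewrite (metric_sym x.1 o.1) (metric_sym x.2 o.2) => h2 h1.
rewrite /exponent /weight addrACA -!mulrDr mulrDl.
apply: (le_trans (ler_normD _ _)); rewrite !normrM.
by apply: lerD; apply: ler_wpM2l => //; rewrite ger0_norm; clear bp; lra.
Qed.

Lemma shadow_ge x c :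
  ((expR (- weight x - (`|b1| + `|b2|) * (2 * c + 1)))%:E
     * mu o (shadow x o c : set bX) <= mu x (shadow x o c : set bX))%E.
Proof.
apply: density_ge; first exact: measurable_shadow.
move=> xi eta1 eta2 hx bp; have := exponent_shadow hx bp.
by rewrite ler_norml => /andP[h _]; clear bp hx; lra.
Qed.

Lemma shadow_le x c : (mu x (shadow x o c : set bX) <=
  (expR (- weight x + (`|b1| + `|b2|) * (2 * c + 1)))%:E
     * mu o (shadow x o c : set bX))%E.
Proof.
apply: density_le; first exact: measurable_shadow.
move=> xi eta1 eta2 hx bp; have := exponent_shadow hx bp.
by rewrite ler_norml => /andP[_ h]; clear bp hx; lra.
Qed.

Lemma weight_inv k : weight (prod_isom k^-1%g o) = weight (prod_isom k o).
Proof.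
rewrite /weight -(isomP k.1) -(isomP k.2) !isom_invK.
by rewrite (metric_sym (k.1 _)) (metric_sym (k.2 _)).
Qed.

(** By invariance this is the mass, for the measure at the image of [o] under [k^-1], of the shadow
    of [o] seen from there, on which the density is known up to bounded factors; the remaining
    factor is at most the total mass. *)
Lemma shadow_upper c : exists2 D, 0 < D & forall k, k \in Gamma ->
  (mu o (shadow o (prod_isom k o) c : set bX) <=
   (D * expR (- weight (prod_isom k o)))%:E)%E.
Proof.
pose m := fine (mu o setT); pose K := (`|b1| + `|b2|) * (2 * c + 1).
have mE : mu o setT = m%:E by rewrite /m fineK// fin_num_measure.
have m0 : 0 <= m by rewrite -lee_fin -mE.
exists ((m + 1) * expR K); first by rewrite mulr_gt0 ?expR_gt0//; lra.
move=> k kG; rewrite shadow_orbit//; apply: (le_trans (shadow_le _ _)).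
rewrite weight_inv -/K; set w := weight _.
have -> : (m + 1) * expR K * expR (- w) = expR (- w + K) * (m + 1) by rewrite expRD; ring.
have le_m : (mu o (shadow (prod_isom k^-1%g o) o c : set bX) <= (m + 1)%:E)%E.
  apply: (@le_trans _ _ m%:E); last by rewrite lee_fin; lra.
  rewrite -mE le_measure ?inE//; exact: measurable_shadow.
by rewrite EFinM; apply: lee_wpmul2l => //; rewrite lee_fin expR_ge0.
Qed.

(** Moving by the [k] of [shadow_cover] turns the shadow into a set containing [W] up to a null set.
    As [L] is finite, the measures at the points [prod_isom k o] are bounded below by a common
    multiple of [mu o]. *)
Lemma positive_shadows (g h : G) : g \in Gamma -> h \in Gamma ->
  independent_rank_one g.1 h.1 -> independent_rank_one g.2 h.2 ->
  exists c q, [/\ 0 < c, 0 < q & forall y : X,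
    (q%:E <= mu o (shadow y o c : set bX))%E].
Proof.
move=> gG hG /(independent_ping_pong M1)[P1 [Q1 [c1 [a1 [d1 [C1 [T1 pp1]]]]]]].
move=> /(independent_ping_pong M2)[P2 [Q2 [c2 [a2 [d2 [C2 [T2 pp2]]]]]]].
have [T12 T21] : T1 <= Num.max T1 T2 /\ T2 <= Num.max T1 T2.
  by rewrite !le_max !lexx orbT.
have [xi sxi] := density_support_neq0 density o.
have [W [L [c [oW Wxi LG c0 hW]]]] := shadow_cover M1 M2 gG hG
  (ping_pong_mono T12 pp1) (ping_pong_mono T21 pp2) theta_in xi.
pose E : set bX := W `&` boundary_slope theta.
have mE : measurable E.
  apply: measurableI; first exact: open_measurable_boundary.
  exact: measurable_boundary_slope.
have [B hB] := seq_bounded L (fun k => (`|b1| + `|b2|) * d o (prod_isom k o)).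
have mW := open_measurable_boundary oW.
have mS : measurable (boundary_slope theta : set bX).
  exact: measurable_boundary_slope.
have muE : mu o E = mu o W.
  have E0 : mu o (W `\` boundary_slope theta) = 0%E.
    apply/negligibleP; first exact: measurableD.
    by apply: negligibleS density_slope => z [_ nz] /= /nz.
  have -> : mu o W = (mu o (W `\` boundary_slope theta) + mu o E)%E.
    exact: measureDI.
  by rewrite E0 add0e.
have W0 : (0 < mu o W)%E := sxi W oW Wxi.
have Wfin : mu o W = (fine (mu o W))%:E.
  by rewrite fineK// fin_num_measure//; exact: open_measurable_boundary.
have w0 : 0 < fine (mu o W) by rewrite -lte_fin -Wfin.
exists c, (expR (- B) * fine (mu o W)); split=> //.
  by rewrite mulr_gt0 ?expR_gt0.
move=> y; have [k kL hk] := hW y.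
rewrite -(shadow_translate o y o c (LG _ kL)).
apply: (@le_trans _ _ (mu (prod_isom k o) E)); last first.
  by rewrite le_measure ?inE//; exact: measurable_shadow.
rewrite EFinM -Wfin -muE; apply: density_ge => // z eta1 eta2 _ _.
by have := exponent_bound (prod_isom k o) eta1 eta2; have := hB k kL;
  rewrite ler_norml; lra.
Qed.

End Densities.

(** * Exponential growth *)

Section Limits.
Context (R : realType) (T : choiceType) (X : filteredType T).
Implicit Types (f : X -> \bar R) (F : set (set X)) (l : \bar R).
Local Open Scope ereal_scope.

Lemma limf_esup_le f F l : F [set x | f x <= l] -> limf_esup f F <= l.
Proof.
move=> Fl; apply: (@le_trans _ _ (ereal_sup (f @` [set x | f x <= l]))).
  by apply: ereal_inf_lbound; exists [set x | f x <= l].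
by apply: ge_ereal_sup => _ [x xl <-].
Qed.

Lemma limf_esup_lt f F {FF : Filter F} l : limf_esup f F < l ->
  F [set x | f x < l].
Proof.
move=> /ereal_inf_lt[_ [V FV <-]] Vl; apply: filterS FV => x Vx /=.
by apply: le_lt_trans Vl; apply: ereal_sup_ubound; exists x.
Qed.

Lemma limf_einf_le f F {FF : ProperFilter F} l : F [set x | f x <= l] ->
  limf_einf f F <= l.
Proof.
move=> Fl; rewrite limf_einfE; apply: ge_ereal_sup => _ [V FV <-].
have [x [Vx xl]] := filter_ex (filterI FV Fl).
by apply: le_trans xl; apply: ereal_inf_lbound; exists x.
Qed.

Lemma limf_einf_lt f F l V : limf_einf f F < l -> F V ->
  exists2 x, V x & f x < l.
Proof.
move=> fl FV; apply: contrapT => h; move: fl; rewrite ltNge => /negP; apply.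
rewrite limf_einfE; apply: (@le_trans _ _ (ereal_inf (f @` V))).
  apply: le_ereal_inf_tmp => _ [x Vx <-]; rewrite leNgt; apply/negP => xl.
  by apply: h; exists x.
by apply: ereal_sup_ubound; exists V.
Qed.

End Limits.

Section Counting.
Context (R : realType).

Lemma lne_rate (N : \bar R) (n : nat) (r : R) : (0 <= N)%E -> (0 < n)%N ->
  ((n%:R^-1)%:E * lne N <= r%:E)%E = (N <= (expR (n%:R * r))%:E)%E.
Proof.
move=> N0 n0; rewrite lee_pdivrMl ?ltr0n// -EFinM -(lee_expeR (lne N)) lneK//.
by rewrite in_itv/= N0 leey.
Qed.

Lemma size_fibers (T : eqType) (B : finType) (f : T -> B) (s : seq T) (m : nat) :
  (forall b, (count (fun x => f x == b) s <= m)%N) -> (size s <= m * #|B|)%N.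
Proof.
move=> h; rewrite -sum1_size (partition_big f predT)//=.
apply: (@leq_trans (\sum_(b : B) m)%N); last by rewrite sum_nat_const mulnC.
by apply: leq_sum => b _; rewrite sum1_count.
Qed.

Lemma cube_expR (a : R) (n : nat) : 0 < a -> a <= 1 ->
  (a * n.+1%:R) ^+ 3 <= expR (n%:R * (3 * a)).
Proof.
move=> a0 a1; have -> : n%:R * (3 * a) = 3%:R * (n%:R * a) by ring.
rewrite expRM_natl; apply: lerXn2r; rewrite ?nnegrE ?mulr_ge0 ?expR_ge0 ?(ltW a0)//.
by apply: le_trans (expR_ge1Dx _); rewrite -natr1 mulrDr mulr1; lra.
Qed.

(** The bound [1 + x <= expR x] is used to the third power: one degree more than needed, and the
    spare factor [a ^+ 3 * n.+1%:R] absorbs [D]. *)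
Lemma square_expR (eta D : R) : 0 < eta -> exists n0 : nat, forall n, (n0 <= n)%N ->
  D * n.+1%:R ^+ 2 <= expR (n%:R * eta).
Proof.
move=> eta0; pose a := Num.min 1 (eta / 3).
have [a0 a1 a3] : [/\ 0 < a, a <= 1 & 3 * a <= eta].
  have : a <= eta / 3 by rewrite ge_min lexx orbT.
  have a1 : a <= 1 by rewrite ge_min lexx.
  have a0 : 0 < a by rewrite lt_min ltr01/=; lra.
  by split=> //; lra.
exists (Num.truncn (`|D| / a ^+ 3)).+1 => n hn.
have n0 : 0 <= n%:R :> R by [].
have a30 : 0 < a ^+ 3 by exact: exprn_gt0.
have hD : `|D| <= a ^+ 3 * n.+1%:R.
  rewrite mulrC -ler_pdivrMr//.
  have /andP[_ /ltW] := truncn_itv (divr_ge0 (normr_ge0 D) (ltW a30)).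
  by move=> /le_trans; apply; rewrite ler_nat; exact: leqW.
apply: (@le_trans _ _ (expR (n%:R * (3 * a)))); last first.
  by rewrite ler_expR ler_wpM2l.
apply: le_trans (cube_expR n a0 a1).
have -> : (a * n.+1%:R) ^+ 3 = a ^+ 3 * n.+1%:R * n.+1%:R ^+ 2 by ring.
apply: ler_wpM2r; first exact: sqr_ge0.
exact: le_trans (ler_norm D) hD.
Qed.

Lemma geometric_summable (u : nat -> \bar R) (D z : R) : 0 <= D -> 0 < z < 1 ->
  (forall n, 0 <= u n)%E -> (forall n, u n <= (D * z ^+ n)%:E)%E ->
  (\sum_(n <oo) u n < +oo)%E.
Proof.
move=> D0 /andP[z0 z1] u0 uz; apply: (@le_lt_trans _ _ (D / (1 - z))%:E); last exact: ltry.
apply: lime_le; first exact: is_cvg_nneseries.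
apply: nearW => n; apply: (@le_trans _ _ (\sum_(0 <= i < n) (D * z ^+ i)%:E)%E).
  by apply: lee_sum => i _; exact: uz.
rewrite sumEFin lee_fin; have := geometric_seriesE D (negbT (lt_eqF z1)).
move=> /(congr1 (fun f => f n)); rewrite /series/= => ->.
rewrite ler_wpM2r ?invr_ge0 ?subr_ge0 ?(ltW z1)// ler_piMr// gerBl.
by rewrite exprn_ge0 ?(ltW z0).
Qed.

End Counting.

Section Multiplicity.
Context d (T : measurableType d) (R : realType) (nu : {finite_measure set T -> \bar R}).
Local Open Scope ereal_scope.

(** The sum is the integral over [B] of the number of sets that contain a point. *)
Lemma sum_measure_le (I : eqType) (s : seq I) (A : I -> set T) (B : set T) (m : nat) :
  (forall i, measurable (A i)) -> measurable B ->
  (forall x, B x -> (count (fun i => x \in A i) s <= m)%N) ->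
  \sum_(i <- s) nu (A i `&` B) <= m%:R%:E * nu B.
Proof.
move=> mA mB h.
have -> : \sum_(i <- s) nu (A i `&` B) =
    \int[nu]_(x in B) \sum_(i <- s) (\1_(A i) x)%:E.
  rewrite ge0_integral_sum//.
  - by apply: eq_bigr => i _; rewrite integral_indic.
  - by move=> i; apply/measurable_EFinP; exact: measurable_indic.
rewrite -integral_cst//; apply: ge0_le_integral => //.
- by move=> x _; apply: sume_ge0 => i _; rewrite lee_fin.
- by apply: emeasurable_sum => i; apply/measurable_EFinP; exact: measurable_indic.
- move=> x Bx; rewrite sumEFin lee_fin.
  have -> : (\sum_(i <- s) \1_(A i) x)%R = (count (fun i => x \in A i) s)%:R :> R.
    rewrite -sum1_count natr_sum [RHS]big_mkcond/=; apply: eq_bigr => i _.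
    by rewrite indicE; case: ifP.
  by rewrite ler_nat; exact: h.
Qed.

Lemma measure_bigsetU_le (I : Type) (s : seq I) (A : I -> set T) :
  (forall i, measurable (A i)) ->
  nu (\big[setU/set0]_(i <- s) A i) <= \sum_(i <- s) nu (A i).
Proof.
move=> mA; elim: s => [|i s IH]; first by rewrite !big_nil measure0.
rewrite !big_cons; apply: (le_trans (measureU2 _ _ _)) => //.
  by apply: bigsetU_measurable => j _; exact: mA.
exact: leeD2l.
Qed.

End Multiplicity.

Section SeqSums.
Context (R : realType) (I : eqType).
Implicit Types (s : seq I) (f : I -> \bar R) (w : R).

Lemma sum_seq_ge s f w : (forall i, i \in s -> w%:E <= f i)%E ->
  (((size s)%:R * w)%:E <= \sum_(i <- s) f i)%E.
Proof.
elim: s => [|i s IH] h; first by rewrite big_nil mul0r.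
rewrite big_cons/= -natr1 mulrDl mul1r addrC EFinD; apply: leeD.
  by apply: h; rewrite mem_head.
by apply: IH => j js; apply: h; rewrite in_cons js orbT.
Qed.

Lemma sum_seq_le s f w : (forall i, i \in s -> f i <= w%:E)%E ->
  (\sum_(i <- s) f i <= ((size s)%:R * w)%:E)%E.
Proof.
elim: s => [|i s IH] h; first by rewrite big_nil mul0r.
rewrite big_cons/= -natr1 mulrDl mul1r addrC EFinD; apply: leeD.
  by apply: IH => j js; apply: h; rewrite in_cons js orbT.
by apply: h; rewrite mem_head.
Qed.

End SeqSums.

(** * Orbit points in annuli and the upper bound on growth *)

Section Orbits.
Context (R : realType) (X1 X2 : metricType R).
Context (M1 : cnspace X1) (M2 : cnspace X2).
Local Notation d := mdist.
Local Notation X := (l2prod X1 X2).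
Local Notation M := (prod_cnspace M1 M2).
Local Notation G := (isometryType X1 * isometryType X2)%type.
Context (o : X) (xi0 : boundary X) (Gamma : groupClosed G) (theta b1 b2 : R).
Local Notation bX := (tboundary o xi0).
Hypothesis theta_in : 0 < theta < pi / 2.
Hypothesis Gamma_discrete : discrete_subset [set` Gamma].
Local Notation shadow := (shadow M1 M2 theta).

(** Translating by the inverse of one element brings the whole cluster into a fixed ball about [o],
    where [finite_orbit] applies. *)
Lemma cluster_bound C : exists m : nat, forall s : seq G,
  uniq s -> {subset s <= Gamma} ->
  (forall k k', k \in s -> k' \in s -> d (prod_isom k o) (prod_isom k' o) <= C) ->
  (size s <= m)%N.
Proof.
have /finite_seqP[t tE] := finite_orbit M1 M2 o C Gamma_discrete.
exists (size t) => -[//|x s] us sG close.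
rewrite -(size_map (fun k => x^-1 * k)%g); apply: uniq_leq_size.
  by rewrite map_inj_uniq// => k k' /(congr1 (fun g => x * g)%g); rewrite !mulgA mulgV !mul1g.
move=> _ /mapP[k ks ->].
have e : prod_isom x (prod_isom (x^-1 * k)%g o) = prod_isom k o.
  by rewrite /prod_isom/= !isom_inv_funK.
have xk : d o (prod_isom (x^-1 * k)%g o) <= C.
  by rewrite -(isomP (prod_isom x)) e; apply: close; rewrite ?mem_head.
have xG : (x^-1 * k)%g \in Gamma.
  by apply: gpredM; [rewrite gpredV; apply: sG; rewrite mem_head|exact: sG].
have : [set` t] (x^-1 * k)%g by rewrite -tE; split.
exact.
Qed.

Lemma ray_neighbours (Y : metricType R) (r : ray Y) (u v : Y) (s t c : R) :
  0 <= s -> 0 <= t -> d u (r s) < c -> d v (r t) < c ->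
  `|d (r 0) u - d (r 0) v| <= 1 -> d u v <= 4 * c + 1.
Proof.
move=> s0 t0 us vt; rewrite ler_norml => uv.
have h1 := mdist_lip (r 0) u (r s); have h2 := mdist_lip (r 0) v (r t).
rewrite ray_dist// sub0r normrN (ger0_norm s0) ler_norml in h1.
rewrite ray_dist// sub0r normrN (ger0_norm t0) ler_norml in h2.
have st : d (r s) (r t) <= 2 * c + 1 by rewrite ray_dist// ler_norml; lra.
have := metric_triangle u (r s) v; have := metric_triangle (r s) (r t) v.
by rewrite (metric_sym (r t) v); lra.
Qed.

Lemma truncn_close (a b : R) : 0 <= a -> 0 <= b ->
  Num.truncn a = Num.truncn b -> `|a - b| <= 1.
Proof.
move=> a0 b0 e; have := truncn_itv a0; have := truncn_itv b0.
by rewrite e -natr1 ler_norml; lra.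
Qed.

Lemma shadow_neighbours (x y : X) c xi :
  (shadow o x c : set bX) xi -> (shadow o y c : set bX) xi ->
  Num.truncn (d o.1 x.1) = Num.truncn (d o.1 y.1) ->
  Num.truncn (d o.2 x.2) = Num.truncn (d o.2 y.2) ->
  d x y <= 8 * c + 2.
Proof.
move=> [[eta1 [eta2 bp]] [[s s0 hs] [t t0 ht]]] [_ [[s' s'0 hs'] [t' t'0 ht']]].
have [co si _] := quadrant_trig theta_in.
rewrite !(bpoint_rayto M1 M2 o theta_in bp)//= in hs ht hs' ht'.
move=> /(truncn_close (mdist_ge0 _ _) (mdist_ge0 _ _)) e1.
move=> /(truncn_close (mdist_ge0 _ _) (mdist_ge0 _ _)) e2.
rewrite -{1 2}(rayto0 M1 o.1 eta1) in e1; rewrite -{1 2}(rayto0 M2 o.2 eta2) in e2.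
have h1 := ray_neighbours (mulr_ge0 s0 (ltW co)) (mulr_ge0 s'0 (ltW co)) hs hs' e1.
have h2 := ray_neighbours (mulr_ge0 t0 (ltW si)) (mulr_ge0 t'0 (ltW si)) ht ht' e2.
by apply: (le_trans (mdist_l2prod_le _ _)); clear bp; lra.
Qed.

(* Two orbit points whose shadows meet and whose distances to o have the same
   integer parts in both factors are close to each other. *)
Lemma shadow_multiplicity c : exists m : nat, forall (n : nat) (s : seq G),
  uniq s -> {subset s <= Gamma} ->
  (forall k, k \in s -> d o (prod_isom k o) <= n%:R) -> forall xi : bX,
  (count (fun k => xi \in (shadow o (prod_isom k o) c : set bX)) s <= m * n.+1 ^ 2)%N.
Proof.
have [m hm] := cluster_bound (8 * c + 2); exists m => n s us sG sn xi.
pose D1 (k : G) := Num.truncn (d o.1 (prod_isom k o).1).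
pose D2 (k : G) := Num.truncn (d o.2 (prod_isom k o).2).
pose f (k : G) : 'I_n.+1 * 'I_n.+1 := (inord (D1 k), inord (D2 k)).
have D1n k : k \in s -> (D1 k < n.+1)%N.
  move=> /sn kn; rewrite ltnS /D1 -(ler_nat R); apply: le_trans kn.
  apply: (@le_trans _ _ (d o.1 (prod_isom k o).1)); last exact: mdist_l2prod1.
  by have /andP[] := truncn_itv (mdist_ge0 o.1 (prod_isom k o).1).
have D2n k : k \in s -> (D2 k < n.+1)%N.
  move=> /sn kn; rewrite ltnS /D2 -(ler_nat R); apply: le_trans kn.
  apply: (@le_trans _ _ (d o.2 (prod_isom k o).2)); last exact: mdist_l2prod2.
  by have /andP[] := truncn_itv (mdist_ge0 o.2 (prod_isom k o).2).
rewrite -size_filter.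
have -> : (n.+1 ^ 2)%N = #|{: 'I_n.+1 * 'I_n.+1}| by rewrite card_prod card_ord mulnn.
apply: (@size_fibers _ _ f) => b; rewrite -size_filter.
apply: hm; first by rewrite !filter_uniq.
  by move=> k; rewrite !mem_filter => /and3P[_ _ /sG].
move=> k k'; rewrite !mem_filter => /and3P[/eqP kb /set_mem xk ks].
move=> /and3P[/eqP k'b /set_mem xk' k's].
have : f k = f k' by rewrite kb.
move=> [/(congr1 val) + /(congr1 val)]; rewrite /= !inordK ?D1n ?D2n// => e1 e2.
exact: (shadow_neighbours xk xk' e1 e2).
Qed.

Definition annulus eps n : set G := [set g | [/\ g \in Gamma,
  n%:R - 1 < d o (prod_isom g o) <= n%:R &
  `|slope_angle o (prod_isom g o) - theta| < eps]].

Lemma annulus_seq eps n : exists s : seq G, [/\ uniq s,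
  forall k, k \in s <-> annulus eps n k &
  orbit_count o [set` Gamma] theta eps n = (size s)%:R%:E].
Proof.
have fin : finite_set (annulus eps n).
  apply: sub_finite_set (finite_orbit M1 M2 o n%:R Gamma_discrete) => k [kG /andP[_ kn] _].
  by split.
exists (finmap.enum_fset (fset_set (annulus eps n))); split.
- exact: finmap.fset_uniq.
- by move=> k; rewrite in_fset_set// inE.
- by rewrite /orbit_count /counting asboolT.
Qed.

Local Notation beta := (b1 * cos theta + b2 * sin theta).

(** In polar coordinates the weight is the distance from [o] times a continuous function of the
    slope with value [beta] at [theta]; the constant term comes from replacing the distance by
    [n]. *)
Lemma weight_annulus eta : 0 < eta -> exists2 e0, 0 < e0 & forall eps n k,
  eps <= e0 -> annulus eps n k ->
  `|weight o b1 b2 (prod_isom k o) - n%:R * beta| <= `|beta| + n%:R * eta.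
Proof.
move=> eta0; pose F (t : R) := b1 * cos t + b2 * sin t.
have cF : {for theta, continuous F}.
  apply: continuousD; apply: continuousM; try exact: cvg_cst.
    exact: continuous_cos.
  exact: continuous_sin.
have [e0 e00 he0] : exists2 e0, 0 < e0 & forall t, `|t - theta| < e0 ->
    `|F t - F theta| < eta.
  move/cvgrPdist_lt : cF => /(_ _ eta0) /nbhs_ballP[e0 /= e00 h].
  by exists e0 => // t te; rewrite distrC; apply: h; rewrite /ball/= distrC.
exists e0 => // eps n k epse0 [_ /andP[n1 n2] sl].
have [_ E1 E2] := slope_polar o (prod_isom k o).
set dk := d o (prod_isom k o) in n1 n2 E1 E2 *.
set phi := slope_angle o (prod_isom k o) in sl E1 E2 *.
have dk0 : 0 <= dk by exact: mdist_ge0.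
have hphi := he0 phi (lt_le_trans sl epse0).
have -> : weight o b1 b2 (prod_isom k o) = dk * F phi.
  by rewrite /weight E1 E2 /F; ring.
have -> : dk * F phi - n%:R * beta = (dk - n%:R) * beta + dk * (F phi - F theta).
  by rewrite /F; ring.
apply: (le_trans (ler_normD _ _)); rewrite !normrM; apply: lerD.
  by rewrite ler_piMl// ler_norml; lra.
rewrite (ger0_norm dk0); apply: ler_pM => //; exact: ltW.
Qed.

Context (mu : X -> {finite_measure set bX -> \bar R}).
Hypothesis density : invariant_density [set` Gamma] b1 b2 theta mu.
Local Notation weight := (weight o b1 b2).

Lemma shadow_lower c q : 0 < q ->
  (forall y : X, (q%:E <= mu o (shadow y o c : set bX))%E) ->
  exists2 D, 0 < D & forall k, k \in Gamma ->
  ((D * expR (- weight (prod_isom k o)))%:E <=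
    mu o (shadow o (prod_isom k o) c : set bX))%E.
Proof.
move=> q0 hq; pose K := (`|b1| + `|b2|) * (2 * c + 1).
exists (q * expR (- K)); first by rewrite mulr_gt0 ?expR_gt0.
move=> k kG.
have -> : mu o (shadow o (prod_isom k o) c : set bX) =
    mu (prod_isom k^-1%g o) (shadow (prod_isom k^-1%g o) o c : set bX).
  exact: (shadow_orbit _ _ theta_in density).
have := shadow_ge M1 M2 theta_in density (prod_isom k^-1%g o) c.
apply: le_trans; rewrite weight_inv -/K expRD.
rewrite (_ : _ * _ * _ = expR (- weight (prod_isom k o)) * expR (- K) * q); last by ring.
by rewrite EFinM; apply: lee_wpmul2l => //; rewrite lee_fin mulr_ge0 ?expR_ge0.
Qed.

(** Each shadow has mass at least [w], and by the multiplicity bound the masses add up to at most a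
    quadratic multiple of the total mass. Half of [eta] pays for the weights, the other half for the
    quadratic factor. *)
Lemma orbit_upper c q eta : 0 < q ->
  (forall y : X, (q%:E <= mu o (shadow y o c : set bX))%E) -> 0 < eta ->
  exists2 e0, 0 < e0 & exists N, forall eps n, eps <= e0 -> (N <= n)%N ->
  (orbit_count o [set` Gamma] theta eps n <= (expR (n%:R * (beta + eta)))%:E)%E.
Proof.
move=> q0 hq eta0; have eta2 : 0 < eta / 2 by lra.
have [D D0 hD] := shadow_lower q0 hq.
have [m hm] := shadow_multiplicity c.
have [e0 e00 he] := weight_annulus eta2.
pose Mu := fine (mu o setT).
have MuE : mu o setT = Mu%:E by rewrite /Mu fineK// fin_num_measure.
have [N hN] := square_expR (m%:R * Mu * expR `|beta| / D) eta2.
exists e0 => //; exists N => eps n epse0 Nn.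
have [s [us sE ->]] := annulus_seq eps n; rewrite lee_fin.
have sG : {subset s <= Gamma} by move=> k /sE[].
pose w := D * expR (- (n%:R * beta + `|beta| + n%:R * (eta / 2))).
have w0 : 0 < w by rewrite mulr_gt0 ?expR_gt0.
have hw k : k \in s -> (w%:E <= mu o (shadow o (prod_isom k o) c : set bX))%E.
  move=> ks; apply: le_trans (hD k (sG _ ks)).
  rewrite lee_fin ler_wpM2l ?(ltW D0)// ler_expR lerN2.
  by have := he eps n k epse0 ((sE k).1 ks); rewrite ler_norml; lra.
have le1 : (((size s)%:R * w)%:E <=
    \sum_(k <- s) mu o ((shadow o (prod_isom k o) c : set bX) `&` setT))%E.
  by apply: sum_seq_ge => k /hw; rewrite setIT.
have le2 : (size s)%:R * w <= (m * n.+1 ^ 2)%:R * Mu.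
  rewrite -lee_fin; apply: (le_trans le1); rewrite EFinM -MuE.
  apply: sum_measure_le => // [k|xi _]; first exact: measurable_shadow.
  apply: (hm n) => // k /sE[_ /andP[]//].
have le3 : (size s)%:R <= m%:R * Mu * expR `|beta| / D * n.+1%:R ^+ 2 *
    expR (n%:R * (beta + eta / 2)).
  rewrite -ler_pdivlMr// in le2; apply: (le_trans le2).
  rewrite natrM natrX /w invfM -expRN opprK le_eqVlt; apply/orP; left; apply/eqP.
  rewrite (_ : n%:R * beta + `|beta| + n%:R * (eta / 2) =
     `|beta| + n%:R * (beta + eta / 2)); last by ring.
  by rewrite expRD; ring.
apply: (le_trans le3); rewrite (_ : n%:R * (beta + eta) =
  n%:R * (eta / 2) + n%:R * (beta + eta / 2)); last by field.
by rewrite expRD; apply: ler_wpM2r; [exact: expR_ge0|exact: hN].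
Qed.

Lemma growth_upper c q : 0 < q ->
  (forall y : X, (q%:E <= mu o (shadow y o c : set bX))%E) ->
  (growth_exponent o [set` Gamma] theta <= beta%:E)%E.
Proof.
move=> q0 hq; apply/lee_addgt0Pr => eta eta0.
have [e0 e00 [N hN]] := orbit_upper q0 hq eta0.
have ie : 0^'+ [set eps : R | eps <= e0] := nbhs_right_le e00.
have i1 : \oo [set n | (N <= n)%N] := nbhs_infty_ge N.
have i2 : \oo [set n | (0 < n)%N] := nbhs_infty_gt 0.
apply: limf_einf_le; apply: filterS ie => eps epse0 /=; apply: limf_esup_le.
apply: filterS (filterI i1 i2) => n [/= Nn n0]; rewrite -EFinD.
have N0 : (0 <= orbit_count o [set` Gamma] theta eps n)%E.
  by have [s [_ _ ->]] := annulus_seq eps n; rewrite lee_fin.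
by rewrite (lne_rate _ N0 n0); exact: hN.
Qed.

Lemma annulus_measure_le c eta : 0 < eta -> exists2 e0, 0 < e0 &
  exists D, forall eps n (r : R), eps <= e0 ->
  (orbit_count o [set` Gamma] theta eps n <= (expR (n%:R * r))%:E)%E ->
  (mu o (\bigcup_(k in annulus eps n) (shadow o (prod_isom k o) c : set bX)) <=
    (D * expR (n%:R * (r - beta + eta)))%:E)%E.
Proof.
move=> eta0; have [D D0 hD] := shadow_upper M1 M2 theta_in density c.
have [e0 e00 he] := weight_annulus eta0.
exists e0 => //; exists (D * expR `|beta|) => eps n r epse0.
have [s [us sE ->]] := annulus_seq eps n; rewrite lee_fin => sr.
have -> : \bigcup_(k in annulus eps n) (shadow o (prod_isom k o) c : set bX) =
    \big[setU/set0]_(k <- s) (shadow o (prod_isom k o) c : set bX).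
  rewrite -bigcup_seq; apply: eq_bigcupl.
  by split=> k /sE.
apply: (le_trans (@measure_bigsetU_le _ _ _ (mu o) _ s _ _)) => [k|]; first exact: measurable_shadow.
pose w := D * expR (- (n%:R * beta) + `|beta| + n%:R * eta).
have hw k : k \in s -> (mu o (shadow o (prod_isom k o) c : set bX) <= w%:E)%E.
  move=> ks; have [kG _ _] := (sE k).1 ks; apply: le_trans (hD k kG) _.
  rewrite lee_fin ler_wpM2l ?(ltW D0)// ler_expR.
  by have := he eps n k epse0 ((sE k).1 ks); rewrite ler_norml; lra.
apply: (@le_trans _ _ ((size s)%:R * w)%:E).
  exact: sum_seq_le.
rewrite lee_fin; apply: (@le_trans _ _ (expR (n%:R * r) * w)).
  by apply: ler_wpM2r => //; rewrite mulr_ge0 ?expR_ge0// ltW.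
rewrite /w (_ : n%:R * (r - beta + eta) = n%:R * r - n%:R * beta + n%:R * eta); last by ring.
by rewrite !expRD le_eqVlt; apply/orP; left; apply/eqP; ring.
Qed.

End Orbits.

(** * Lower bound on growth by Borel-Cantelli *)

Section GrowthLower.
Context (R : realType) (X1 X2 : metricType R).
Context (M1 : cnspace X1) (M2 : cnspace X2).
Local Notation d := mdist.
Local Notation X := (l2prod X1 X2).
Local Notation M := (prod_cnspace M1 M2).
Local Notation G := (isometryType X1 * isometryType X2)%type.
Context (o : X) (xi0 : boundary X) (Gamma : groupClosed G) (theta b1 b2 : R).
Local Notation bX := (tboundary o xi0).
Hypothesis theta_in : 0 < theta < pi / 2.
Hypothesis Gamma_discrete : discrete_subset [set` Gamma].
Local Notation shadow := (shadow M1 M2 theta).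
Local Notation beta := (b1 * cos theta + b2 * sin theta).
Context (mu : X -> {finite_measure set bX -> \bar R}).
Hypothesis density : invariant_density [set` Gamma] b1 b2 theta mu.

(** The scale [k] is taken past [n0] with [k.+1%:R^-1] below the margin of [cos_close]. Then
    [speed_stopped] controls the slope of the orbit point, and its distance to [o], hence its
    annulus index, exceeds [n0]. *)
Lemma radial_annulus (c eps : R) (xi : bX) (n0 : nat) : 0 < eps ->
  boundary_slope theta xi ->
  (forall k, radial_approx M1 M2 [set` Gamma] c k xi) ->
  exists2 n, (n0 <= n)%N & exists2 g, annulus o Gamma theta eps n g &
    shadow o (prod_isom g o) c xi.
Proof.
move=> eps0 sl hrad; have [co si _] := quadrant_trig theta_in.
have [eta1 [eta2 bp]] := sl.
have [s1 s2] := bpoint_speed M1 M2 o theta_in bp.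
have [dl dl0 hdl] := cos_close theta_in eps0.
have i1 : \oo [set k : nat | k.+1%:R^-1 < dl] := near_infty_natSinv_lt (PosNum dl0).
have i2 : \oo [set k : nat | (n0 <= k)%N] := nbhs_infty_ge n0.
have [k /= kdl n0k] := filterI_ex i1 i2.
have [g gG [gk gray gh1 gh2]] := hrad k.
have k0 : 0 < k.+1%:R :> R by rewrite ltr0n.
have k1 : 1 <= k.+1%:R :> R by rewrite ler1n.
have exn : exists n, d o (prod_isom g o) <= n%:R.
  exists (Num.truncn (d o (prod_isom g o))).+1.
  by have /andP[_ /ltW] := truncn_itv (mdist_ge0 o (prod_isom g o)).
(* The least such [n] is the distance rounded up, whence the strict lower bound of the annulus. *)
case: (ex_minnP exn) => n gn nmin; exists n.
  by apply: (leq_trans n0k); rewrite -(ler_nat R); move: gk; rewrite -natr1; lra.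
have h1 : hit1 M1 M2 o (prod_isom g o) c xi by apply: gh1; rewrite s1.
have h2 : hit2 M1 M2 o (prod_isom g o) c xi by apply: gh2; rewrite s2.
exists g; last by split.
split=> //.
  rewrite gn andbT ltNge; apply/negP => gn1.
  have n_gt0 : (0 < n)%N.
    by rewrite -(ltr_nat R); apply: lt_le_trans gn; apply: le_lt_trans gk; rewrite ltW.
  have : (n <= n.-1)%N.
    by apply: nmin; move: gn1; rewrite -{1}(prednK n_gt0) -natr1 addrK.
  by rewrite leqNgt prednK// leqnn.
have [phi01 _ _] := slope_polar o (prod_isom g o).
apply: hdl => //; apply: le_lt_trans kdl.
have := @speed_stopped _ _ _ M1 M2 o (prod_isom g o) xi k.+1%:R k0 (ltW gk).
rewrite s1 => h; apply: (@le_trans _ _ (k.+1%:R * `|cos theta - cos (slope_angle o (prod_isom g o))|)).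
  by rewrite ler_peMl.
by apply: ltW; apply: le_lt_trans gray.
Qed.

Local Notation approx := (@radial_approx _ _ _ M1 M2 o xi0 [set` Gamma]).

(** With this [eta] the exponent [r - beta + eta] equals [- eta]: the unions of shadows over the
    annuli have summable measures, and Borel-Cantelli applies. *)
Lemma radial_null (c r : R) :
  (growth_exponent o [set` Gamma] theta < r%:E)%E -> r < beta ->
  (mu o).-negligible (boundary_slope theta `&`
    \bigcap_(k in [set: nat]) approx c k : set bX).
Proof.
move=> growth rbeta; pose eta := (beta - r) / 2.
have eta0 : 0 < eta by rewrite /eta; lra.
have [e0 e00 [D hD]] :=
  annulus_measure_le M1 M2 theta_in Gamma_discrete density c eta0.
have ie1 : 0^'+ [set eps : R | eps <= e0] := nbhs_right_le e00.
have ie2 : 0^'+ [set eps : R | 0 < eps] := nbhs_right_gt 0.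
have [eps [/= epse0 eps0] heps] := limf_einf_lt growth (filterI ie1 ie2).
have i1 : \oo [set n | ((n%:R^-1)%:E *
    lne (orbit_count o [set` Gamma] theta eps n) < r%:E)%E].
  exact: limf_esup_lt heps.
have i2 : \oo [set n | (0 < n)%N] := nbhs_infty_gt 0.
have [N _ hN] := filterI i1 i2.
have small n : (N <= n)%N ->
    (orbit_count o [set` Gamma] theta eps n <= (expR (n%:R * r))%:E)%E.
  move=> /hN[/= h n0].
  have N0 : (0 <= orbit_count o [set` Gamma] theta eps n)%E.
    have [s [_ _ ->]] := annulus_seq M1 M2 o theta Gamma_discrete eps n.
    by rewrite lee_fin.
  by rewrite -(lne_rate _ N0 n0) ltW.
(* The count is controlled only from [N] on; emptying the earlier sets leaves the limit superior
   unchanged. *)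
pose F n : set bX := if (N <= n)%N then
  \bigcup_(k in annulus o Gamma theta eps n) (shadow o (prod_isom k o) c : set bX)
  else set0.
have mF n : measurable (F n).
  rewrite /F; case: ifP => // _.
  have [s [_ sE _]] := annulus_seq M1 M2 o theta Gamma_discrete eps n.
  apply: fin_bigcup_measurable => [|k _]; last exact: measurable_shadow.
  by apply: sub_finite_set (finite_seq s) => k /sE.
have F0 : mu o (lim_sup_set F) = 0%E.
  apply: lim_sup_set_cvg0 => //.
  apply: (@geometric_summable _ _ `|D| (expR (- eta))) => // [|n].
    by rewrite expR_gt0 expR_lt1; lra.
  rewrite /F; case: ifPn => [Nn|_]; last first.
    by rewrite measure0 lee_fin mulr_ge0// exprn_ge0// expR_ge0.
  apply: (le_trans (hD _ _ _ epse0 (small _ Nn))).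
  rewrite lee_fin -expRM_natl (_ : r - beta + eta = - eta); last by rewrite /eta; field.
  by apply: ler_wpM2r; [exact: expR_ge0|exact: ler_norm].
exists (lim_sup_set F); split=> //.
  by apply: bigcap_measurable => // k _; exact: bigcup_measurable.
move=> xi [sl hrad] n0 _.
have [n n0n [g gA gxi]] := radial_annulus (maxn n0 N) eps0 sl (fun k => hrad k I).
rewrite geq_max in n0n; have [n0n' Nn] := andP n0n.
by exists n => //; rewrite /F Nn; exists g.
Qed.

Lemma growth_lower : (0 < mu o (radial_limit_set o [set` Gamma]))%E ->
  (beta%:E <= growth_exponent o [set` Gamma] theta)%E.
Proof.
move=> rad; rewrite leNgt; apply/negP => growth.
have [r gr rbeta] : exists2 r : R,
    (growth_exponent o [set` Gamma] theta < r%:E)%E & r < beta.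
  move: growth; case: (growth_exponent _ _ _) => [g|//|] h.
  - exists ((g + beta) / 2); rewrite ?lte_fin; move: h; rewrite lte_fin; lra.
  - by exists (beta - 1); rewrite ?ltNyr//; lra.
have : (mu o).-negligible (radial_limit_set o [set` Gamma] : set bX).
  have n1 : (mu o).-negligible (\bigcup_(c in [set: nat]) (boundary_slope theta `&`
      \bigcap_(k in [set: nat]) approx c%:R k) : set bX).
    by apply: negligible_bigcup => c; exact: (radial_null c%:R gr rbeta).
  have n2 : (mu o).-negligible (~` boundary_slope theta : set bX).
    exact: (density_slope M1 M2 density).
  apply: negligibleS (negligibleU n1 n2) => xi.
  rewrite (@radial_limit_setE _ _ _ M1 M2 o xi0 [set` Gamma]) => -[c _ hc].
  have [sl|nsl] := pselect (boundary_slope theta xi); last by right.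
  by left; exists c.
move=> null; have e : mu o (radial_limit_set o [set` Gamma]) = 0%E.
  by apply/negligibleP; [exact: measurable_radial_limit_set|].
by rewrite e ltxx in rad.
Qed.

End GrowthLower.

Theorem theoremD (R : realType) (X1 X2 : metricType R)
  (hadamard1 : hadamard X1) (hadamard2 : hadamard X2)
  (lcompact1 : locally_compact [set: X1])
  (lcompact2 : locally_compact [set: X2])
  (o : l2prod X1 X2)
  (Gamma : groupClosed (isometryType X1 * isometryType X2)%type)
  (Gamma_discrete : discrete_subset [set` Gamma])
  (Gamma_independent : exists g h : isometryType X1 * isometryType X2,
     [/\ g \in Gamma, h \in Gamma, independent_rank_one g.1 h.1 &
         independent_rank_one g.2 h.2])
  (xi0 : boundary (l2prod X1 X2))
  (theta b1 b2 : R) (theta_in : 0 < theta < pi / 2)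
  (mu : l2prod X1 X2 -> {finite_measure set (tboundary o xi0) -> \bar R})
  (mu_density : invariant_density [set` Gamma] b1 b2 theta mu)
  (mu_radial : (0 < mu o (radial_limit_set o [set` Gamma]))%E) :
  growth_exponent o [set` Gamma] theta =
    (b1 * cos theta + b2 * sin theta)%:E.
Proof.
have M1 := hadamard_cnspace hadamard1 lcompact1.
have M2 := hadamard_cnspace hadamard2 lcompact2.
have [g [h [gG hG gh1 gh2]]] := Gamma_independent.
have [c [q [_ q0 hq]]] := positive_shadows M1 M2 theta_in mu_density gG hG gh1 gh2.
apply/eqP; rewrite eq_le; apply/andP; split.
  exact: (growth_upper theta_in Gamma_discrete mu_density q0 hq).
exact: (growth_lower M1 M2 theta_in Gamma_discrete mu_density mu_radial).
Qed.
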